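(* Let $m\ge 1$ be an integer. Let $\varphi\in C^0([0,\infty))\cap C^1((0,\infty))$ with $\varphi(0)=0$ and $\varphi'>0$ on $(0,\infty)$. Let $f\in C^0([0,\infty))$ be strictly increasing on $[0,\infty)$ with $f>0$ on $(0,\infty)$. Let $l\in C^0([0,\infty))$ with $l>0$ on $(0,\infty)$, and suppose that $l$ is $C$-monotone non-decreasing for some $C\ge 1$, i.e. $\sup_{s\in[0,t]} l(s)\le C\,l(t)$ for all $t\ge 0$. Suppose that $$\frac{t\varphi'(t)}{l(t)}\in L^1(0^+)\setminus L^1(+\infty),\qquad \frac{\varphi(t)}{l(t)}=o(1)\ \text{ as } t\to 0^+ .$$ Set $K(t)=\int_0^t \frac{s\varphi'(s)}{l(s)}\,ds$ and $F(t)=\int_0^t f(s)\,ds$ for $t\ge 0$, and assume $$\frac{1}{K^{-1}(F(t))}\in L^1(+\infty).$$ Let $u\in C^1(\mathbb{R}^m)$ be a non-negative weak solution of $$\Delta^\varphi_{\mathbb{R}^m}u=\operatorname{div}\left(|\nabla u|^{-1}\varphi(|\nabla u|)\nabla u\right)\ \ge\ f(u)\,l(|\nabla u|)\qquad\text{on }\mathbb{R}^m .$$ Then $u$ is constant. Moreover, if $l(0)>0$, then $u\equiv 0$.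
   Context: $L^1(0^+)$, resp. $L^1(+\infty)$, means integrable in a right neighbourhood of $0$, resp. in a neighbourhood of $+\infty$. Under the hypotheses $K$ is an increasing bijection of $[0,\infty)$ onto itself, with inverse $K^{-1}$. The differential inequality is understood weakly: for all $\zeta\in C_0^\infty(\mathbb{R}^m)$ with $\zeta\ge 0$, $-\int_{\mathbb{R}^m}|\nabla u|^{-1}\varphi(|\nabla u|)\langle\nabla u,\nabla\zeta\rangle\ge\int_{\mathbb{R}^m}f(u)\,l(|\nabla u|)\,\zeta$, where the integrand on the left is $0$ where $\nabla u=0$. *)

(* Defs.v *)
From HB Require Import structures.
From mathcomp Require Import all_boot all_order all_algebra.
From mathcomp Require Import all_classical all_reals all_analysis.

Set Implicit Arguments.
Unset Strict Implicit.
Unset Printing Implicit Defensive.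
Import Order.TTheory GRing.Theory Num.Theory.
Import numFieldNormedType.Exports.
Local Open Scope classical_set_scope.
Local Open Scope ring_scope.

(* The library only has Lebesgue measure on [R].  On [n]-tuples of reals, with
   their product sigma-algebra, Lebesgue measure is built by iterating the
   binary product measure; [lebesgue_tuple_box] is the usual characterization
   of the result. *)

Section lebesgue_tuple.
Context {R : realType}.
Local Notation T := (measurableTypeR R).

Definition tcons n (p : T * n.-tuple T) : n.+1.-tuple T :=
  [tuple of p.1 :: p.2].

Lemma measurable_tcons n : measurable_fun [set: T * n.-tuple T] (@tcons n).
Proof. exact: measurable_cons. Qed.

Lemma measurable_tuncons n : measurable_fun [set: n.+1.-tuple T]
  (fun t : n.+1.-tuple T => (thead t, [tuple of behead t]) : T * n.-tuple T).
Proof.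
apply: measurable_fun_pair; last exact: measurable_behead.
exact: (@measurable_tnth _ T n.+1 ord0).
Qed.

Section step.
Variables (n : nat) (mu : {sigma_finite_measure set (n.-tuple T) -> \bar R}).

Definition lebesgue_step : set (n.+1.-tuple T) -> \bar R :=
  pushforward (lebesgue_measure \x mu)%E (@tcons n).

Let nu : {measure set (n.+1.-tuple T) -> \bar R}.
Proof.
refine [the {measure set (n.+1.-tuple T) -> \bar R} of
  pushforward (lebesgue_measure \x mu)%E (@tcons n)].
exact: measurable_tcons.
Defined.

HB.instance Definition _ := isMeasure.Build _ _ _ lebesgue_step
  (measure0 nu) (measure_ge0 nu) (@measure_semi_sigma_additive _ _ _ nu).

Let lebesgue_step_sigma_finite : sigma_finite setT lebesgue_step.
Proof.
have /sigma_finiteP[F [TF ndF Foo]] :=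
  sigma_finiteT (@lebesgue_measure R).
have /sigma_finiteP[G [TG ndG Goo]] := sigma_finiteT mu.
exists (fun i => (fun t : n.+1.-tuple T =>
  (thead t, [tuple of behead t]) : T * n.-tuple T) @^-1` (F i `*` G i)).
  apply/esym; rewrite -subTset => t _.
  have [i _ Fi] : (\bigcup_i F i) (thead t) by rewrite -TF.
  have [j _ Gj] : (\bigcup_i G i) [tuple of behead t] by rewrite -TG.
  exists (maxn i j) => //; split=> /=.
    by move: Fi; exact/subsetPset/ndF/leq_maxl.
  by move: Gj; exact/subsetPset/ndG/leq_maxr.
move=> i; have [mF Fi] := Foo i; have [mG Gi] := Goo i; split.
  rewrite -[X in measurable X]setTI; apply: measurable_tuncons => //.
  exact: measurableX.
rewrite /lebesgue_step /pushforward -comp_preimage (_ : _ \o _ = id).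
  by rewrite preimage_id product_measure1E// lte_mul_pinfty// ge0_fin_numE.
apply/funext => -[x t] /=; congr (_, _).
exact: val_inj.
Qed.

HB.instance Definition _ := Measure_isSigmaFinite.Build _ _ _
  lebesgue_step lebesgue_step_sigma_finite.
End step.

Fixpoint lebesgue_tuple n : {sigma_finite_measure set (n.-tuple T) -> \bar R} :=
  match n with
  | 0%N => dirac [tuple] : {sigma_finite_measure set (0.-tuple T) -> \bar R}
  | n'.+1 => lebesgue_step (lebesgue_tuple n')
  end.

Lemma measurable_tuple_box n (A : 'I_n -> set T) :
  (forall i, measurable (A i)) ->
  measurable [set t : n.-tuple T | forall i, A i (tnth t i)].
Proof.
move=> mA.
rewrite (_ : mkset _ = \bigcap_(i in [set: 'I_n]) ((@tnth n T)^~ i @^-1` A i)).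
  apply: fin_bigcap_measurable => // i _.
  by rewrite -[X in measurable X]setTI; exact: measurable_tnth.
by apply/seteqP; split=> t At i; [move=> _; exact: At|exact: (At i Logic.I)].
Qed.

Lemma lebesgue_tuple_box n (A : 'I_n -> set T) :
  (forall i, measurable (A i)) ->
  lebesgue_tuple n [set t | forall i, A i (tnth t i)] =
  (\prod_(i < n) lebesgue_measure (A i))%E.
Proof.
elim: n A => [A _|n IHn A mA].
  by rewrite big_ord0 /= diracE mem_set// => -[].
rewrite big_ord_recl -(IHn (fun i => A (lift ord0 i)))// -product_measure1E//.
  rewrite /= /lebesgue_step /pushforward; congr (_ _).
  apply/seteqP; split=> -[x t] /=.
    move=> At; split; first exact: (At ord0).
    by move=> i; have := At (lift ord0 i); rewrite /tcons tnthS.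
  move=> [Ax At] i; case: (unliftP ord0 i) => [j ->|->//].
  by rewrite /tcons tnthS; exact: At.
exact: (measurable_tuple_box (fun i => mA (lift ord0 i))).
Qed.

End lebesgue_tuple.

Section euclidean.
Context {R : realType} {m : nat}.
Implicit Types (u zeta : 'rV[R]_m -> R).

Definition vec_of_tuple (t : m.-tuple (measurableTypeR R)) : 'rV[R]_m :=
  \row_i tnth t i.

Definition integral_Rn (g : 'rV[R]_m -> R) : R :=
  \int[lebesgue_tuple m]_t g (vec_of_tuple t).

(* The library norm [`|v|] on ['rV[R]_m] is the sup norm. *)
Definition inner (v w : 'rV[R]_m) : R := \sum_i v 0 i * w 0 i.

Definition enorm (v : 'rV[R]_m) : R := Num.sqrt (inner v v).

Definition partial (i : 'I_m) u : 'rV[R]_m -> R := 'D_(delta_mx 0 i) u.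

Definition grad u (x : 'rV[R]_m) : 'rV[R]_m := \row_i partial i u x.

Fixpoint Ck (k : nat) u : Prop :=
  match k with
  | 0%N => continuous u
  | k'.+1 => continuous u /\
      forall i, (forall x, derivable u x (delta_mx 0 i)) /\ Ck k' (partial i u)
  end.

Definition Cinfty u : Prop := forall k, Ck k u.

Definition test_function zeta : Prop :=
  Cinfty zeta /\ compact (closure [set x | zeta x != 0]).

(* Since [0^-1 = 0], the integrand on the left vanishes where [grad u = 0]. *)
Definition weak_solution (phi f l : R -> R) u : Prop :=
  forall zeta, test_function zeta -> (forall x, 0 <= zeta x) ->
    - integral_Rn (fun x => (enorm (grad u x))^-1 * phi (enorm (grad u x)) *
                            inner (grad u x) (grad zeta x))
    >= integral_Rn (fun x => f (u x) * l (enorm (grad u x)) * zeta x).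

End euclidean.

Section one_variable.
Context {R : realType}.
Implicit Types g l phi f K : R -> R.

Definition L1_at_0 g : Prop :=
  exists2 d, 0 < d & lebesgue_measure.-integrable `]0, d[ (EFin \o g).

Definition L1_at_infty g : Prop :=
  exists2 a, 0 < a & lebesgue_measure.-integrable `]a, +oo[ (EFin \o g).

Definition C_monotone_nondecreasing (C : R) l : Prop :=
  forall t, 0 <= t -> sup [set l s | s in `[0, t]] <= C * l t.

Definition Kdensity phi l (t : R) : R := t * derive1 phi t / l t.

Definition Kfun phi l (t : R) : R :=
  \int[lebesgue_measure]_(s in `[0, t]) Kdensity phi l s.

Definition Ffun f (t : R) : R := \int[lebesgue_measure]_(s in `[0, t]) f s.

(* For [K] a bijection of [0, +oo) onto itself, this is its inverse on
   [0, +oo); the values on negative reals are irrelevant. *)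
Definition inv_pos K : R -> R := 'pinv_(fun=> 0) `[0, +oo[ K.

End one_variable.

(* Main.v *)
(* If [u p < u q], compare [u] with a radial supersolution [al (|x - p|)] on an
   annulus around [p] whose inner radius is so small that [u] stays below [u q]
   on it.  The profile solves [K(al') = sig F(al)], hence
   [(phi al')' = sig f(al) l(al')]; for small [sig] the C-monotonicity of [l] and
   [phi / l = o(1)] absorb the curvature term [(m - 1) / r phi(al')].  The
   Keller-Osserman condition bounds the time that [al] needs to reach any level,
   so [al] overtakes [u] before a fixed radius, while a small [sig] delays [al]
   enough to keep it below [u q] at [q].  Hence [w = u - al] has a positive maximum
   inside the annulus; there the two gradients agree and [f(u) > f(al)], so
   testing with [((w - c)^+)^2], [c] just below the maximum, contradicts the
   monotonicity of [v |-> phi(|v|) v / |v|].  This test function is only C^1; it is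
   a C^1 limit of smooth ones, obtained from Bernstein polynomials by
   multiplication with a smooth cutoff. *)

Require Import Defs.
From mathcomp Require Import all_boot all_order all_algebra ring lra.
From mathcomp Require Import all_classical all_reals all_analysis measurable_realfun.

Set Implicit Arguments.
Unset Strict Implicit.
Unset Printing Implicit Defensive.
Import Order.TTheory GRing.Theory Num.Theory.
Import numFieldNormedType.Exports.
Local Open Scope classical_set_scope.
Local Open Scope ring_scope.

(** * One-variable calculus *)

(** The weight [t * phi' / l] in [K] is such that differentiating [K(al') = sig F(al)] and dividing
    by [al'] gives exactly the equation for [phi al']: separation of variables in a first-order
    equation replaces a second-order problem. The speed [Ki (sig * F s)] vanishes at [s = 0], so the
    profile starts from a positive value and is built as the inverse of its travel time. The order
    of choices matters: the inner radius comes from continuity of [u] at [p], then [sig] from the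
    gap and from the distance of [q], then the time bound [T]; only after that is the final level
    fixed, from a bound of [u] on the ball of radius [T]. Since [u] is only C^1 and the operator may
    degenerate where the gradient vanishes, the comparison is made under the integral, and only the
    radial field of the barrier is integrated by parts. Bernstein operators suit the density step:
    they are positive, fix constants and differentiate into finite differences, so one second-moment
    estimate controls a function and its gradient. The same polynomials show that compactly
    supported continuous functions are measurable for the product sigma-algebra. *)

Section one_variable_calculus.
Context {R : realType}.
Local Notation mu := (@lebesgue_measure R).
Implicit Types (f g df : R -> R) (a b x t : R).

Lemma mono_le f df a b : a <= b -> {within `[a, b], continuous f} ->
  (forall x : R, a < x < b -> is_derive x 1 f (df x)) ->
  (forall x, a < x < b -> 0 <= df x) -> f a <= f b.
Proof.
rewrite le_eqVlt => /predU1P[->//|ab] cf Df df0.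
have Df' x : x \in `]a, b[ -> is_derive x 1 f (df x) by rewrite in_itv; exact: Df.
have [c + E] := MVT ab Df' cf; rewrite in_itv/= => abc.
by rewrite -subr_ge0 E mulr_ge0 ?df0// subr_ge0 ltW.
Qed.

Lemma mono_lt f df a b : a < b -> {within `[a, b], continuous f} ->
  (forall x : R, a < x < b -> is_derive x 1 f (df x)) ->
  (forall x, a < x < b -> 0 < df x) -> f a < f b.
Proof.
move=> ab cf Df df0.
have Df' x : x \in `]a, b[ -> is_derive x 1 f (df x) by rewrite in_itv; exact: Df.
have [c + E] := MVT ab Df' cf; rewrite in_itv/= => abc.
by rewrite -subr_gt0 E mulr_gt0 ?df0// subr_gt0.
Qed.

Lemma is_derive_cont f (d : R) (x : R) : is_derive x 1 f d -> {for x, continuous f}.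
Proof. by move=> [? _]; apply/differentiable_continuous/derivable1_diffP. Qed.

Lemma within_deriv f df a b : (forall x : R, a <= x <= b -> is_derive x 1 f (df x)) ->
  {within `[a, b], continuous f}.
Proof.
move=> Df; apply: continuous_in_subspaceT => x; rewrite inE/= in_itv/= => xab.
exact: is_derive_cont (Df x xab).
Qed.

Lemma integrable_setU (A B : set R) (f : R -> \bar R) : measurable A -> measurable B ->
  mu.-integrable A f -> mu.-integrable B f -> mu.-integrable (A `|` B) f.
Proof.
move=> mA mB iA iB.
have mf : measurable_fun (A `|` B) f.
  by apply/measurable_funU => //; split; [exact: measurable_int iA|exact: measurable_int iB].
have mnf : measurable_fun (A `|` B) (fun x => `|f x|%E) by exact: measurableT_comp.
apply/integrableP; split => //.
have E : A `|` B = A `|` (B `\` A).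
  apply/seteqP; split=> x; last by case=> [|[]]; [left|right].
  by have [Ax|Ax] := pselect (A x); [left|case=> // Bx; right].
rewrite E in mnf *; rewrite ge0_integral_setU//; last 2 first.
- exact: measurableD.
- by apply/disj_set2P/seteqP; split=> x // [Ax [_ /(_ Ax)]].
apply: lte_add_pinfty; first by move/integrableP : iA => [].
move/integrableP : iB => [mB' +]; apply: le_lt_trans.
apply: ge0_subset_integral => //; first exact: measurableD.
by apply: measurableT_comp.
Qed.

Lemma continuous_primitive (c : R -> R) a : continuous c ->
  exists P : R -> R, forall x : R, a < x -> is_derive x 1 P (c x).
Proof.
move=> cc; exists (fun x => \int[mu]_(t in `[a, x]) c t)%R => x ax.
have xu : x < x + 1 by rewrite ltrDl.
have ic : mu.-integrable `[a, x + 1] (EFin \o c).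
  by apply: continuous_compact_integrable; [exact: segment_compact|exact: continuous_subspaceT].
have [d] := continuous_FTC1_closed xu ic ax (cc x).
by rewrite derive1E => dE; exact: DeriveDef d dE.
Qed.

Lemma within0y_cont f (x : R) : {within `[0, +oo[, continuous f} -> 0 < x ->
  {for x, continuous f}.
Proof.
by move=> /continuous_within_itvcyP[cf _] x0; apply: cf; rewrite in_itv/= x0.
Qed.

(** Extension by the constant [f 0] to the left makes the function continuous on the whole line, so
    that it can be composed with the non-negative functions [u] and [enorm (grad u x)]. *)
Lemma max0_cont f : {within `[0, +oo[, continuous f} ->
  continuous (fun t : R => f (Num.max 0 t)).
Proof.
move=> /continuous_within_itvcyP[cf f0] t.
apply/cvgrPdist_lt => e e0.
have [t0|t0|->] := ltgtP t 0.
- have : \forall s \near t, s < 0 by exact: lt_nbhsl.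
  apply: filterS => s s0.
  by rewrite !max_l ?ltW// subrr normr0.
- have ct : {for t, continuous f} by apply: cf; rewrite in_itv/= t0.
  have Ht : \forall s \near t, 0 < s by exact: lt_nbhsr.
  move/cvgrPdist_lt : ct => /(_ _ e0) H.
  near=> s; rewrite !max_r ?ltW//; [by near: s|by near: s].
- move/cvgrPdist_lt : f0 => /(_ _ e0)[d /= d0 Hd].
  apply/nbhs_ballP; exists d => // s /=.
  have [s0 _|s0 ds] := leP s 0; first by rewrite subrr normr0.
  exact: Hd.
Unshelve. all: by end_near. Qed.

End one_variable_calculus.

(** * The function [K] and its inverse *)

Section K_function.
Context {R : realType}.
Local Notation mu := (@lebesgue_measure R).
Variables (phi l : R -> R).
Hypotheses (phi'_cont : {in `]0, +oo[, continuous (derive1 phi)})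
  (phi'_gt0 : {in `]0, +oo[, forall t, 0 < derive1 phi t})
  (l_cont : {within `[0, +oo[, continuous l})
  (l_gt0 : {in `]0, +oo[, forall t, 0 < l t})
  (K_0 : L1_at_0 (Kdensity phi l))
  (K_infty : ~ L1_at_infty (Kdensity phi l)).

Let k := Kdensity phi l.
Let K := Kfun phi l.

Let pos_itv (t : R) : 0 < t -> t \in `]0, +oo[.
Proof. by rewrite in_itv/= andbT. Qed.

Lemma Kdensity_gt0 t : 0 < t -> 0 < k t.
Proof. by move=> t0; rewrite divr_gt0 ?mulr_gt0 ?phi'_gt0 ?l_gt0// pos_itv. Qed.

Lemma Kdensity_ge0 t : 0 <= t -> 0 <= k t.
Proof.
rewrite le_eqVlt => /predU1P[<-|/Kdensity_gt0/ltW//].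
by rewrite /k /Kdensity !mul0r.
Qed.

Lemma Kdensity_cont (t : R) : 0 < t -> {for t, continuous k}.
Proof.
move=> t0; have lt0 : l t != 0 by rewrite gt_eqF// l_gt0// pos_itv.
exact: cvgM (cvgM cvg_id (phi'_cont (pos_itv t0)))
  (cvgV lt0 (within0y_cont l_cont t0)).
Qed.

Lemma Kdensity_within a b : 0 < a -> {within `[a, b], continuous k}.
Proof.
move=> a0; apply: continuous_in_subspaceT => x; rewrite inE/= in_itv/= => /andP[ax _].
by apply: Kdensity_cont; exact: lt_le_trans ax.
Qed.

(** [L1_at_0] speaks only of an open interval []0, d[]; the point [0], and the segment from [d / 2]
    on which the density is continuous, are added to it. *)
Lemma Kdensity_integrable b : mu.-integrable `[0, b] (EFin \o k).
Proof.
have [d d0 id] := K_0.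
have d20 : 0 < d / 2 by rewrite divr_gt0.
have i1 : mu.-integrable `[d / 2, b] (EFin \o k).
  by apply: continuous_compact_integrable; [exact: segment_compact|exact: Kdensity_within].
have i0 : mu.-integrable [set (0 : R)] (EFin \o k).
  apply: measurable_bounded_integrable => //.
  - have H : (mu [set 0%R : R] < +oo)%E by rewrite lebesgue_measure_set1.
    exact: H.
  - exact: measurable_fun_set1.
  - exists (k 0); split; first exact: num_real.
    by move=> x kx y /= ->; rewrite ger0_norm ?Kdensity_ge0// ltW.
have i2 := integrable_setU (measurable_set1 _) (measurable_itv _) i0 id.
have i3 := integrable_setU (measurableU _ _ (measurable_set1 (0 : R)) (measurable_itv _))
  (measurable_itv _) i2 i1.
apply: integrableS i3 => //.
  by apply: measurableU => //; apply: measurableU.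
move=> x /=; rewrite !in_itv/= => /andP[]; rewrite le_eqVlt => /predU1P[<- _|x0 xb].
  by left; left.
have [xd|dx] := ltP x (d / 2); last by right.
by left; right; rewrite x0/=; lra.
Qed.

Lemma is_derive_Kfun (t : R) : 0 < t -> is_derive t 1 K (k t).
Proof.
move=> t0; have tu : t < t + 1 by rewrite ltrDl.
have [d] := continuous_FTC1_closed tu (Kdensity_integrable _) t0 (Kdensity_cont t0).
by rewrite derive1E => dE; exact: DeriveDef d dE.
Qed.

Lemma Kfun_within b : 0 <= b -> {within `[0, b], continuous K}.
Proof.
by move=> b0; apply: (parameterized_integral_continuous b0 (Kdensity_integrable b)).
Qed.

Lemma Kfun0 : K 0 = 0.
Proof. by rewrite /K /Kfun set_itv1 Rintegral_set1. Qed.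

Lemma Kfun_lt s t : 0 <= s -> s < t -> K s < K t.
Proof.
move=> s0 st; apply: (mono_lt st (df := k)).
- have t0 : 0 <= t by rewrite (le_trans s0)// ltW.
  apply: continuous_subspaceW (Kfun_within t0).
  by apply: subset_itvr; rewrite bnd_simp.
- by move=> x /andP[sx _]; apply: is_derive_Kfun; exact: le_lt_trans sx.
- by move=> x /andP[sx _]; apply: Kdensity_gt0; exact: le_lt_trans sx.
Qed.

(** A bounded [K], being monotone, converges at infinity; the fundamental theorem on [[1, +oo[] then
    makes the density integrable there, against [K_infty]. *)
Lemma Kfun_unbounded y : exists2 t : R, 0 <= t & y <= K t.
Proof.
apply: contrapT => H; have Ky t : K t < y.
  have [t0|t0] := leP 0 t.
    by rewrite ltNge; apply/negP => yK; apply: H; exists t.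
  (* On negative reals the interval of integration is empty, so [K] takes the value [0] there. *)
  rewrite /K /Kfun set_itv_ge ?Rintegral_set0; last by rewrite bnd_simp -ltNge.
  rewrite -Kfun0 ltNge; apply/negP => yK; apply: H; exists 0 => //.
apply: K_infty; exists 1 => //.
have ndK : nondecreasing_fun K.
  move=> s t; rewrite le_eqVlt => /predU1P[->//|st].
  have [s0|s0] := leP 0 s; first exact/ltW/Kfun_lt.
  rewrite [K s]/K /Kfun set_itv_ge ?Rintegral_set0; last by rewrite bnd_simp -ltNge.
  by apply: Rintegral_ge0 => x; rewrite /= in_itv/= => /andP[/Kdensity_ge0].
have Kub : has_ubound (range K) by exists y => _ [t _ <-]; exact/ltW/Ky.
have kc : {within `[1, +oo[, continuous k}.
  apply: continuous_in_subspaceT => x; rewrite inE/= in_itv/= andbT => x1.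
  by apply: Kdensity_cont; exact: lt_le_trans x1.
have E : (\int[mu]_(x in `[1%R, +oo[) (k x)%:E = (sup (range K))%:E - (K 1)%:E)%E.
  apply: (ge0_continuous_FTC2y _ kc (nondecreasing_cvgr ndK Kub)).
  - by move=> x x1; apply: Kdensity_ge0; exact: le_trans x1.
  - by move=> x x1; have [] := is_derive_Kfun (lt_trans ltr01 x1).
  - by apply: cvg_at_right_filter; exact: is_derive_cont (is_derive_Kfun ltr01).
  - move=> x; rewrite in_itv/= andbT => x1; rewrite derive1E.
    by have [_] := is_derive_Kfun (lt_trans ltr01 x1).
suff I : mu.-integrable `[1, +oo[ (EFin \o k).
  by apply: integrableS I => //; apply: subset_itvr; rewrite bnd_simp.
apply/integrableP; split.
  by apply/measurable_EFinP; exact: subspace_continuous_measurable_fun.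
have -> : (\int[mu]_(x in `[1%R, +oo[) `|(EFin \o k) x| =
    \int[mu]_(x in `[1%R, +oo[) (k x)%:E)%E.
  apply: eq_integral => x; rewrite inE/= in_itv/= andbT => x1.
  by rewrite ger0_norm ?Kdensity_ge0// (le_trans _ x1).
by rewrite E -EFinD ltry.
Qed.

(** Surjectivity is the intermediate value theorem below a point given by [Kfun_unbounded];
    injectivity on [[0, +oo[] is strict monotonicity. *)
Lemma inv_Kfun y : 0 <= y -> 0 <= inv_pos K y /\ K (inv_pos K y) = y.
Proof.
move=> y0; have [t t0 yt] := Kfun_unbounded y.
have [s + Ks] : exists2 s, s \in `[0, t] & K s = y.
  apply: IVT => //; first exact: Kfun_within.
  by rewrite Kfun0 min_l ?max_r ?y0// (le_trans y0).
rewrite in_itv/= => /andP[s0 _].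
have s0y : [set` `[0, +oo[] s by rewrite /= in_itv/= s0.
have inj : {in [set` `[0, +oo[] &, injective K}.
  move=> a b; rewrite !inE/= !in_itv/= !andbT => a0 b0 Kab.
  by have [/(Kfun_lt a0)|/(Kfun_lt b0)|//] := ltgtP a b; rewrite Kab ltxx.
rewrite /inv_pos -Ks pinvKV//; by rewrite inE.
Qed.

End K_function.

(** * The barrier *)

Section barrier.
Context {R : realType}.
Variables (phi phi' f l F K k Ki : R -> R) (C c : R).
Implicit Types (s t d y : R).
Hypotheses
  (phiD : forall t : R, 0 < t -> is_derive t 1 phi (phi' t))
  (phi'_gt0 : forall t, 0 < t -> 0 < phi' t)
  (f_cont : forall t : R, 0 < t -> {for t, continuous f})
  (f_le : forall s t, 0 <= s -> s <= t -> f s <= f t)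
  (f_gt0 : forall t, 0 < t -> 0 < f t)
  (F0 : F 0 = 0)
  (FD : forall t : R, 0 <= t -> is_derive t 1 F (f t))
  (l_cont : forall t : R, 0 < t -> {for t, continuous l})
  (l_gt0 : forall t, 0 < t -> 0 < l t)
  (C_ge1 : 1 <= C)
  (l_le : forall s t, 0 < s -> s <= t -> l s <= C * l t)
  (kE : forall t, 0 < t -> k t = t * phi' t / l t)
  (KD : forall t : R, 0 < t -> is_derive t 1 K (k t))
  (K0 : K 0 = 0)
  (K_lt : forall s t, 0 <= s -> s < t -> K s < K t)
  (KiP : forall y, 0 <= y -> 0 <= Ki y /\ K (Ki y) = y)
  (phi_l : forall d, 0 < d -> exists2 r : R, 0 < r &
     forall t, 0 < t <= r -> phi t <= d * l t)
  (KO : exists A B (G : R -> R), 0 <= A /\ forall x : R, A < x ->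
     is_derive x 1 G (Ki (F x))^-1 /\ G x <= B)
  (c_ge0 : 0 <= c).

Let k_gt0 t : 0 < t -> 0 < k t.
Proof. by move=> t0; rewrite kE// divr_gt0 ?mulr_gt0 ?phi'_gt0 ?l_gt0. Qed.

Lemma Ki_gt0 y : 0 < y -> 0 < Ki y.
Proof.
move=> y0; have [Ky KKy] := KiP (ltW y0).
rewrite lt_def Ky andbT; apply/eqP => Ky0.
by move: y0; rewrite -KKy Ky0 K0 ltxx.
Qed.

Lemma Ki_le y z : 0 <= y -> y <= z -> Ki y <= Ki z.
Proof.
move=> y0 yz; have [Ky KKy] := KiP y0; have [Kz KKz] := KiP (le_trans y0 yz).
by rewrite leNgt; apply/negP => /(K_lt Kz); rewrite KKy KKz ltNge yz.
Qed.

Lemma KiK t : 0 <= t -> Ki (K t) = t.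
Proof.
move=> t0; have Kt0 : 0 <= K t.
  by rewrite -K0; move: t0; rewrite le_eqVlt => /predU1P[<-//|/(K_lt (lexx _))/ltW].
have [KK0 KKK] := KiP Kt0.
by have [/(K_lt KK0)|/(K_lt t0)|//] := ltgtP (Ki (K t)) t; rewrite KKK ltxx.
Qed.

Lemma is_derive_Ki (y : R) : 0 < y -> is_derive y 1 Ki (k (Ki y))^-1.
Proof.
move=> y0; have x0 := Ki_gt0 y0; have [_ Ky] := KiP (ltW y0).
rewrite -[y in is_derive y]Ky; apply: is_derive_inverse.
- have : \forall t \near Ki y, 0 < t by exact: lt_nbhsr.
  by apply: filterS => t t0; exact/KiK/ltW.
- have : \forall t \near Ki y, 0 < t by exact: lt_nbhsr.
  by apply: filterS => t t0; exact: is_derive_cont (KD t0).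
- exact: KD.
- by rewrite gt_eqF// k_gt0.
Qed.

Lemma F_lt s t : 0 <= s -> s < t -> F s < F t.
Proof.
move=> s0 st; apply: (mono_lt st (df := f)).
- by apply: (within_deriv (df := f)) => x /andP[sx _]; apply: FD; exact: le_trans sx.
- by move=> x /andP[sx _]; apply: FD; exact: ltW (le_lt_trans s0 sx).
- by move=> x /andP[sx _]; apply: f_gt0; exact: le_lt_trans sx.
Qed.

Lemma F_gt0 s : 0 < s -> 0 < F s.
Proof. by move=> s0; rewrite -F0; exact: F_lt. Qed.

Lemma F_le s t : 0 <= s -> s <= t -> F s <= F t.
Proof. by move=> s0; rewrite le_eqVlt => /predU1P[->//|/(F_lt s0)/ltW]. Qed.

(** Convexity of [F] together with [F 0 = 0]: the difference of the two sides vanishes at [0] and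
    has derivative [sig * (f x - f (sig * x))], non-negative because [f] is monotone. *)
Lemma F_scale sig s : 0 <= sig <= 1 -> 0 <= s -> F (sig * s) <= sig * F s.
Proof.
move=> /andP[s0 s1] s_ge0.
pose D := fun x : R => sig * F x - F (sig * x).
have DD (x : R) : 0 <= x <= s -> is_derive x 1 D (sig * f x - sig * f (sig * x)).
  move=> /andP[x0 _].
  have D1 : is_derive x 1 (fun y : R => sig * y) sig.
    have D1 := is_deriveM (is_derive_cst sig x (1 : R)) (is_derive_id x (1 : R)).
    by apply: (is_derive_eq D1); rewrite /GRing.scale/= mulr1 mulr0 addr0.
  have sx0 : 0 <= sig * x by rewrite mulr_ge0.
  have D2 := is_derive1_comp (FD sx0) D1.
  have D3 := is_deriveB (is_deriveM (is_derive_cst sig x (1 : R)) (FD x0)) D2.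
  by apply: (is_derive_eq D3); rewrite /GRing.scale/= mulr0 addr0 [f _ * sig]mulrC.
have : D 0 <= D s.
  apply: (mono_le s_ge0 (df := fun x => sig * f x - sig * f (sig * x))).
  - exact: within_deriv DD.
  - by move=> x /andP[x0 x1]; apply: DD; rewrite !ltW.
  - move=> x /andP[x0 x1]; rewrite subr_ge0 ler_wpM2l// f_le ?mulr_ge0 ?(ltW x0)//.
    by rewrite ler_piMl// ltW.
by rewrite /D mulr0 F0 mulr0 subr0 subr_ge0.
Qed.

Section speed.
Variables (sig : R) (sig_gt0 : 0 < sig) (sig_le1 : sig <= 1).

(** The profile equation [K(al') = sig F(al)] solved for [al']: the slope of the profile as a
    function of its height. *)
Definition speed s := Ki (sig * F s).

Lemma speed_gt0 s : 0 < s -> 0 < speed s.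
Proof. by move=> s0; rewrite Ki_gt0// mulr_gt0// F_gt0. Qed.

Lemma speed_le s t : 0 <= s -> s <= t -> speed s <= speed t.
Proof.
move=> s0 st; apply: Ki_le.
  by rewrite mulr_ge0 ?(ltW sig_gt0)// -F0 F_le.
by rewrite ler_wpM2l ?(ltW sig_gt0)// F_le.
Qed.

Lemma is_derive_speed (s : R) : 0 < s ->
  is_derive s 1 speed ((k (speed s))^-1 * (sig * f s)).
Proof.
move=> s0; have D1 : is_derive s 1 (fun x : R => sig * F x) (sig * f s).
  have D1 := is_deriveM (is_derive_cst sig s (1 : R)) (FD (ltW s0)).
  by apply: (is_derive_eq D1); rewrite /GRing.scale/= mulr0 addr0.
have y0 : 0 < sig * F s by rewrite mulr_gt0// F_gt0.
exact: (@is_derive1_comp _ Ki (fun x => sig * F x) s _ _ (is_derive_Ki y0) D1).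
Qed.

(* [F_scale] gives [speed s >= Ki (F (sig * s))], so [H] is controlled by the
   primitive of the Keller-Osserman integrand. *)
Lemma travel_time (e : R) : 0 < e -> exists H : R -> R, H e = 0 /\
  (forall s : R, e / 2 < s -> is_derive s 1 H (speed s)^-1) /\
  exists T, forall s, e <= s -> H s <= T.
Proof.
move=> e0; pose a := e / 2; have a0 : 0 < a by rewrite divr_gt0.
(* Reflection at [a] keeps the argument of [speed] at least [a > 0], which makes the integrand
   continuous on the whole line; to the right of [a] nothing changes. *)
have cc : continuous (fun t : R => (speed (a + `|t - a|))^-1).
  move=> t; have p0 : 0 < a + `|t - a| by rewrite ltr_wpDr.
  have sp : speed (a + `|t - a|) != 0 by rewrite gt_eqF// speed_gt0.
  apply: cvgV => //.
  apply: (@continuous_comp _ _ _ (fun t : R => a + `|t - a|) speed).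
    apply: cvgD; first exact: cvg_cst.
    by apply: cvg_norm; apply: cvgB; [exact: cvg_id|exact: cvg_cst].
  exact: is_derive_cont (is_derive_speed p0).
have [P HP] := continuous_primitive a cc.
exists (fun s => P s - P e); rewrite subrr; split => //.
have HD (s : R) : a < s -> is_derive s 1 (fun s => P s - P e) (speed s)^-1.
  move=> as_; have D1 := is_deriveB (HP s as_) (is_derive_cst (P e) s (1 : R)).
  by apply: (is_derive_eq D1); rewrite subr0 gtr0_norm ?subr_gt0// subrKC.
split => //.
set H := fun s => P s - P e in HD *.
have [A [B [G [A0 HG]]]] := KO.
(* Then [sig * s1 = sig * e + A + 1] lies beyond [A], where the primitive [G] is available. Below
   [s1] monotonicity of [H] suffices; above it [H] grows no faster than [G (sig * x) / sig]. *)
pose s1 := e + (A + 1) / sig.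
have A1 : 0 <= (A + 1) / sig by rewrite divr_ge0 ?addr_ge0// ltW.
have es1 : e <= s1 by rewrite /s1 lerDl.
have As1 : A < sig * s1.
  rewrite /s1 mulrDr mulrCA divff ?mulr1 ?gt_eqF// addrA ltr_pwDr// lerDr.
  by rewrite mulr_ge0// ltW.
have ae : a < e by rewrite /a; lra.
exists (H s1 + (B - G (sig * s1)) / sig) => s es.
have [ss1|s1s] := leP s s1.
  have Hs : H s <= H s1.
    apply: (mono_le ss1 (df := fun x => (speed x)^-1)).
    - by apply: within_deriv => x /andP[sx _]; apply: HD; lra.
    - by move=> x /andP[sx _]; apply: HD; lra.
    - by move=> x /andP[sx _]; rewrite invr_ge0 ltW// speed_gt0//; lra.
  rewrite (le_trans Hs)// lerDl divr_ge0 ?(ltW sig_gt0)// subr_ge0.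
  exact: (HG _ As1).2.
pose D := fun x => G (sig * x) / sig - H x.
pose dD := fun x => (Ki (F (sig * x)))^-1 - (speed x)^-1.
have DD (x : R) : s1 <= x -> is_derive x 1 D (dD x).
  move=> s1x; have D1 : is_derive x 1 (fun y : R => sig * y) sig.
    have D1 := is_deriveM (is_derive_cst sig x (1 : R)) (is_derive_id x (1 : R)).
    by apply: (is_derive_eq D1); rewrite /GRing.scale/= mulr1 mulr0 addr0.
  have sx0 : A < sig * x by rewrite (lt_le_trans As1)// ler_wpM2l// ltW.
  have D2 := @is_derive1_comp _ G (fun y => sig * y) x _ _ (HG _ sx0).1 D1.
  have ax : a < x by lra.
  have D3 := is_deriveB (is_deriveM D2 (is_derive_cst (sig^-1) x (1 : R))) (HD x ax).
  apply: (is_derive_eq D3); rewrite /GRing.scale/= mulr0 add0r /dD.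
  by rewrite mulrCA mulVf ?mulr1 ?gt_eqF.
have : D s1 <= D s.
  apply: (mono_le (ltW s1s) (df := dD)).
  - by apply: within_deriv => x /andP[+ _]; exact: DD.
  - by move=> x /andP[+ _] => /ltW; exact: DD.
  - move=> x /andP[s1x _]; have x0 : 0 < x by rewrite (lt_le_trans e0)// (le_trans es1)// ltW.
    rewrite subr_ge0 lef_pV2 ?posrE ?speed_gt0//; last first.
      by rewrite Ki_gt0// F_gt0// mulr_gt0.
    apply: Ki_le; first by rewrite -F0 F_le// mulr_ge0// ltW.
    by rewrite F_scale ?(ltW sig_gt0)// ltW.
have sigs : A < sig * s by rewrite (lt_trans As1)// ltr_pM2l.
have : G (sig * s) / sig <= B / sig.
  by rewrite ler_wpM2r ?invr_ge0 ?(ltW sig_gt0)//; exact: (HG _ sigs).2.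
rewrite /D mulrBl -/(H s); lra.
Qed.

(** The factor [phi'] from the chain rule cancels against the one in [k]. Along the profile a
    further factor [al' = speed sig al] removes the denominator. *)
Lemma is_derive_phi_speed (s : R) : 0 < s ->
  is_derive s 1 (phi \o speed) (sig * f s * l (speed s) / speed s).
Proof.
move=> s0; have g0 := speed_gt0 s0.
have D := is_derive1_comp (phiD g0) (is_derive_speed s0).
apply: (is_derive_eq D); rewrite kE//; field.
by rewrite !gt_eqF ?phi'_gt0 ?l_gt0.
Qed.

End speed.

(** The profile is the inverse of the travel time [H], shifted to start at [t0]. That [T] precedes
    [N] expresses that any height is reached within a bounded time. In the application [c] is
    [m - 1], and the last inequality says that the radial function is a supersolution. *)
Lemma barrier (t0 t1 e eta : R) : 0 < t0 -> t0 <= t1 -> 0 < e < eta ->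
  exists T, forall N, eta < N -> exists r1 (al a b : R -> R),
    [/\ t1 <= r1 <= T, al t0 = e, al t1 <= eta & al r1 = N] /\
    forall r : R, t0 <= r <= r1 ->
      [/\ is_derive r 1 al (a r), 0 < a r & e <= al r] /\
      [/\ is_derive r 1 (phi \o a) (b r), {for r, continuous a}, {for r, continuous b} &
          b r + c / r * phi (a r) <= f (al r) * l (a r)].
Proof.
move=> t00 t01 /andP[e0 eeta].
have eta0 : 0 < eta by exact: lt_trans eeta.
have C0 : 0 < C by rewrite (lt_le_trans ltr01).
have fe0 := f_gt0 e0.
(* [rho1] absorbs the initial value of [phi a], [rho2] delays the arrival at [eta],
   and [q] absorbs the growth of [phi a]; see [s1], [Heta] and [s2] below. *)
pose d := t0 * f e / (2 * (c + 1) * C).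
have c10 : 0 < c + 1 by rewrite ltr_wpDl.
have d0 : 0 < d by rewrite divr_gt0 ?mulr_gt0.
have [rho1 rho10 Hrho1] := phi_l d0.
pose rho2 := (eta - e) / (t1 - t0 + 1).
have t10 : 0 < t1 - t0 + 1 by rewrite ltr_wpDl// subr_ge0.
have rho20 : 0 < rho2 by rewrite divr_gt0// subr_gt0.
pose rho := Num.min rho1 rho2.
have rho0 : 0 < rho by rewrite lt_min rho10.
have Krho0 : 0 < K rho by rewrite -K0 K_lt.
have Feta0 := F_gt0 eta0.
pose q := 2 * (1 + c * C).
have cC0 : 0 <= c * C by rewrite mulr_ge0// ltW.
have q0 : 0 < q by rewrite mulr_gt0// ltr_wpDr.
(* The first entry gives [sig * (1 + c * C) <= 2^-1]. The second gives [sig * F eta <= K rho], so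
   the speed is at most [rho] up to the height [eta]. *)
pose sig := Num.min q^-1 (K rho / F eta).
have sig0 : 0 < sig by rewrite lt_min invr_gt0 q0 divr_gt0.
have sigq : sig * (1 + c * C) <= 2^-1.
  have : sig <= q^-1 by rewrite ge_min lexx.
  rewrite -[X in _ <= X]div1r ler_pdivlMr// /q mulrCA => H.
  by rewrite -[2^-1]div1r ler_pdivlMr// mulrC.
have sig1 : sig <= 1.
  have := ler_peMr (ltW sig0) (_ : 1 <= 1 + c * C); rewrite lerDl => /(_ cC0).
  by lra.
have sp_rho s : 0 < s -> s <= eta -> speed sig s <= rho.
  move=> s0 seta; apply: le_trans (speed_le sig0 (ltW s0) seta) _.
  rewrite -(KiK (ltW rho0)); apply: Ki_le; first by rewrite mulr_ge0// ltW.
  by rewrite -ler_pdivlMr// ge_min lexx orbT.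
have [H [He [HD [T HT]]]] := travel_time sig0 sig1 e0.
(* The segment from [lo] to [hi] contains [[e, N]] in its interior, so the inverse of [H] is
   differentiable also at the two end values; [lo] stays above [e / 2], where [H] has a
   derivative. *)
pose lo := e * (3 / 4).
have lo1 : e / 2 < lo by rewrite /lo; lra.
have lo2 : lo < e by rewrite /lo; lra.
have H_lt s t : lo <= s -> s < t -> H s < H t.
  move=> los st; apply: (mono_lt st (df := fun x => (speed sig x)^-1)).
  - by apply: within_deriv => x /andP[sx _]; apply: HD; lra.
  - by move=> x /andP[sx _]; apply: HD; lra.
  - by move=> x /andP[sx _]; rewrite invr_gt0 speed_gt0//; lra.
have H_le s t : lo <= s -> s <= t -> H s <= H t.
  by move=> los; rewrite le_eqVlt => /predU1P[->//|/(H_lt _ _ los)/ltW].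
exists (t0 + T) => N etaN.
pose hi := N + 1.
have Nhi : N < hi by rewrite /hi ltrDl.
have lohi : lo <= hi by lra.
pose I := [set` `[lo, hi]].
pose ga := 'pinv_(fun=> 0) I H.
have gaK s : lo <= s <= hi -> ga (H s) = s.
  move=> Is; apply: pinvKV; last by rewrite inE/I/= in_itv.
  move=> x y; rewrite !inE/I/= !in_itv/= => /andP[lox _] /andP[loy _] Hxy.
  by have [/(H_lt _ _ lox)|/(H_lt _ _ loy)|//] := ltgtP x y; rewrite Hxy ltxx.
have Hsurj y : H e <= y <= H N -> exists2 s, e <= s <= N & H s = y.
  move=> /andP[y1 y2]; have eN : e <= N by lra.
  have [s + Hs] : exists2 s, s \in `[e, N] & H s = y.
    apply: IVT => //; last by rewrite min_l ?max_r ?y1 ?(le_trans y1).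
    by apply: within_deriv => x /andP[sx _]; apply: HD; lra.
  by rewrite in_itv/= => sI; exists s.
pose al r := ga (r - t0); pose a r := speed sig (al r).
pose b r := sig * f (al r) * l (a r).
have HN : H eta < H N by apply: H_lt => //; lra.
(* At speed at most [rho2], the way from [e] to [eta] takes time at least
   [(eta - e) / rho2 = t1 - t0 + 1]. *)
have Heta : t1 - t0 <= H eta.
  have : H e - e / rho2 <= H eta - eta / rho2.
    apply: (mono_le (ltW eeta) (f := fun x => H x - x / rho2)
      (df := fun x => (speed sig x)^-1 - rho2^-1)).
    - apply: (within_deriv (df := fun x => (speed sig x)^-1 - rho2^-1)).
      move=> x /andP[ex _]; have ax : e / 2 < x by lra.
      have D1 := is_deriveB (HD x ax)
        (is_deriveM (is_derive_id x (1 : R)) (is_derive_cst (rho2^-1) x (1 : R))).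
      by apply: (is_derive_eq D1); rewrite /GRing.scale/= mulr0 add0r mulr1.
    - move=> x /andP[ex _]; have ax : e / 2 < x by lra.
      have D1 := is_deriveB (HD x ax)
        (is_deriveM (is_derive_id x (1 : R)) (is_derive_cst (rho2^-1) x (1 : R))).
      by apply: (is_derive_eq D1); rewrite /GRing.scale/= mulr0 add0r mulr1.
    - move=> x /andP[ex xeta]; have x0 : 0 < x by lra.
      rewrite subr_ge0 lef_pV2 ?posrE ?speed_gt0// (le_trans (sp_rho _ x0 (ltW xeta)))//.
      by rewrite ge_min lexx orbT.
  rewrite He; have -> : eta / rho2 = e / rho2 + (t1 - t0 + 1).
    by rewrite /rho2; field; rewrite ?(gt_eqF t10) subr_eq0 (gt_eqF eeta).
  by lra.
have alE r : t0 <= r <= t0 + H N -> e <= al r <= N /\ H (al r) = r - t0.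
  move=> /andP[r1 r2].
  have [|s /andP[s1 s2] Hs] := Hsurj (r - t0); first by rewrite He; apply/andP; split; lra.
  have -> : al r = s by rewrite /al -Hs gaK//; apply/andP; split; lra.
  by rewrite s1 s2.
have eN : e < N by lra.
exists (t0 + H N), al, a, b; split.
  split.
  - by apply/andP; split; [lra|rewrite lerD2l HT// ltW].
  - by rewrite /al subrr -He gaK//; apply/andP; split; lra.
  - have [] := alE t1; first by apply/andP; split; lra.
    move=> /andP[a1 _] Ha; rewrite leNgt; apply/negP => /H_lt.
    by rewrite Ha => /(_ _)H'; have := H' (_ : lo <= eta); lra.
  - by rewrite /al addrC addKr gaK//; apply/andP; split; lra.
have alD (r : R) : t0 <= r <= t0 + H N -> is_derive r 1 al (a r).
  move=> Ir; have [/andP[a1 a2] Ha] := alE r Ir.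
  have a0 : 0 < al r by lra.
  have al1 : e / 2 < al r by lra.
  have n1 : \forall s \near al r, lo < s by apply: lt_nbhsr; lra.
  have n2 : \forall s \near al r, s < hi by apply: lt_nbhsl; lra.
  have D1 : is_derive (r - t0) 1 ga (speed sig (al r)).
    rewrite -Ha -[speed _ _]invrK; apply: is_derive_inverse.
    - near=> s; apply: gaK; apply/andP; split; apply: ltW; by near: s.
    - near=> s; apply: is_derive_cont (HD s _).
      by have : lo < s by [near: s]; lra.
    - exact: HD.
    - by rewrite invr_eq0 gt_eqF// speed_gt0.
  have D2 : is_derive r 1 (fun x : R => x - t0) 1.
    have D2 := is_deriveB (is_derive_id r (1 : R)) (is_derive_cst t0 r (1 : R)).
    by apply: (is_derive_eq D2); rewrite subr0.
  have D3 := @is_derive1_comp _ ga (fun x => x - t0) r _ _ D1 D2.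
  by apply: (is_derive_eq D3); rewrite mulr1.
have apos r : t0 <= r <= t0 + H N -> 0 < al r /\ 0 < a r.
  by move=> Ir; have [/andP[a1 _] _] := alE r Ir; split; [|apply: speed_gt0 => //]; lra.
have aD (r : R) : t0 <= r <= t0 + H N -> {for r, continuous a}.
  move=> Ir; have [al0 a0] := apos r Ir.
  exact: (@continuous_comp _ _ _ al (speed sig) r (is_derive_cont (alD r Ir))
    (is_derive_cont (is_derive_speed sig0 al0))).
have phiaD (r : R) : t0 <= r <= t0 + H N -> is_derive r 1 (phi \o a) (b r).
  move=> Ir; have [al0 a0] := apos r Ir.
  have D := is_derive1_comp (is_derive_phi_speed sig0 al0) (alD r Ir).
  by apply: (is_derive_eq D); rewrite /b -/(a r) divfK// gt_eqF.
have al_le r s : t0 <= r -> r <= s -> s <= t0 + H N -> al r <= al s.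
  move=> r1 rs s2; apply: (mono_le rs (df := a)).
  - by apply: within_deriv => x /andP[rx xs]; apply: alD; rewrite (le_trans r1)// (le_trans xs).
  - by move=> x /andP[rx xs]; apply: alD; rewrite (le_trans r1) ?(ltW rx)// (le_trans (ltW xs)).
  - move=> x /andP[rx xs]; apply/ltW/(apos x _).2.
    by rewrite (le_trans r1) ?(ltW rx)// (le_trans (ltW xs)).
move=> r Ir; have [al0 a0] := apos r Ir.
have [/andP[a1 a2] Ha] := alE r Ir; have /andP[r1 r2] := Ir.
split; first by split => //; exact: alD.
split; [exact: phiaD|exact: aD| |].
  have cal := is_derive_cont (alD r Ir).
  apply: cvgM; first apply: cvgM; first exact: cvg_cst.
    exact: (@continuous_comp _ _ _ al f r cal (f_cont al0)).
  exact: (@continuous_comp _ _ _ a l r (aD r Ir) (l_cont a0)).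
set L := l (a r); set ff := f (al r).
have L0 : 0 < L by exact: l_gt0.
have ff0 : 0 < ff by exact: f_gt0.
have fff : f e <= ff by apply: f_le => //; exact: ltW.
have t0I : t0 <= t0 <= t0 + H N by rewrite lexx; lra.
have [alt0 at0] := apos t0 t0I.
have at0E : a t0 = speed sig e by rewrite /a /al subrr -He gaK//; apply/andP; split; lra.
have a_le x : t0 <= x -> x <= r -> 0 < a x <= a r.
  move=> x1 x2; have Ix : t0 <= x <= t0 + H N by rewrite x1 (le_trans x2).
  have [alx ax] := apos x Ix; rewrite ax/=.
  by apply: speed_le => //; [exact: ltW|exact: al_le].
have phi0_le : phi (a t0) <= d * (C * L).
  have /andP[_ aa] := a_le t0 (lexx _) r1.
  rewrite (@le_trans _ _ (d * l (a t0)))//; last by rewrite ler_wpM2l ?(ltW d0)// l_le.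
  apply: Hrho1; rewrite at0/= at0E (le_trans (sp_rho e e0 (ltW eeta)))//.
  by rewrite ge_min lexx.
(* On [[t0, r]] the derivative [b] is at most [C] times its value at [r]: [al] and [a] are
   non-decreasing there, and [l] is [C]-monotone. *)
have phi_le : phi (a r) <= phi (a t0) + sig * ff * (C * L) * (r - t0).
  pose M := sig * ff * (C * L).
  have MD (x : R) : t0 <= x <= r -> is_derive x 1 (fun y => M * y - phi (a y)) (M - b x).
    move=> /andP[x1 x2]; have Ix : t0 <= x <= t0 + H N by rewrite x1 (le_trans x2).
    have D := is_deriveB (is_deriveM (is_derive_cst M x (1 : R)) (is_derive_id x (1 : R)))
      (phiaD x Ix).
    by apply: (is_derive_eq D); rewrite /GRing.scale/= mulr1 mulr0 addr0.
  have : M * t0 - phi (a t0) <= M * r - phi (a r).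
    apply: (mono_le r1 (f := fun y => M * y - phi (a y)) (df := fun x => M - b x)).
    - exact: within_deriv MD.
    - by move=> x /andP[x1 x2]; apply: MD; rewrite !ltW.
    - move=> x /andP[x1 x2]; have /andP[ax0 axr] := a_le x (ltW x1) (ltW x2).
      have Ix : t0 <= x <= t0 + H N by rewrite (ltW x1) (le_trans (ltW x2)).
      have [alx _] := apos x Ix.
      rewrite subr_ge0 /b /M; apply: ler_pM.
      + by rewrite mulr_ge0 ?(ltW sig0)// ltW// f_gt0.
      + exact/ltW/l_gt0.
      + by rewrite ler_wpM2l ?(ltW sig0)// f_le ?(ltW alx)// al_le// ltW.
      + exact: l_le.
  by rewrite /M mulrBr; lra.
have r0 : 0 < r by exact: lt_le_trans r1.
have cr0 : 0 <= c / r by rewrite divr_ge0// ltW.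
(* By the definition of [d], the product [c / t0 * (d * C)] is [c / (c + 1)] times [f e / 2];
   moreover [t0 <= r] and [f e <= ff]. *)
have s1 : c / r * (d * (C * L)) <= 2^-1 * (ff * L).
  have cr : c / r <= c / t0 by rewrite ler_wpM2l// lef_pV2.
  apply: (@le_trans _ _ (c / t0 * (d * (C * L)))).
    have dCL : 0 <= d * (C * L) by exact: mulr_ge0 (ltW d0) (mulr_ge0 (ltW C0) (ltW L0)).
    by apply: ler_wpM2r.
  have -> : c / t0 * (d * (C * L)) = c / (c + 1) * (2^-1 * (f e * L)).
    by rewrite /d; field; rewrite !gt_eqF.
  have fL : 0 <= 2^-1 * (f e * L).
    by apply: mulr_ge0; [rewrite invr_ge0|exact: mulr_ge0 (ltW fe0) (ltW L0)].
  apply: (@le_trans _ _ (2^-1 * (f e * L))).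
    by apply: ler_piMl => //; rewrite ler_pdivrMr// mul1r lerDl.
  by rewrite ler_wpM2l ?invr_ge0// ler_wpM2r// ltW.
have s2 : c / r * (sig * ff * (C * L) * (r - t0)) <= c * (sig * ff * (C * L)).
  set X := sig * ff * (C * L).
  have X0 : 0 <= X by rewrite /X !mulr_ge0 ?(ltW sig0) ?(ltW ff0) ?(ltW C0) ?(ltW L0).
  have -> : c / r * (X * (r - t0)) = c * X * ((r - t0) / r) by field; rewrite gt_eqF.
  apply: ler_piMr; first by rewrite mulr_ge0.
  by rewrite ler_pdivrMr// mul1r gerBl ltW.
have s3 := ler_wpM2l cr0 phi_le.
have s4 := ler_wpM2l cr0 phi0_le.
have fL0 : 0 <= ff * L by rewrite mulr_ge0 ?(ltW ff0) ?(ltW L0).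
have s5 := ler_wpM2r fL0 sigq.
rewrite /b -/ff -/L.
(* One half pays for [b] and for the growth of [phi a], the other half for the initial value
   [phi (a t0)]. *)
have -> : ff * L = 2^-1 * (ff * L) + 2^-1 * (ff * L) by field.
apply: (@le_trans _ _ (sig * (1 + c * C) * (ff * L) + 2^-1 * (ff * L))); last by rewrite lerD2r.
have -> : sig * (1 + c * C) * (ff * L) = sig * ff * L + c * (sig * ff * (C * L)) by ring.
rewrite -addrA lerD2l addrC (le_trans s3)// mulrDr.
by apply: lerD => //; exact: le_trans s1.
Unshelve. all: by end_near. Qed.

End barrier.

(** * Bernstein polynomials *)

Section bernstein.
Context {R : realType}.
Implicit Types (c d : nat -> R) (t : R).

(* De Casteljau's recursion for the Bernstein polynomial
   [\sum_(a <= n) 'C(n, a) * t ^ a * (1 - t) ^ (n - a) * c a]. *)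
Fixpoint bern (n : nat) c t : R :=
  if n is n'.+1 then (1 - t) * bern n' c t + t * bern n' (c \o S) t else c 0%N.

Lemma bern_le n c d t : 0 <= t <= 1 ->
  (forall a, (a <= n)%N -> c a <= d a) -> bern n c t <= bern n d t.
Proof.
move=> /andP[t0 t1]; elim: n c d => [|n IHn] c d cd; first exact: cd.
apply: lerD; apply: ler_wpM2l; rewrite ?subr_ge0//; apply: IHn => a an.
- by apply: cd; exact: leqW.
- exact: cd.
Qed.

Lemma bern_cst n (k : R) t : bern n (fun=> k) t = k.
Proof. by elim: n => //= n IHn; rewrite [_ \o _](_ : _ = fun=> k)// IHn; ring. Qed.

Lemma bernD n c d t : bern n (fun a => c a + d a) t = bern n c t + bern n d t.
Proof.
elim: n c d => //= n IHn c d.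
by rewrite IHn (IHn (c \o S) (d \o S)); ring.
Qed.

Lemma bernZ n (k : R) c t : bern n (fun a => k * c a) t = k * bern n c t.
Proof.
elim: n c => //= n IHn c; rewrite IHn (IHn (c \o S)); ring.
Qed.

Lemma bernB n c d t : bern n (fun a => c a - d a) t = bern n c t - bern n d t.
Proof.
by rewrite -mulN1r -bernZ -bernD; congr (bern _ _ _); apply/funext => a; ring.
Qed.

(** Variance plus squared bias of the binomial law with parameters [n] and [t]. The induction is
    over all [k], since shifting the coefficients replaces [k] by [k - 1]. *)
Lemma bern_sqr n (k t : R) :
  bern n (fun a => (a%:R - k) ^+ 2) t = n%:R * t * (1 - t) + (n%:R * t - k) ^+ 2.
Proof.
elim: n k => [|n IHn] k /=; first ring.
rewrite IHn (_ : _ \o _ = fun a => (a%:R - (k - 1)) ^+ 2).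
  by rewrite IHn -natr1; ring.
by apply/funext => a /=; rewrite -natr1; ring.
Qed.

Lemma bern_dist n c (k e : R) t : 0 <= t <= 1 ->
  (forall a, (a <= n)%N -> `|c a - k| <= e) -> `|bern n c t - k| <= e.
Proof.
move=> t01 ck; rewrite ler_norml; apply/andP; split.
- rewrite lerBrDl -[X in X <= _](bern_cst n _ t); apply: bern_le => // a /ck.
  by rewrite ler_norml; lra.
- rewrite lerBlDl -[X in _ <= X](bern_cst n _ t); apply: bern_le => // a /ck.
  by rewrite ler_norml; lra.
Qed.

Lemma bern_dist_le n c d (k : R) t : 0 <= t <= 1 ->
  (forall a, (a <= n)%N -> `|c a - k| <= d a) -> `|bern n c t - k| <= bern n d t.
Proof.
move=> t01 ck; rewrite ler_norml; apply/andP; split.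
- rewrite lerBrDl -mulN1r -bernZ -[X in X + _](bern_cst n _ t) -bernD.
  by apply: bern_le => // a /ck; rewrite ler_norml; lra.
- rewrite lerBlDl -[X in X + _](bern_cst n _ t) -bernD.
  by apply: bern_le => // a /ck; rewrite ler_norml; lra.
Qed.

(** Coefficients and parameter both move with [y]. The second term is the classical derivative, [n]
    times the polynomial of degree [n - 1] of the forward differences; for [n = 0] the factor [n%:R]
    removes it. *)
Lemma is_derive_bern (V : normedModType R) n (x v : V) (h : nat -> V -> R)
    (dh : nat -> R) (th : V -> R) (dth : R) :
  (forall a, is_derive x v (h a) (dh a)) -> is_derive x v th dth ->
  is_derive x v (fun y => bern n (h^~ y) (th y))
    (bern n dh (th x) +
     dth * (n%:R * bern n.-1 (fun a => h a.+1 x - h a x) (th x))).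
Proof.
move=> dhx dthx; elim: n h dh dhx => [|n IHn] h dh dhx /=.
  by apply: is_derive_eq (dhx 0%N) _; ring.
have D1 := IHn h dh dhx.
have D2 := IHn (fun a => h a.+1) (dh \o S) (fun a => dhx a.+1).
have D3 : is_derive x v (fun y => 1 - th y) (- dth).
  have := is_deriveB (is_derive_cst (1 : R) x v) dthx.
  by rewrite sub0r.
have D4 := is_deriveD (is_deriveM D3 D1) (is_deriveM dthx D2).
apply: (is_derive_eq D4) => {D4}; rewrite /GRing.scale/= -!/(GRing.mul _ _).
set T := th x.
case: n {IHn D1 D2} => [|n] /=; first by rewrite /comp; ring.
by rewrite /comp !bernB -(natr1 n.+1); ring.
Qed.

End bernstein.

(** * Coordinate lines, cubes and moduli of continuity *)

Section coordinates.
Context {R : realType} {m : nat}.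
Implicit Types (x y : 'rV[R]_m) (i j : 'I_m) (g : 'rV[R]_m -> R).

Definition upd x i (s : R) : 'rV[R]_m := \row_j if j == i then s else x 0 j.

Definition cube (M : R) : set 'rV[R]_m := [set x | forall i, `|x 0 i| <= M].

Lemma upd_eq x i s : upd x i s 0 i = s.
Proof. by rewrite mxE eqxx. Qed.

Lemma upd_neq x i j s : j != i -> upd x i s 0 j = x 0 j.
Proof. by rewrite mxE => /negbTE ->. Qed.

Lemma upd_cube M x i s : cube M x -> `|s| <= M -> cube M (upd x i s).
Proof. by move=> Mx Ms j; rewrite mxE; case: eqP. Qed.

Lemma line_upd x i (h : R) : h *: delta_mx 0 i + x = upd x i (h + x 0 i).
Proof.
apply/rowP => j; rewrite !mxE eqxx/=; case: eqP => [->|_]; first by rewrite mulr1.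
by rewrite mulr0 add0r.
Qed.

Lemma upd_upd x i s t : upd (upd x i s) i t = upd x i t.
Proof. by apply/rowP => j; rewrite !mxE; case: eqP. Qed.

(** A directional derivative sees only the restriction to a line, so it passes between functions on
    different spaces that agree along corresponding lines. This reduces partial derivatives to
    one-variable calculus. *)
Lemma is_derive_line (V V' W : normedModType R) (f : V -> W) (f' : V' -> W)
    (x v : V) (x' v' : V') df :
  (forall h : R, f (h *: v + x) = f' (h *: v' + x')) ->
  is_derive x' v' f' df -> is_derive x v f df.
Proof.
move=> ff' [d' <-].
have E : (fun h : R => h^-1 *: (f (h *: v + x) - f x)) =
         (fun h : R => h^-1 *: (f' (h *: v' + x') - f' x')).
  apply/funext => h; rewrite ff'; congr (_ *: (_ - _)).
  by have := ff' 0; rewrite !scale0r !add0r.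
by apply: DeriveDef; [rewrite /derivable E|rewrite /derive E].
Qed.

Lemma is_derive_upd g i (dg : 'rV[R]_m -> R) x (s : R) :
  is_derive (upd x i s) (delta_mx 0 i) g (dg (upd x i s)) ->
  is_derive s 1 (fun r => g (upd x i r)) (dg (upd x i s)).
Proof.
apply: is_derive_line => h.
by rewrite line_upd upd_eq upd_upd [_%:A]mulr1.
Qed.

Lemma is_derive_upd_neq g i j (d : R) x (s : R) : j != i ->
  is_derive (upd x i s) (delta_mx 0 j) g d ->
  is_derive x (delta_mx 0 j) (fun y => g (upd y i s)) d.
Proof.
move=> ji; apply: is_derive_line => h; congr (g _).
rewrite !line_upd upd_neq//; apply/rowP => k; rewrite !mxE.
by case: (eqVneq k i) => // ->; rewrite eq_sym (negbTE ji).
Qed.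

Lemma is_derive_upd_eq g i x (s : R) :
  is_derive x (delta_mx 0 i) (fun y => g (upd y i s)) 0.
Proof.
apply: (@is_derive_line _ _ _ _ (cst (g (upd x i s))) x _ x (delta_mx 0 i)).
by move=> h; rewrite line_upd upd_upd.
Qed.

Lemma is_derive_coord x i j :
  is_derive x (delta_mx 0 j) (fun y : 'rV[R]_m => y 0 i) (i == j)%:R.
Proof.
have D : is_derive (0 : R) 1 (fun h : R => h * (i == j)%:R + x 0 i) (i == j)%:R.
  have := is_deriveD (is_deriveM (is_derive_id (0 : R) 1)
    (is_derive_cst ((i == j)%:R : R) (0 : R) 1)) (is_derive_cst (x 0 i) (0 : R) 1).
  by move=> D; apply: (is_derive_eq D); rewrite /GRing.scale/= mul0r add0r addr0 mulr1.
apply: (is_derive_line _ D) => h.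
by rewrite !mxE eqxx/= [_%:A]mulr1 addr0.
Qed.

Lemma coord_cont i : continuous (fun x : 'rV[R]_m => x 0 i).
Proof. exact: coord_continuous. Qed.

Lemma cube_compact M : compact (cube M).
Proof.
rewrite (_ : cube M = [set v : 'rV[R]_m | forall i, v ord0 i \in `[- M, M]]).
  by apply: (@rV_compact _ _ (fun=> `[- M, M]%classic)) => _; exact: segment_compact.
by apply/seteqP; split => x /= Mx i; have := Mx i; rewrite in_itv/= ler_norml.
Qed.

Lemma cont_bounded (A : set 'rV[R]_m) g : compact A -> {within A, continuous g} ->
  exists2 B : R, 0 < B & forall x, A x -> `|g x| <= B.
Proof.
move=> cA cg.
have /ex_strict_bound_gt0[k k_gt0 /= gk] : bounded_set (g @` A).
  exact/compact_bounded/continuous_compact.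
by exists k => // x Ax; apply/ltW/gk; exists x.
Qed.

Lemma mx_ballE x y (e : R) : 0 < e -> (forall i, `|x 0 i - y 0 i| < e) -> ball x e y.
Proof. by move=> e0 xy; split => // i j; rewrite ord1; exact: xy. Qed.

Lemma ball_mxE x y (e : R) i : ball x e y -> `|x 0 i - y 0 i| < e.
Proof. by move=> [_]; exact. Qed.

(** Heine-Cantor through the covering form of compactness. Only [x] is confined to [A]; the nearby
    [y] is free. *)
Lemma unif_cont (A : set 'rV[R]_m) g (e : R) : compact A -> continuous g -> 0 < e ->
  exists2 d : R, 0 < d & forall x y, A x -> (forall i, `|x 0 i - y 0 i| < d) ->
    `|g x - g y| < e.
Proof.
move=> /compact_near_coveringP cA cg e0.
pose P (d : R) x := forall y, (forall i, `|x 0 i - y 0 i| < d) -> `|g x - g y| < e.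
have /(_ R (0^'+) P _) H := cA.
have : \forall d \near 0^'+, A `<=` P d.
  apply: H => x Ax.
  have e20 : 0 < e / 2 by rewrite divr_gt0.
  have /cvgrPdist_lt/(_ _ e20) := cg x.
  move=> /nbhs_ballP[r /= r0 xr].
  near=> x' d => /= y x'y.
  have xx' : ball x (r / 2) x' by near: x'; apply: nbhsx_ballx; rewrite divr_gt0.
  have d0 : 0 < d by near: d; exact: nbhs_right_gt.
  have dr : d < r / 2 by near: d; apply: nbhs_right_lt; rewrite divr_gt0.
  have h1 : `|g x - g x'| < e / 2.
    by apply: xr; apply: le_ball xx'; lra.
  have h2 : `|g x - g y| < e / 2.
    apply: xr; apply: mx_ballE => // i.
    have h1' : `|x 0 i - x' 0 i| < r / 2 := ball_mxE i xx'.
    apply: le_lt_trans (ler_distD (x' 0 i) _ _) _; rewrite [r]splitr.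
    exact: ltrD h1' (lt_trans (x'y i) dr).
  apply: le_lt_trans (ler_distD (g x) _ _) _; rewrite [e]splitr distrC.
  exact: ltrD h1 h2.
move=> [d /= d0 Hd]; exists (d / 2); first by rewrite divr_gt0.
move=> x y Ax; apply: (Hd (d / 2)) => //=; last by rewrite divr_gt0.
by rewrite /ball_/= sub0r normrN gtr0_norm ?divr_gt0//; lra.
Unshelve. all: by end_near. Qed.

(* Quadratic modulus of continuity, adapted to the second moments of Bernstein
   polynomials. *)
Lemma quadratic_modulus M g (e : R) : continuous g -> 0 < e ->
  exists2 L : R, 0 < L & forall x i s, cube M x -> `|s| <= M ->
    `|g (upd x i s) - g x| <= e + L * (s - x 0 i) ^+ 2.
Proof.
move=> cg e0.
have [d d0 gd] := unif_cont (@cube_compact M) cg e0.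
have [B B0 gB] := cont_bounded (@cube_compact M) (continuous_subspaceT cg).
have d20 : 0 < d ^+ 2 by rewrite exprn_gt0.
(* Displacements below [d] cost at most [e] by uniform continuity; for the others
   [1 <= (s - x 0 i) ^+ 2 / d ^+ 2], while the increment of [g] is at most [2 * B]. *)
exists (2 * B / d ^+ 2); first by rewrite divr_gt0// mulr_gt0.
move=> x i s Mx Ms.
have [sd|ds] := ltP `|s - x 0 i| d.
  apply: (@le_trans _ _ e); last by rewrite lerDl mulr_ge0 ?sqr_ge0// divr_ge0 ?mulr_ge0 ?ltW.
  apply/ltW; apply: gd; first exact: upd_cube.
  by move=> j; rewrite mxE; case: eqP => [->//|_]; rewrite subrr normr0.
apply: (@le_trans _ _ (2 * B)).
  have := ler_normB (g (upd x i s)) (g x).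
  have := gB _ Mx; have := gB _ (upd_cube i Mx Ms); lra.
apply: (@le_trans _ _ (2 * B / d ^+ 2 * (s - x 0 i) ^+ 2)); last by rewrite lerDr ltW.
rewrite mulrAC ler_pdivlMr//; apply: ler_wpM2l; first by rewrite mulr_ge0// ltW.
by rewrite -[leRHS]real_normK ?num_real// ler_sqr ?nnegrE// ltW.
Qed.

End coordinates.

(** * Bernstein smoothing on a cube, one coordinate at a time *)

Section bernstein_operator.
Context {R : realType} {m : nat}.
Variables (M : R) (M_gt0 : 0 < M).
Implicit Types (x y : 'rV[R]_m) (i j : 'I_m) (g : 'rV[R]_m -> R).

(** The mesh is [2 * M / n.+1]: with degree [n.+1] for the function, there is no division by [0] and
    the derivative has degree [n]. *)
Definition bnode (n a : nat) : R := - M + 2 * M * (a%:R / n.+1%:R).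

Definition bparam (s : R) : R := (s + M) / (2 * M).

(** The Bernstein operator of [[-M, M]] in the coordinate [i] alone, the other coordinates being
    parameters. *)
Definition bsmooth (n : nat) i g x : R :=
  bern n.+1 (fun a => g (upd x i (bnode n a))) (bparam (x 0 i)).

Lemma bparam01 s : `|s| <= M -> 0 <= bparam s <= 1.
Proof.
rewrite ler_norml => /andP[s1 s2]; have M20 : 0 < 2 * M by rewrite mulr_gt0.
by rewrite ler_pdivlMr// ler_pdivrMr//; apply/andP; split; lra.
Qed.

Lemma bnode_cube n a : (a <= n.+1)%N -> `|bnode n a| <= M.
Proof.
move=> an; have a0 : 0 <= a%:R / n.+1%:R :> R by rewrite divr_ge0.
have a1 : a%:R / n.+1%:R <= 1 :> R by rewrite ler_pdivrMr// mul1r ler_nat.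
have := mulr_ge0 (ltW M_gt0) a0; have := ler_wpM2l (ltW M_gt0) a1.
by rewrite /bnode -mulrA ler_norml; set q := M * _; lra.
Qed.

Lemma bnodeS n a : bnode n a.+1 - bnode n a = 2 * M / n.+1%:R.
Proof.
by rewrite /bnode -natr1; field; rewrite addrC natr1 pnatr_eq0.
Qed.

(** Degree [n.+1] serves the function and degree [n] its derivative, on the same nodes. After
    rescaling this is [bern_sqr]: the bias is [0] for [n.+1], and its square is [t ^+ 2 <= 1] for
    [n]. *)
Lemma bern_node_sqr n k s : `|s| <= M -> (k == n) || (k == n.+1) ->
  bern k (fun a => (bnode n a - s) ^+ 2) (bparam s) <= (2 * M) ^+ 2 / n.+1%:R.
Proof.
move=> Ms kn; have := bparam01 Ms; set t := bparam s => t01.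
have sE : s = - M + 2 * M * t by rewrite /t /bparam; field; rewrite gt_eqF.
have -> : (fun a : nat => (bnode n a - s) ^+ 2) =
          (fun a : nat => (2 * M / n.+1%:R) ^+ 2 * (a%:R - n.+1%:R * t) ^+ 2).
  apply/funext => a; rewrite /bnode sE -(natr1 n).
  by field; rewrite natr1 pnatr_eq0.
rewrite bernZ bern_sqr.
have -> : (2 * M) ^+ 2 / n.+1%:R = (2 * M / n.+1%:R) ^+ 2 * n.+1%:R.
  by field; rewrite addrC natr1 pnatr_eq0.
apply: ler_wpM2l; first exact: sqr_ge0.
case/andP: t01 => t0 t1.
have tt0 : 0 <= t * (1 - t) by rewrite mulr_ge0// subr_ge0.
have tt1 : t * (1 - t) <= 1 by nra.
have n0 : 0 <= n%:R :> R by [].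
case/orP: kn => /eqP ->; rewrite -(natr1 n).
  by have := mulr_ge0 n0 tt0; have := ler_wpM2l n0 tt1; nra.
rewrite subrr expr0n addr0 -mulrA.
by rewrite -[leRHS]mulr1 ler_wpM2l// natr1.
Qed.

Lemma archi_div (c e : R) : 0 < e -> exists N, forall n, (N <= n)%N -> c / n.+1%:R <= e.
Proof.
move=> e0; exists (Num.bound `|c / e|) => n Nn.
rewrite ler_pdivrMr// mulrC -ler_pdivrMr// (le_trans (ler_norm _))//.
by rewrite (le_trans (ltW (archi_boundP (normr_ge0 _))))// ler_nat leqW.
Qed.

Lemma bsmooth_dist n i g h (e : R) : (forall x, cube M x -> `|g x - h x| <= e) ->
  forall x, cube M x -> `|bsmooth n i g x - bsmooth n i h x| <= e.
Proof.
move=> gh x Mx; rewrite /bsmooth -bernB -[X in `|X|]subr0.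
apply: bern_dist => [|a an]; first exact: bparam01.
by rewrite subr0; apply: gh; apply: upd_cube => //; exact: bnode_cube.
Qed.

Lemma bsmooth_ge0 n i g : (forall x, cube M x -> 0 <= g x) ->
  forall x, cube M x -> 0 <= bsmooth n i g x.
Proof.
move=> g0 x Mx; rewrite /bsmooth -[leLHS](bern_cst n.+1 0 (bparam (x 0 i))).
apply: bern_le => [|a an]; first exact: bparam01.
by apply: g0; apply: upd_cube => //; exact: bnode_cube.
Qed.

(** Averaging the quadratic modulus of [g] leaves [e / 2] plus [L] times a second moment of order
    [1 / n], uniformly in the point and in the coordinate. *)
Lemma bsmooth_cvg g (e : R) : continuous g -> 0 < e ->
  exists N, forall n, (N <= n)%N -> forall i x, cube M x ->
    `|bsmooth n i g x - g x| <= e.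
Proof.
move=> cg e0; have e20 : 0 < e / 2 by rewrite divr_gt0.
have [L L0 gL] := quadratic_modulus M cg e20.
have [N HN] := archi_div (L * (2 * M) ^+ 2) e20.
exists N => n /HN Ln i x Mx.
apply: (le_trans (bern_dist_le
    (d := fun a => e / 2 + L * (bnode n a - x 0 i) ^+ 2)
    (bparam01 (Mx i)) _)) => [a an|].
  by apply: gL => //; exact: bnode_cube an.
rewrite bernD bern_cst bernZ [leRHS]splitr lerD2l (le_trans _ Ln)// -mulrA.
by rewrite ler_wpM2l ?(ltW L0)// bern_node_sqr// eqxx orbT.
Qed.

(** The points [xi a] stand for those that the mean value theorem yields in the mesh intervals. Each
    is within one mesh of its node, so [(v + w)^2 <= 2 v^2 + 2 w^2] reduces the bound to second
    moments at the nodes. *)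
Lemma bern_slope_cvg g (e : R) : continuous g -> 0 < e ->
  exists N, forall n, (N <= n)%N -> forall i x (xi : nat -> R), cube M x ->
    (forall a, bnode n a <= xi a <= bnode n a.+1) ->
    bern n (fun a => `|g (upd x i (xi a)) - g x|) (bparam (x 0 i)) <= e.
Proof.
move=> cg e0; have e20 : 0 < e / 2 by rewrite divr_gt0.
have [L L0 gL] := quadratic_modulus M cg e20.
have [N HN] := archi_div (4 * L * (2 * M) ^+ 2) e20.
exists N => n /HN Ln i x xi Mx Hxi.
pose q := (2 * M) ^+ 2 / n.+1%:R.
apply: (@le_trans _ _ (bern n (fun a => (e / 2 + 2 * L * q) +
    2 * L * (bnode n a - x 0 i) ^+ 2) (bparam (x 0 i)))).
  apply: bern_le => [|a an]; first exact: bparam01.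
  have /andP[x1 x2] := Hxi a.
  have b1 := bnode_cube (leqW an); have b2 := bnode_cube (an : a.+1 <= n.+1)%N.
  apply: (le_trans (gL _ _ _ Mx _)).
    by move: b1 b2; rewrite !ler_norml => /andP[? ?] /andP[? ?]; apply/andP; split; lra.
  rewrite -addrA lerD2l; have -> : 2 * L * q + 2 * L * (bnode n a - x 0 i) ^+ 2 =
    L * (2 * q + 2 * (bnode n a - x 0 i) ^+ 2) by ring.
  apply: ler_wpM2l; first exact: ltW.
  have d2 : (xi a - bnode n a) ^+ 2 <= q.
    apply: (@le_trans _ _ ((2 * M / n.+1%:R) ^+ 2)).
      rewrite ler_sqr ?nnegrE; [|lra|by rewrite divr_ge0// mulr_ge0// ltW].
      by rewrite -(bnodeS n a); lra.
    rewrite expr_div_n ler_wpM2l ?sqr_ge0// lef_pV2 ?posrE ?exprn_gt0//.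
    by rewrite -natrX ler_nat expnS expn1 leq_pmulr.
  have := sqr_ge0 ((xi a - bnode n a) - (bnode n a - x 0 i)).
  by move: d2; rewrite /= !expr2; lra.
rewrite bernD bern_cst bernZ.
have : 2 * L * bern n (fun a => (bnode n a - x 0 i) ^+ 2) (bparam (x 0 i)) <= 2 * L * q.
  apply: ler_wpM2l; first by rewrite mulr_ge0// ltW.
  by apply: bern_node_sqr => //; rewrite eqxx.
have : 4 * L * q <= e / 2 by rewrite mulrA.
lra.
Qed.

Lemma is_derive_bparam x i j : is_derive x (delta_mx 0 j)
  (fun y : 'rV[R]_m => bparam (y 0 i)) ((i == j)%:R / (2 * M)).
Proof.
have D := is_deriveM (is_deriveD (is_derive_coord x i j)
  (is_derive_cst M x (delta_mx 0 j)))
  (is_derive_cst ((2 * M)^-1) x (delta_mx 0 j)).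
by apply: (is_derive_eq D); rewrite /GRing.scale/= mulr0 add0r addr0 mulrC.
Qed.

(** Each smoothing adds one error [e] and does not amplify the earlier ones, since Bernstein
    averages contract the uniform distance. In the smoothed coordinate the derivative averages
    difference quotients, which are derivative values by the mean value theorem; in the other
    coordinates differentiation commutes with smoothing. That [n] precedes [s] lets the induction on
    [s] keep one degree. *)
Lemma bernstein_C1 g (dg : 'I_m -> 'rV[R]_m -> R) (e : R) :
  continuous g -> (forall i, continuous (dg i)) ->
  (forall i x, is_derive x (delta_mx 0 i) g (dg i x)) -> 0 < e ->
  exists n, forall s : seq 'I_m, exists dh : 'I_m -> 'rV[R]_m -> R,
    let h := foldr (bsmooth n) g s in
    (forall i x, is_derive x (delta_mx 0 i) h (dh i x)) /\
    (forall x, cube M x -> `|h x - g x| <= (size s)%:R * e /\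
       forall i, `|dh i x - dg i x| <= (size s)%:R * e).
Proof.
move=> cg cdg dgg e0.
have [N0 HN0] := bsmooth_cvg cg e0.
have /choice[N1 HN1] := fun i => bsmooth_cvg (cdg i) e0.
have /choice[N2 HN2] := fun i => bern_slope_cvg (cdg i) e0.
pose n := maxn N0 (\max_i maxn (N1 i) (N2 i)).
have n0 : (N0 <= n)%N by exact: leq_maxl.
have n1 i : (N1 i <= n)%N.
  by rewrite leq_max (leq_trans _ (leq_bigmax i)) ?orbT// leq_maxl.
have n2 i : (N2 i <= n)%N.
  by rewrite leq_max (leq_trans _ (leq_bigmax i)) ?orbT// leq_maxr.
exists n; elim => [|i s [dh [Dh Eh]]].
  by exists dg; split => //= x Mx; rewrite mul0r subrr normr0; split => // i; rewrite subrr normr0.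
set h := foldr _ _ _ in Dh Eh.
have mvt x a : exists r : R, bnode n a <= r <= bnode n a.+1 /\
    h (upd x i (bnode n a.+1)) - h (upd x i (bnode n a)) =
    dh i (upd x i r) * (2 * M / n.+1%:R).
  have lt_node : bnode n a < bnode n a.+1.
    by rewrite -subr_gt0 bnodeS divr_gt0// mulr_gt0.
  have D r := is_derive_upd (Dh i (upd x i r)).
  have cD : {within `[bnode n a, bnode n a.+1], continuous (fun r => h (upd x i r))}.
    apply: continuous_subspaceT => r.
    by apply/differentiable_continuous/derivable1_diffP; have [] := D r.
  have [r] := MVT lt_node (fun r _ => D r) cD.
  rewrite bnodeS in_itv/= => /andP[r1 r2] E.
  by exists r; rewrite !ltW.
pose dh' j x := if j == i then
    bern n (fun a => h (upd x i (bnode n a.+1)) - h (upd x i (bnode n a)))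
      (bparam (x 0 i)) * (n.+1%:R / (2 * M))
  else bsmooth n i (dh j) x.
exists dh'; split.
  move=> j x; have Dp := is_derive_bparam x i j; rewrite /dh' /= -/h.
  have [->|ji] := eqVneq j i.
    have D := is_derive_bern n.+1 (fun a => is_derive_upd_eq h i x (bnode n a))
      (is_derive_bparam x i i).
    by apply: (is_derive_eq D); rewrite bern_cst eqxx /=; field; rewrite gt_eqF.
  have D := is_derive_bern n.+1 (fun a => is_derive_upd_neq ji (Dh j (upd x i (bnode n a)))) Dp.
  by apply: (is_derive_eq D); rewrite eq_sym (negbTE ji) !mul0r addr0.
move=> x Mx /=; rewrite -/h -natr1 mulrDl mul1r; split.
  rewrite -(subrKA (bsmooth n i g x)); apply: (le_trans (ler_normD _ _)); apply: lerD.
    by apply: bsmooth_dist Mx => y /Eh[].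
  exact: HN0.
move=> j; rewrite /dh'; case: eqVneq => [->|ji]; last first.
  rewrite -(subrKA (bsmooth n i (dg j) x)); apply: (le_trans (ler_normD _ _)); apply: lerD.
    by apply: bsmooth_dist Mx => y /Eh[].
  exact: HN1.
have /choice[xi Hxi] := mvt x.
have -> : (fun a => h (upd x i (bnode n a.+1)) - h (upd x i (bnode n a))) =
    fun a => 2 * M / n.+1%:R * dh i (upd x i (xi a)).
  by apply/funext => a; rewrite (Hxi a).2 mulrC.
rewrite bernZ mulrAC mulrA divfK// divff ?mul1r; last by rewrite gt_eqF// mulr_gt0.
apply: (le_trans (bern_dist_le (d := fun a => (size s)%:R * e +
    `|dg i (upd x i (xi a)) - dg i x|) (bparam01 (Mx i)) _)) => [a an|].
  rewrite -(subrKA (dg i (upd x i (xi a)))) (le_trans (ler_normD _ _))// lerD2r.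
  apply: (Eh _ _).2; apply: upd_cube => //.
  have /andP[x1 x2] := (Hxi a).1.
  have b1 := bnode_cube (leqW an); have b2 := bnode_cube (an : a.+1 <= n.+1)%N.
  by move: b1 b2; rewrite !ler_norml => /andP[? ?] /andP[? ?]; apply/andP; split; lra.
rewrite bernD bern_cst lerD2l; apply: HN2 => // a; exact: (Hxi a).1.
Qed.

End bernstein_operator.

(** * Smooth functions and test functions *)

Section smooth_functions.
Context {R : realType} {m : nat}.
Implicit Types (x y : 'rV[R]_m) (i j : 'I_m) (f g h : 'rV[R]_m -> R).

Lemma is_derive_comp1 (V : normedModType R) (F : R -> R) (q : V -> R) (x v : V) a b :
  is_derive (q x) 1 F a -> is_derive x v q b ->
  is_derive x v (fun z : V => F (q z)) (a * b).
Proof.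
move=> DF Dq; pose p (h : R) := q (h *: v + x).
have Dp : is_derive (0 : R) 1 p b.
  apply: (is_derive_line _ Dq) => h.
  by rewrite /p [_%:A]mulr1 addr0.
have D : is_derive (0 : R) 1 (F \o p) (a * b).
  by apply: is_derive1_comp; rewrite /p scale0r add0r.
by apply: (is_derive_line _ D) => h; rewrite /= /p [_%:A]mulr1 addr0.
Qed.

Lemma near_eq0_closed (S : set 'rV[R]_m) g x : closed S -> ~ S x ->
  (forall y, ~ S y -> g y = 0) -> \near x, g x = 0.
Proof.
move=> cS Sx g0; have : nbhs x (~` S) by apply: open_nbhs_nbhs; split=> //; exact: closed_openC.
by apply: filterS => y; exact: g0.
Qed.

(** At a point off the closed set [S], the function is [0] in a whole neighbourhood; hence only
    points of [S] require an argument. This is how functions regular only on an annulus are extended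
    by [0]. *)
Lemma is_derive_glue (S : set 'rV[R]_m) g (dg : 'rV[R]_m -> R) v : closed S ->
  (forall x, S x -> is_derive x v g (dg x)) ->
  (forall x, ~ S x -> g x = 0 /\ dg x = 0) ->
  forall x, is_derive x v g (dg x).
Proof.
move=> cS DS D0 x; have [/DS//|Sx] := pselect (S x).
rewrite (D0 x Sx).2; apply: (@near_eq_is_derive _ _ _ (cst 0)).
have := near_eq0_closed cS Sx (fun y Sy => (D0 y Sy).1).
by apply: filterS => y ->.
Qed.

Lemma continuous_glue (S : set 'rV[R]_m) g : closed S ->
  (forall x, S x -> {for x, continuous g}) -> (forall x, ~ S x -> g x = 0) ->
  continuous g.
Proof.
move=> cS DS D0 x; have [/DS//|Sx] := pselect (S x).
rewrite /continuous_at (D0 x Sx).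
have g0 := near_eq0_closed cS Sx D0.
exact: (@cvg_near_cst _ _ (0 : R) g (nbhs x) (nbhs_filter x) g0).
Qed.

Lemma Ck_cont k f : Ck k f -> continuous f.
Proof. by case: k => [|k] // -[]. Qed.

Lemma CkW k f : Ck k.+1 f -> Ck k f.
Proof.
elim: k f => [|k IHk] f; first by case.
move=> [cf Df]; split => // i; have [d Dk] := Df i; split => //.
by apply: IHk.
Qed.

Lemma Ck_is_derive k f i x : Ck k.+1 f -> is_derive x (delta_mx 0 i) f (partial i f x).
Proof. by move=> [_ /(_ i)[d _]]; apply: derivableP. Qed.

Lemma Ck_build k f (df : 'I_m -> 'rV[R]_m -> R) : continuous f ->
  (forall i x, is_derive x (delta_mx 0 i) f (df i x)) ->
  (forall i, Ck k (df i)) -> Ck k.+1 f.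
Proof.
move=> cf Df Cdf; split => // i; split; first by move=> x; have [] := Df i x.
suff -> : partial i f = df i by [].
by apply/funext => x; have [_] := Df i x.
Qed.

Lemma Ck_cst k (c : R) : Ck k (fun _ : 'rV[R]_m => c).
Proof.
elim: k c => [|k IHk] c; first exact: cst_continuous.
apply: (Ck_build (df := fun _ _ => 0)) => [|i]; last exact: IHk.
exact: cst_continuous.
Qed.

Lemma CkD k f g : Ck k f -> Ck k g -> Ck k (fun x => f x + g x).
Proof.
elim: k f g => [|k IHk] f g Cf Cg.
  move=> x; exact: cvgD ((Cf : continuous f) x) ((Cg : continuous g) x).
apply: (Ck_build (df := fun i x => partial i f x + partial i g x)) => [x|i x|i].
- exact: cvgD (Ck_cont Cf (x := x)) (Ck_cont Cg (x := x)).
- exact: is_deriveD (Ck_is_derive i x Cf) (Ck_is_derive i x Cg).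
- by apply: IHk; [exact: (Cf.2 i).2|exact: (Cg.2 i).2].
Qed.

Lemma CkM k f g : Ck k f -> Ck k g -> Ck k (fun x => f x * g x).
Proof.
elim: k f g => [|k IHk] f g Cf Cg.
  move=> x; exact: cvgM ((Cf : continuous f) x) ((Cg : continuous g) x).
apply: (Ck_build (df := fun i x => f x * partial i g x + g x * partial i f x)) => [x|i x|i].
- exact: cvgM (Ck_cont Cf (x := x)) (Ck_cont Cg (x := x)).
- exact: is_deriveM (Ck_is_derive i x Cf) (Ck_is_derive i x Cg).
- apply: CkD; apply: IHk; try exact: CkW.
    exact: (Cg.2 i).2.
  exact: (Cf.2 i).2.
Qed.

Lemma Ck_coord k i : Ck k (fun x : 'rV[R]_m => x 0 i).
Proof.
case: k => [|k]; first exact: coord_cont.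
apply: (Ck_build (df := fun j _ => (i == j)%:R)) => [|j x|j]; last exact: Ck_cst.
  exact: coord_cont.
exact: is_derive_coord.
Qed.

(* Smoothing in all the coordinates turns [g] into a polynomial: after smoothing in
   the coordinates [s], the function is polynomial in [x] and in the values of [g]
   at points whose coordinates in [s] are frozen, [alg (partial_evals g s)]. *)
Inductive alg (B : ('rV[R]_m -> R) -> Prop) : ('rV[R]_m -> R) -> Prop :=
| alg_cst c : alg B (fun=> c)
| alg_coord i : alg B (fun x => x 0 i)
| alg_base f : B f -> alg B f
| alg_add f g : alg B f -> alg B g -> alg B (fun x => f x + g x)
| alg_mul f g : alg B f -> alg B g -> alg B (fun x => f x * g x).

Definition polyfun := alg (fun=> False).

Lemma polyfun_Cinfty f : polyfun f -> Cinfty f.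
Proof.
move=> pf k; elim: pf => [c|i|//|f1 f2 _ H1 _ H2|f1 f2 _ H1 _ H2].
- exact: Ck_cst.
- exact: Ck_coord.
- exact: CkD.
- exact: CkM.
Qed.

Definition upds (s : seq 'I_m) x y : 'rV[R]_m :=
  \row_i if i \in s then y 0 i else x 0 i.

Definition partial_evals g (s : seq 'I_m) f := exists y, f = fun x => g (upds s x y).

Lemma alg_upd g s i c f : alg (partial_evals g s) f ->
  alg (partial_evals g (i :: s)) (fun x => f (upd x i c)).
Proof.
elim=> [d|j|_ [y ->]|f1 f2 _ H1 _ H2|f1 f2 _ H1 _ H2].
- exact: alg_cst.
- have [->|ji] := eqVneq j i.
    by under eq_fun do rewrite upd_eq; exact: alg_cst.
  by under eq_fun do rewrite upd_neq//; exact: alg_coord.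
(* If [i] is already frozen, [y] supplies that coordinate and the update has no effect; otherwise
   the value [c] is stored in [y]. *)
- apply: alg_base; exists (if i \in s then y else upd y i c).
  apply/funext => x; congr g; apply/rowP => k; rewrite !mxE in_cons.
  have [->|ki] := eqVneq k i; first by case: ifPn => //; rewrite upd_eq.
  by case: (i \in s) => /=; case: ifP => //; rewrite upd_neq.
- exact: alg_add.
- exact: alg_mul.
Qed.

Lemma alg_bern B n (h : nat -> 'rV[R]_m -> R) t : alg B t ->
  (forall a, alg B (h a)) -> alg B (fun x => bern n (h^~ x) (t x)).
Proof.
move=> Bt; elim: n h => [|n IHn] h Bh /=; first exact: Bh.
apply: alg_add; apply: alg_mul => //.
- apply: (alg_add (f := fun=> 1)); first exact: alg_cst.
  rewrite (_ : (fun _ => - _) = fun x => -1 * t x).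
    by apply: alg_mul => //; exact: alg_cst.
  by apply/funext => x; rewrite mulN1r.
- exact: IHn.
- by apply: (IHn (fun a => h a.+1)).
Qed.

Lemma alg_bsmooth M g n s :
  alg (partial_evals g s) (foldr (bsmooth M n) g s).
Proof.
elim: s => [|i s IHs] /=.
  apply: alg_base; exists 0; apply/funext => x; congr g.
  by apply/rowP => i; rewrite mxE.
apply: alg_bern => [|a]; last exact: alg_upd.
apply: alg_mul; last exact: alg_cst.
by apply: alg_add; [exact: alg_coord|exact: alg_cst].
Qed.

(** Once every coordinate is frozen, the remaining values of [g] are constants. *)
Lemma polyfun_bsmooth M g n :
  polyfun (foldr (bsmooth M n) g (enum 'I_m)).
Proof.
elim: (alg_bsmooth M g n (enum 'I_m)) => [c|j|_ [y ->]|f1 f2 _ H1 _ H2|f1 f2 _ H1 _ H2].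
- exact: alg_cst.
- exact: alg_coord.
- rewrite (_ : (fun _ => _) = fun=> g y); first exact: alg_cst.
  by apply/funext => x; congr g; apply/rowP => i; rewrite mxE mem_enum.
- exact: alg_add.
- exact: alg_mul.
Qed.

End smooth_functions.

(** * The smooth function [exp(-1/t)] and its derivatives *)

Section bump.
Context {R : realType}.

(** The functions [t^-k exp(-1/t)], extended by [0], span a space closed under differentiation, so
    smoothness of the case [k = 0] follows by an induction over all [k] at once. *)
Definition bump (k : nat) (t : R) : R :=
  if 0 < t then t^-1 ^+ k * expR (- t^-1) else 0.

Lemma bump_ge0 k t : 0 <= bump k t.
Proof.
rewrite /bump; case: ifPn => // t0.
by rewrite mulr_ge0 ?expR_ge0// exprn_ge0// invr_ge0 ltW.
Qed.

Lemma bump_gt0 k t : 0 < t -> 0 < bump k t.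
Proof.
by move=> t0; rewrite /bump t0 mulr_gt0 ?expR_gt0// exprn_gt0// invr_gt0.
Qed.

(** The term of order [k.+1] of the series of [exp(1/t)] has one power of [1/t] more than [t^-k];
    that power leaves the factor [t]. *)
Lemma bump_le k t : 0 < t -> bump k t <= k.+1`!%:R * t.
Proof.
move=> t0; rewrite /bump t0 expRN ler_pdivrMr ?expR_gt0//.
have ti0 : 0 < t^-1 by rewrite invr_gt0.
have F : 0 < k.+1`!%:R :> R by rewrite ltr0n fact_gt0.
have := expR_ge1Dxn k (ltW ti0) => H.
have F0 : k.+1`!%:R * t * (t^-1 ^+ k.+1 / k.+1`!%:R) = t^-1 ^+ k.
  rewrite exprS; set P := t^-1 ^+ k; set Q := (k.+1`!)%:R in F *.
  by field; rewrite !gt_eqF.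
rewrite -F0; apply: ler_wpM2l; first by rewrite mulr_ge0// ltW.
by apply: le_trans H; rewrite lerDr.
Qed.

Lemma bump_cont0 k : {for (0 : R), continuous (bump k)}.
Proof.
have c0 : {for 0, continuous (fun t : R => k.+1`!%:R * `|t|)}.
  by move=> ?; apply: cvgM; [exact: cst_continuous|exact: norm_continuous].
apply/cvgrPdist_lt => e e0.
have /cvgrPdist_lt/(_ _ e0) := c0; apply: filterS => t.
rewrite normr0 mulr0 [X in _ -> `|X - _| < _](_ : _ = 0); last by rewrite /bump ltxx.
rewrite !sub0r !normrN; apply: le_lt_trans; rewrite ger0_norm ?bump_ge0//.
rewrite [leRHS]ger0_norm ?mulr_ge0//.
have [t0|t0] := ltP 0 t; first by rewrite gtr0_norm//; exact: bump_le.
by rewrite /bump ltNge t0 mulr_ge0.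
Qed.

Lemma is_derive_bump (k : nat) (t : R) :
  is_derive t 1 (bump k) (- k%:R * bump k.+1 t + bump k.+2 t).
Proof.
have [t0|t0|->] := ltgtP t 0.
- rewrite /bump (lt_gtF t0) mulr0 addr0.
  apply: (@near_eq_is_derive _ _ _ (cst 0)).
  near=> s; rewrite /bump ifF//; apply/negbTE; rewrite -leNgt ltW//.
  by near: s; exact: lt_nbhsl.
- have D1 : is_derive t 1 (fun s : R => s^-1) (- t ^- 2).
    have := is_deriveV (lt0r_neq0 t0) (is_derive_id t (1 : R)).
    by move=> D; apply: (is_derive_eq D); rewrite /GRing.scale/= mulr1.
  have D2 : is_derive t 1 (fun s : R => expR (- s^-1)) (expR (- t^-1) * t ^- 2).
    have D := @is_derive1_comp _ expR (fun s : R => - s^-1) t _ _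
      (is_derive_expR _) (is_deriveN D1).
    by apply: (is_derive_eq D); rewrite opprK.
  have D3 := is_deriveM (is_deriveX k D1) D2.
  have E : (((fun s : R => s^-1) ^+ k) t *: (expR (- t^-1) * t ^- 2) +
    expR (- t^-1) *: ((k%:R * t^-1 ^+ k.-1) *: - t ^- 2)) =
    - k%:R * bump k.+1 t + bump k.+2 t.
    rewrite /bump t0 /GRing.scale/= exprfctE -exprVn.
    by case: k {D3} => [|k] /=; rewrite ?exprS; ring.
  rewrite -E; apply: (@near_eq_is_derive _ _ _ _ _ _ _ _ _ D3).
  near=> s; rewrite /bump ifT; first by rewrite mulrfctE exprfctE.
  by near: s; exact: lt_nbhsr.
(* Away from [0], the difference quotient of [bump k] at [0] is [bump k.+1] itself, which is
   continuous at [0]. *)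
- apply/is_derive1_caratheodory; exists (bump k.+1); split.
  + move=> z; rewrite subr0 /bump ltxx subr0; case: ifPn; last by rewrite mul0r.
    by move=> z0; rewrite exprS; field; rewrite gt_eqF.
  + exact: bump_cont0.
  + by rewrite /bump ltxx mulr0 add0r.
Unshelve. all: by end_near. Qed.

Lemma bump_continuous k : continuous (bump k).
Proof.
move=> t; apply/differentiable_continuous/derivable1_diffP.
by have [] := is_derive_bump k t.
Qed.

End bump.

(** * A smooth cutoff of the cube, and C^1 density of test functions *)

Section cutoff.
Context {R : realType} {m : nat}.
Implicit Types (x y : 'rV[R]_m) (i j : 'I_m).

Lemma Ck_bump n k (c s : R) i : Ck n (fun x => bump k (c + s * x 0 i)).
Proof.
have cp : continuous (fun x => c + s * x 0 i).
  exact: (CkD (Ck_cst 0 c) (CkM (Ck_cst 0 s) (Ck_coord 0 i))).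
have cb k' : continuous (fun x => bump k' (c + s * x 0 i)).
  by move=> x; exact: (@continuous_comp _ _ _ _ (bump k') x (cp x) (@bump_continuous _ k' _)).
elim: n k => [|n IHn] k; first exact: cb.
apply: (Ck_build (df := fun j x => (- k%:R * bump k.+1 (c + s * x 0 i) +
    bump k.+2 (c + s * x 0 i)) * (s * (i == j)%:R))) => [//|j x|j].
- apply: is_derive_comp1; first exact: is_derive_bump.
  have D := is_deriveD (is_derive_cst c x (delta_mx 0 j))
   (is_deriveM (is_derive_cst s x (delta_mx 0 j)) (is_derive_coord x i j)).
  by apply: (is_derive_eq D); rewrite /GRing.scale/= mulr0 addr0 add0r.
- apply: CkM; last exact: Ck_cst.
  by apply: CkD => //; apply: CkM => //; exact: Ck_cst.
Qed.

Definition cutoff (M : R) x : R :=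
  \prod_i (bump 0 (M + 1 * x 0 i) * bump 0 (M + -1 * x 0 i)).

Lemma Ck_cutoff n M : Ck n (cutoff M).
Proof.
rewrite /cutoff; elim: (index_enum _) => [|i s IHs].
  by under eq_fun do rewrite big_nil; exact: Ck_cst.
under eq_fun do rewrite big_cons.
by apply: CkM => //; apply: CkM; exact: Ck_bump.
Qed.

Lemma cutoff_ge0 M x : 0 <= cutoff M x.
Proof. by apply: prodr_ge0 => i _; rewrite mulr_ge0 ?bump_ge0. Qed.

Lemma cutoff_gt0 M x : (forall i, `|x 0 i| < M) -> 0 < cutoff M x.
Proof.
move=> xM; apply: prodr_gt0 => i _.
have := xM i; rewrite ltr_norml => /andP[x1 x2].
by rewrite mulr_gt0// bump_gt0//; lra.
Qed.

Lemma cutoff_eq0 M x i : M <= `|x 0 i| -> cutoff M x = 0.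
Proof.
move=> Mx; rewrite /cutoff (bigD1 i)//= /bump.
have [x0|x0] := leP 0 (x 0 i).
  by rewrite ger0_norm// in Mx; rewrite [X in _ * X * _]ifF ?mulr0 ?mul0r//; lra.
by rewrite ltr0_norm// in Mx; rewrite ifF ?mul0r//; lra.
Qed.

Lemma cube_closed M : closed (@cube R m M).
Proof. by apply: compact_closed; [exact: norm_hausdorff|exact: cube_compact]. Qed.

Lemma dcutoff_eq0 M x i j : M < `|x 0 i| -> partial j (cutoff M) x = 0.
Proof.
move=> Mx; rewrite /partial (@near_eq_derive _ _ _ _ (cst 0)) ?derive_cst//.
have cS : ~ cube M x by move=> /(_ i); rewrite leNgt Mx.
apply: (near_eq0_closed (@cube_closed M) cS) => y /existsNP[k /negP].
by rewrite -ltNge => /ltW /cutoff_eq0.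
Qed.

Lemma test_function_supp M (z : 'rV[R]_m -> R) : Cinfty z ->
  (forall x, ~ cube M x -> z x = 0) -> test_function z.
Proof.
move=> Cz zout; split => //.
apply: (subclosed_compact (@closed_closure _ _) (@cube_compact R m M)).
rewrite [X in _ `<=` X]((closure_id _).1 (@cube_closed M)).
by apply: closure_subset => x /=; apply: contra_neqP => /zout.
Qed.

(** A polynomial has no compact support, so [zeta] is not smoothed directly: its quotient by a
    smooth cutoff [X] of the larger cube is, and multiplication by [X] restores the support.
    Positivity survives because Bernstein smoothing and [X] are both non-negative. *)
Lemma test_function_density (M' M : R) zeta (dz : 'I_m -> 'rV[R]_m -> R) (e : R) :
  0 < M' < M -> continuous zeta -> (forall i, continuous (dz i)) ->
  (forall i x, is_derive x (delta_mx 0 i) zeta (dz i x)) ->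
  (forall x, ~ cube M' x -> zeta x = 0 /\ forall i, dz i x = 0) ->
  (forall x, 0 <= zeta x) -> 0 < e ->
  exists2 z, test_function z &
    (forall x, 0 <= z x) /\
    (forall x, ~ cube M x -> z x = 0 /\ forall i, partial i z x = 0) /\
    (forall x, `|z x - zeta x| <= e /\ forall i, `|partial i z x - dz i x| <= e).
Proof.
move=> /andP[M'0 M'M] cz cdz Dz supp z0 e0.
have M0 : 0 < M by exact: lt_trans M'M.
pose X : 'rV[R]_m -> R := cutoff M; pose dX i := partial i X.
have CX n : Ck n X by exact: Ck_cutoff.
have cX : continuous X by exact: (CX 0).
have cdX i : continuous (dX i) by exact: ((CX 1).2 i).2.
have DX i x : is_derive x (delta_mx 0 i) X (dX i x) := Ck_is_derive i x (CX 1%N).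
have X0 x : cube M' x -> 0 < X x.
  by move=> M'x; apply: cutoff_gt0 => i; exact: le_lt_trans (M'x i) M'M.
(* The quotient by the cutoff vanishes near the boundary of the larger cube, by
   [supp]; there [0^-1 = 0]. *)
pose h x := zeta x * (X x)^-1.
pose dh i x := zeta x * (- (X x) ^- 2 * dX i x) + (X x)^-1 * dz i x.
have ch : continuous h.
  apply: (continuous_glue (@cube_closed M')) => x Mx.
    have Xx : X x != 0 by rewrite gt_eqF// X0.
    exact: cvgM (cz x) (cvgV Xx (cX x)).
  by rewrite /h (supp x Mx).1 mul0r.
have cdh i : continuous (dh i).
  apply: (continuous_glue (@cube_closed M')) => x Mx; last first.
    by rewrite /dh (supp x Mx).1 (supp x Mx).2 mul0r mulr0 addr0.
  have Xx : X x != 0 by rewrite gt_eqF// X0.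
  have XX : X x * X x != 0 by rewrite mulf_neq0.
  exact: cvgD (cvgM (cz x) (cvgM (cvgN (cvgV XX (cvgM (cX x) (cX x)))) (cdX i x)))
    (cvgM (cvgV Xx (cX x)) (cdz i x)).
have Dh i x : is_derive x (delta_mx 0 i) h (dh i x).
  apply: (is_derive_glue (@cube_closed M')) => {}x Mx; last first.
    by rewrite /h /dh (supp x Mx).1 (supp x Mx).2 !mul0r mulr0 addr0.
  have Xx : X x != 0 by rewrite gt_eqF// X0.
  have D := is_deriveM (Dz i x) (is_derive_comp1 (is_deriveV Xx (is_derive_id _ _)) (DX i x)).
  by apply: (is_derive_eq D); rewrite /GRing.scale/= mulr1.
have hX x : X x * h x = zeta x.
  have [Mx|Mx] := pselect (cube M' x).
    by rewrite /h mulrCA divff ?mulr1// gt_eqF// X0.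
  by rewrite /h (supp x Mx).1 mul0r mulr0.
have dhX i x : X x * dh i x + h x * dX i x = dz i x.
  have [Mx|Mx] := pselect (cube M' x).
    by rewrite /h /dh; field; rewrite gt_eqF// X0.
  by rewrite /h /dh (supp x Mx).1 (supp x Mx).2 !(mul0r, mulr0) !addr0 mulr0.
have /cont_bounded : compact (@cube R m M) by exact: cube_compact.
move=> bnd.
have [B B0 XB] := bnd X (continuous_subspaceT cX).
have /choice[C HC] i : exists C : R, 0 < C /\ forall x, cube M x -> `|dX i x| <= C.
  by have [C C0 HC] := bnd (dX i) (continuous_subspaceT (@cdX i)); exists C.
(* The errors are [X * (p - h)] and, for the derivatives, [X * (dp i - dh i) + dX i * (p - h)]; [D]
   dominates the coefficients of both. *)
pose D := B + \sum_i C i.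
have CD i : C i <= \sum_i C i.
  by rewrite (bigD1 i)//= lerDl sumr_ge0// => j _; exact/ltW/(HC j).1.
have D0 : 0 < D.
  by rewrite ltr_pwDl// sumr_ge0// => j _; exact/ltW/(HC j).1.
pose s := enum 'I_m.
(* The aim is [(size s)%:R * e1 <= e / D]; the successor keeps the denominator positive even for an
   empty list of coordinates. *)
pose e1 := e / (D * (size s).+1%:R).
have e10 : 0 < e1 by rewrite divr_gt0// mulr_gt0.
have [n Hn] := bernstein_C1 M0 ch cdh Dh e10.
have [dp [Dp Ep]] := Hn s.
pose p := foldr (bsmooth M n) h s.
have Cp k : Ck k p by exact: (polyfun_Cinfty (polyfun_bsmooth M h n)).
have p0 x : cube M x -> 0 <= p x.
  rewrite /p; elim: s {Ep Dp Hn dp e1 e10 p Cp} x => [|i s IHs] x Mx /=.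
    by rewrite /h mulr_ge0// invr_ge0 cutoff_ge0.
  exact: bsmooth_ge0.
have se1 : (size s)%:R * e1 <= e / D.
  rewrite /e1 invfM [leLHS]mulrC -mulrA -mulrA mulrA ler_piMr ?divr_ge0 ?(ltW e0) ?(ltW D0)//.
  by rewrite mulrC ler_pdivrMr// mul1r ler_nat.
pose z x := X x * p x.
have Cz k : Ck k z by exact: CkM.
have Dz' i x : partial i z x = X x * partial i p x + p x * dX i x.
  have := is_deriveM (DX i x) (Ck_is_derive i x (Cp 1%N)) => DD.
  by have [_] := DD.
have Dp' i x : partial i p x = dp i x by have [_] := Dp i x.
have zout x : ~ cube M x -> z x = 0 /\ forall i, partial i z x = 0.
  move=> /existsNP[i /negP]; rewrite -ltNge => Mx.
  have Xx0 : X x = 0 := cutoff_eq0 (ltW Mx).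
  rewrite /z Xx0 mul0r; split => // j.
  by rewrite Dz' Xx0 /dX (dcutoff_eq0 _ Mx) mul0r mulr0 addr0.
exists z; first by apply: (@test_function_supp M) => // x /zout[].
split.
  move=> x; have [Mx|/zout[->]//] := pselect (cube M x).
  by rewrite mulr_ge0 ?cutoff_ge0 ?p0.
split => // x.
have [Mx|Mx] := pselect (cube M x); last first.
  have [-> zd] := zout _ Mx.
  have M'x : ~ cube M' x by move=> H; apply: Mx => i; exact: le_trans (H i) (ltW M'M).
  have [-> dzd] := supp _ M'x; rewrite subrr normr0; split; first exact: ltW.
  by move=> i; rewrite zd dzd subrr normr0 ltW.
have [E1 E2] := Ep x Mx; have XBx := XB x Mx.
pose q := e / D; have eD : e = D * q by rewrite /q mulrCA divff ?mulr1// gt_eqF.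
have eD0 : 0 <= q by rewrite divr_ge0 ?ltW.
have S0 : 0 <= \sum_i C i by rewrite sumr_ge0// => j _; exact/ltW/(HC j).1.
have BE (r : R) : `|r| <= (size s)%:R * e1 -> `|X x * r| <= B * q.
  by move=> Hr; rewrite normrM ler_pM// (le_trans Hr).
split.
  rewrite (_ : z x - zeta x = X x * (p x - h x)); last by rewrite -(hX x) mulrBr.
  by rewrite (le_trans (BE _ E1))// [leRHS]eD /D ler_wpM2r// lerDl.
move=> i; rewrite Dz' Dp' -(dhX i x).
rewrite opprD addrACA -mulrBr -mulrBl (le_trans (ler_normD _ _))// [leRHS]eD /D [leRHS]mulrDl.
apply: lerD; first exact: BE.
rewrite mulrC normrM ler_pM//; last exact: le_trans E1 _.
exact: le_trans ((HC i).2 x Mx) (CD i).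
Qed.

End cutoff.

(** * Integration on Euclidean space *)

Section tuple_integral.
Context {R : realType}.
Local Notation T := (measurableTypeR R).
Local Notation mu n := (@lebesgue_tuple R n).

Definition tbox n (M : R) : set (n.-tuple T) :=
  [set t | forall i, `[- M, M]%classic (tnth t i)].
Arguments tbox : clear implicits.

Lemma measurable_tbox n M : measurable (tbox n M).
Proof. by apply: (@measurable_tuple_box R n (fun=> `[- M, M]%classic)). Qed.

Lemma tbox_fin n M : (mu n (tbox n M) < +oo)%E.
Proof.
rewrite (@lebesgue_tuple_box R n (fun=> `[- M, M]%classic))//.
rewrite -ge0_fin_numE; last by apply: prode_ge0 => i _; exact: measure_ge0.
elim/big_ind: _ => [//|x y|i _]; first exact: fin_numM.
by rewrite lebesgue_measure_itv/=; case: ifP.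
Qed.

(** The class passes to slices with a coordinate fixed, with the same [M] and [B], as the induction
    on the dimension requires. *)
Definition bsupp n (M B : R) (G : n.-tuple T -> R) :=
  [/\ measurable_fun setT G, (forall t, `|G t| <= B) &
      forall t i, M < `|tnth t i| -> G t = 0].

Lemma bounded_supp_integrable d (S : measurableType d)
    (nu : {measure set S -> \bar R}) (D : set S) (B : R) (G : S -> R) :
  measurable D -> (nu D < +oo)%E -> measurable_fun setT G ->
  (forall t, `|G t| <= B) -> (forall t, ~ D t -> G t = 0) ->
  nu.-integrable setT (EFin \o G).
Proof.
move=> mD nuD mG bG sG.
have -> : EFin \o G = (EFin \o G) \_ D.
  apply/funext => t; rewrite /patch; case: ifPn => //= tD.
  by rewrite sG// => Dt; move/negP: tD; apply; rewrite inE.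
apply/integrable_restrict => //=.
rewrite setTI; apply: measurable_bounded_integrable => //.
  exact: measurable_funTS.
exists B; split; first exact: num_real.
by move=> x Bx t _ /=; exact: le_trans (bG t) (ltW Bx).
Qed.

Lemma bsupp_tbox n M B (G : n.-tuple T -> R) t : bsupp M B G -> ~ tbox n M t -> G t = 0.
Proof.
move=> [_ _ sG] /existsNP[i Hi]; apply: (sG t i).
by rewrite ltNge; apply/negP => tiM; apply: Hi => /=; rewrite in_itv/= -ler_norml.
Qed.

Lemma bsupp_integrable n M B (G : n.-tuple T -> R) : bsupp M B G ->
  (mu n).-integrable setT (EFin \o G).
Proof.
move=> bG; have [mG BG _] := bG.
apply: (@bounded_supp_integrable _ _ _ (tbox n M) B) => //.
- exact: measurable_tbox.
- exact: tbox_fin.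
- by move=> t; exact: bsupp_tbox bG.
Qed.

Definition tset n (t : n.-tuple T) (i : 'I_n) (s : T) : n.-tuple T :=
  [tuple if k == i then s else tnth t k | k < n].

Lemma integral_derive_supp (M : R) (G G' : R -> R) : 0 < M ->
  (forall s : R, is_derive s 1 G (G' s)) -> continuous G' ->
  (forall s, M < `|s| -> G s = 0 /\ G' s = 0) ->
  (\int[lebesgue_measure]_s (G' s)%:E = 0)%E.
Proof.
(* [G] is known to vanish only strictly beyond [M], hence the endpoints of a larger interval. *)
move=> M0 DG cG' sG; pose N := M + 1.
have MN : - N < N by rewrite /N; lra.
have -> : (\int[lebesgue_measure]_s (G' s)%:E =
    \int[lebesgue_measure]_(s in `[(- N)%R, N]) (G' s)%:E)%E.
  rewrite [RHS]integral_mkcond; apply: eq_integral => s _; rewrite patchE.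
  case: ifPn => // /negP sN; congr EFin; apply: (sG s _).2.
  rewrite ltNge; apply/negP => sM; apply: sN; rewrite inE/= in_itv/= -ler_norml.
  by rewrite (le_trans sM)// /N lerDl.
have cG : continuous G.
  by move=> s; apply/differentiable_continuous/derivable1_diffP; have [] := DG s.
rewrite (@continuous_FTC2 _ G' G)//.
- have N0 : M < `|N| by rewrite gtr0_norm /N; lra.
  by rewrite (sG N N0).1 (sG (- N) _).1 ?normrN// subee.
- exact: continuous_subspaceT.
- split; first by move=> s _; have [] := DG s.
  + exact/cvg_at_right_filter/cG.
  + exact/cvg_at_left_filter/cG.
- by move=> s _; rewrite derive1E; have [_] := DG s.
Qed.

Lemma tset_cons0 n (x s : T) (t : n.-tuple T) :
  tset (tcons (x, t)) ord0 s = tcons (s, t).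
Proof.
apply: eq_from_tnth => k; rewrite tnth_mktuple.
case: (unliftP ord0 k) => [j ->|->]; last by rewrite eqxx.
by rewrite /tcons !tnthS eq_sym (negbTE (neq_lift _ _)).
Qed.

Lemma tset_consS n (x s : T) (t : n.-tuple T) i :
  tset (tcons (x, t)) (lift ord0 i) s = tcons (x, tset t i s).
Proof.
apply: eq_from_tnth => k; rewrite tnth_mktuple.
case: (unliftP ord0 k) => [j ->|->]; last by rewrite (negbTE (neq_lift _ _)).
by rewrite /tcons !tnthS tnth_mktuple (inj_eq lift_inj).
Qed.

(** Fubini allows the coordinate [i] to be integrated first. If it is the first one, the inner
    integral is the fundamental theorem for a function vanishing at both ends; otherwise the slice
    over the remaining coordinates falls under the induction hypothesis. *)
Lemma integral_partial_tuple n (i : 'I_n) (M B : R) (G G' : n.-tuple T -> R) : 0 < M ->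
  bsupp M B G' ->
  (forall t (s : R), is_derive s 1 (fun r : R => G (tset t i r)) (G' (tset t i s))) ->
  (forall t, continuous (fun r : R => G' (tset t i r))) ->
  (forall t, M < `|tnth t i| -> G t = 0) ->
  (\int[mu n]_t (G' t)%:E = 0)%E.
Proof.
move=> M0; elim: n i G G' => [[]//|n IHn] i G G' bG' DG cG' sG.
have mt := @measurable_tcons R n.
have iG := bsupp_integrable bG'.
have [mG' BG' sG'] := bG'.
have iG2 : (lebesgue_measure \x mu n)%E.-integrable setT (EFin \o (G' \o @tcons R n)).
  apply: (@bounded_supp_integrable _ _ _ (@tcons R n @^-1` (tbox n.+1 M)) B).
  - by rewrite -[X in measurable X]setTI; apply: mt => //; exact: measurable_tbox.
  - exact: (tbox_fin n.+1 M).
  - exact: measurableT_comp.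
  - by move=> t; exact: BG'.
  - by move=> t; exact: bsupp_tbox bG'.
have -> : (\int[mu n.+1]_t (G' t)%:E =
    \int[lebesgue_measure \x mu n]_p (EFin \o (G' \o @tcons R n)) p)%E.
  have /measurable_EFinP mE := mG'.
  exact: (@integral_pushforward _ _ _ _ R (@tcons R n) mt
    (lebesgue_measure \x mu n)%E setT _ mE iG2 measurableT).
case: (unliftP ord0 i) => [j ij|i0]; subst i.
- rewrite -integral12_prod_meas1//=; apply: integral0_eq => x _.
  have tS t : tnth (tcons (x, t)) (lift ord0 j) = tnth t j by rewrite /tcons tnthS.
  apply: (IHn j (fun t => G (tcons (x, t)))) => [|t s|t|t tM].
  + split.
    * apply: (measurableT_comp mG'); apply: (measurableT_comp mt).
      exact: pair1_measurable.
    * by move=> t; exact: BG'.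
    * by move=> t k tM; apply: (sG' _ (lift ord0 k)); rewrite /tcons tnthS.
  + have := DG (tcons (x, t)) s; rewrite tset_consS.
    by under eq_fun do rewrite tset_consS.
  + by have := cG' (tcons (x, t)); under eq_fun do rewrite tset_consS.
  + by apply: sG; rewrite tS.
- rewrite -integral21_prod_meas1//=; apply: integral0_eq => t _.
  apply: (@integral_derive_supp M (fun s => G (tcons (s, t)))) => //.
  + move=> s; have := DG (tcons (s, t)) s; rewrite tset_cons0.
    by under eq_fun do rewrite tset_cons0.
  + by have := cG' (tcons (0, t)); under eq_fun do rewrite tset_cons0.
  + move=> s Ms; split; first exact: sG.
    by apply: (sG' _ ord0).
Qed.

End tuple_integral.

(** * Integrals of continuous functions supported in a cube *)

Section integral_continuous.
Context {R : realType} {m : nat}.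
Implicit Types (M : R) (g h : 'rV[R]_m -> R) (x : 'rV[R]_m) (t : m.-tuple (measurableTypeR R)).

Lemma bernstein_C0 M g (e : R) : 0 < M -> continuous g -> 0 < e ->
  exists n, forall (s : seq 'I_m) x, cube M x ->
    `|foldr (bsmooth M n) g s x - g x| <= (size s)%:R * e.
Proof.
move=> M0 cg e0; have [n Hn] := bsmooth_cvg M0 cg e0.
exists n; elim => [|i s IHs] x Mx /=; first by rewrite subrr normr0 mul0r.
rewrite -natr1 mulrDl mul1r -(subrKA (bsmooth M n i g x)).
apply: (le_trans (ler_normD _ _)); apply: lerD; last exact: Hn.
exact: bsmooth_dist.
Qed.

Lemma vec_of_tupleE t i : vec_of_tuple t 0 i = tnth t i.
Proof. by rewrite mxE. Qed.

Lemma measurable_polyfun g : polyfun g ->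
  measurable_fun setT (g \o @vec_of_tuple R m).
Proof.
elim=> [c|i|//|f1 f2 _ H1 _ H2|f1 f2 _ H1 _ H2].
- exact: measurable_cst.
- rewrite (_ : _ \o _ = (@tnth _ _)^~ i); first exact: measurable_tnth.
  by apply/funext => t; exact: vec_of_tupleE.
- exact: measurable_funD.
- exact: measurable_funM.
Qed.

Definition cc M g := [/\ 0 < M, continuous g & forall x, ~ cube M x -> g x = 0].

Lemma tbox_cube M t : @tbox R m M t <-> cube M (vec_of_tuple t).
Proof.
by split=> tM i; have := tM i; rewrite /= ?vec_of_tupleE in_itv/= ler_norml.
Qed.

(** The sigma-algebra on tuples is the product one, for which polynomials are measurable because
    coordinates are. [g] is a pointwise limit of Bernstein polynomials restricted to the box;
    outside the box they need not approximate it, hence the indicator. *)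
Lemma measurable_cc M g : cc M g -> measurable_fun setT (g \o @vec_of_tuple R m).
Proof.
move=> [M0 cg sg]; pose s := enum 'I_m.
pose e (k : nat) : R := ((size s).+1%:R * k.+1%:R)^-1.
have e0 k : 0 < e k by rewrite /e invr_gt0 mulr_gt0 ?ltr0n.
have /choice[n Hn] := fun k => bernstein_C0 M0 cg (e0 k).
pose G k t := foldr (bsmooth M (n k)) g s (vec_of_tuple t) * \1_(@tbox R m M) t.
apply: (@measurable_fun_cvg _ _ R setT G) => [k|t _].
  apply: measurable_funM; last by apply: measurable_indic; exact: measurable_tbox.
  exact: (measurable_polyfun (polyfun_bsmooth M g (n k))).
apply/cvgrPdist_le => d d0.
have [N HN] := archi_div 1 d0.
exists N => // k /= Nk; rewrite /G indicE distrC.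
have [tM|tM] := boolP (t \in (@tbox R m M)); last first.
  rewrite mulr0 sg ?subrr ?normr0 ?(ltW d0)// => /tbox_cube H.
  by move/negP: tM; apply; rewrite inE.
rewrite mulr1 (le_trans (Hn k s _ _))//; first by apply/tbox_cube; rewrite inE in tM.
rewrite /e invfM mulrA (le_trans _ (HN k Nk))// ler_wpM2r ?invr_ge0//.
by rewrite ler_pdivrMr// mul1r ler_nat.
Qed.

Lemma cc_bounded M g : cc M g -> exists2 B : R, 0 < B & forall x, `|g x| <= B.
Proof.
move=> [M0 cg sg].
have [B B0 HB] := cont_bounded (@cube_compact R m M) (continuous_subspaceT cg).
exists B => // x; have [/HB//|/sg ->] := pselect (cube M x).
by rewrite normr0 ltW.
Qed.

Lemma cc_bsupp M B g : cc M g -> (forall x, `|g x| <= B) ->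
  bsupp M B (g \o @vec_of_tuple R m).
Proof.
move=> cg gB; split; [exact: measurable_cc cg|by move=> t; exact: gB|].
move=> t i tM; have [_ _ sg] := cg; apply: sg => /(_ i).
by rewrite vec_of_tupleE leNgt tM.
Qed.

Lemma cc_integrable M g : cc M g ->
  (lebesgue_tuple m).-integrable setT (EFin \o (g \o @vec_of_tuple R m)).
Proof.
by move=> cg; have [B B0 gB] := cc_bounded cg; exact: bsupp_integrable (cc_bsupp cg gB).
Qed.

Lemma integral_Rn_D M g h : cc M g -> cc M h ->
  integral_Rn (fun x => g x + h x) = integral_Rn g + integral_Rn h.
Proof.
move=> cg ch; rewrite /integral_Rn -RintegralD//.
- exact: cc_integrable cg.
- exact: cc_integrable ch.
Qed.

Lemma integral_Rn_Z M g (c : R) : cc M g ->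
  integral_Rn (fun x => c * g x) = c * integral_Rn g.
Proof.
by move=> cg; rewrite /integral_Rn -RintegralZl//; exact: cc_integrable cg.
Qed.

Definition cube_vol (M : R) : R := fine (lebesgue_tuple m (@tbox R m M)).

Lemma cube_vol_ge0 M : 0 <= cube_vol M.
Proof. exact/fine_ge0/measure_ge0. Qed.

Lemma integral_Rn_norm M g (e : R) : cc M g -> (forall x, `|g x| <= e) ->
  `|integral_Rn g| <= e * cube_vol M.
Proof.
move=> cg ge.
have ig := cc_integrable cg.
have [B B0 HB] := cc_bounded cg.
rewrite -lee_fin EFin_normr_Rintegral//.
apply: (le_trans (le_abse_integral _ _ _)) => //; first exact: measurable_int ig.
have -> : (\int[lebesgue_tuple m]_t `|(g (vec_of_tuple t))%:E| =
   \int[lebesgue_tuple m]_(t in (@tbox R m M)) `|(g (vec_of_tuple t))%:E|)%E.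
  rewrite [RHS]integral_mkcond; apply: eq_integral => t _; rewrite patchE.
  case: ifPn => // /negP tM; have [_ _ ->] := cg; first by rewrite abse0.
  by move=> /tbox_cube H; apply: tM; rewrite inE.
rewrite EFinM fineK; last first.
  by rewrite ge0_fin_numE ?measure_ge0//; exact: tbox_fin.
apply: integral_le_bound => //; first exact: measurable_tbox.
- by apply: measurable_funTS; exact: measurable_int ig.
- by rewrite lee_fin (le_trans _ (ge 0)).
- by apply: aeW => t _ /=; rewrite lee_fin.
Qed.

(** Continuity keeps [g] above [g x0 / 2] on a closed box of side [r] around [x0], which has measure
    [r ^+ m]. *)
Lemma integral_Rn_gt0 M g x0 : cc M g -> (forall x, 0 <= g x) -> 0 < g x0 ->
  0 < integral_Rn g.
Proof.
move=> cg g0 gx0; have [_ cong _] := cg.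
have c0 : 0 < g x0 / 2 by rewrite divr_gt0.
have /cvgrPdist_lt/(_ _ c0)/nbhs_ballP[r /= r0 Hr] := cong x0.
pose A i := `[x0 0 i - r / 2, x0 0 i + r / 2]%classic : set (measurableTypeR R).
pose D := [set t : m.-tuple (measurableTypeR R) | forall i, A i (tnth t i)].
have mA i : measurable (A i) by exact: measurable_itv.
have mD : measurable D := measurable_tuple_box mA.
have DE : lebesgue_tuple m D = (r ^+ m)%:E.
  rewrite (lebesgue_tuple_box mA) -[in RHS](card_ord m) -prodr_const -prodEFin.
  apply: eq_bigr => i _; rewrite /A lebesgue_measure_itv/= lte_fin ifT; last by lra.
  by rewrite -EFinD; congr EFin; field.
have gD t : D t -> g x0 / 2 <= g (vec_of_tuple t).
  move=> Dt; have : `|g x0 - g (vec_of_tuple t)| < g x0 / 2.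
    apply: Hr; apply: mx_ballE => // i; have := Dt i.
    by rewrite /A/= in_itv/= vec_of_tupleE ltr_norml => /andP[? ?]; apply/andP; split; lra.
  by rewrite ltr_norml => /andP[? ?]; lra.
have ig := cc_integrable cg.
have H : (((g x0 / 2) * r ^+ m)%:E <= \int[lebesgue_tuple m]_t (g (vec_of_tuple t))%:E)%E.
  rewrite EFinM -DE -integral_cst//.
  apply: (@le_trans _ _ (\int[lebesgue_tuple m]_(t in D) (g (vec_of_tuple t))%:E)%E).
    apply: ge0_le_integral => //.
    - by move=> t _; rewrite lee_fin ltW.
    - by apply: measurable_funTS; exact: measurable_int ig.
  apply: ge0_subset_integral => //; first exact: measurable_int ig.
  by move=> t _; rewrite lee_fin.
rewrite /integral_Rn /Rintegral -lte_fin fineK; last exact: integrable_fin_num.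
by apply: lt_le_trans H; rewrite lte_fin mulr_gt0// exprn_gt0.
Qed.

Lemma vec_of_tset t i (s : R) : vec_of_tuple (tset t i s) = upd (vec_of_tuple t) i s.
Proof. by apply/rowP => j; rewrite !mxE tnth_mktuple. Qed.

Lemma integral_Rn_partial M i g (dg : 'rV[R]_m -> R) : cc M g -> cc M dg ->
  (forall x, is_derive x (delta_mx 0 i) g (dg x)) ->
  integral_Rn dg = 0.
Proof.
move=> cg cdg Dg; have [B B0 dgB] := cc_bounded cdg.
have [M0 cong sg] := cg.
rewrite /integral_Rn /Rintegral.
suff -> : (\int[lebesgue_tuple m]_t (dg (vec_of_tuple t))%:E = 0)%E by [].
apply: (@integral_partial_tuple _ m i M B (g \o @vec_of_tuple R m)
  (dg \o @vec_of_tuple R m)) => //=.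
- exact: cc_bsupp.
- move=> t s; under eq_fun do rewrite vec_of_tset.
  by rewrite vec_of_tset; exact: (is_derive_upd (Dg _)).
- move=> t; under eq_fun do rewrite vec_of_tset.
  have [_ cdong _] := cdg => s.
  apply: (@continuous_comp _ _ _ (fun r : R => upd (vec_of_tuple t) i r) dg); last exact: cdong.
  apply/cvg_ballP => e e0.
  have : \forall s' \near s, `|s - s'| < e by apply/nbhs_ballP; exists e.
  apply: filterS => s' ss'; apply: mx_ballE => // j; rewrite !mxE.
  by case: eqP => // _; rewrite subrr normr0.
- by move=> t tM; apply: sg => /(_ i); rewrite vec_of_tupleE leNgt tM.
Qed.

End integral_continuous.

(** * The weak inequality *)

Section weak_inequality.
Context {R : realType} {m : nat}.
Implicit Types (M : R) (g h zeta : 'rV[R]_m -> R) (x : 'rV[R]_m) (i : 'I_m).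

Lemma cont_sum (X : 'I_m -> 'rV[R]_m -> R) (P : 'rV[R]_m) :
  (forall i, {for P, continuous (X i)}) ->
  {for P, continuous (fun x => \sum_i X i x)}.
Proof.
move=> cX; elim: (index_enum _) => [|i s IHs].
  rewrite (_ : (fun x => _) = fun=> 0); first exact: cst_continuous.
  by apply/funext => x; rewrite big_nil.
rewrite (_ : (fun x => _) = fun x => X i x + \sum_(j <- s) X j x).
  exact: cvgD (cX i) IHs.
by apply/funext => x; rewrite big_cons.
Qed.

Lemma cc_mul M g h : continuous g -> cc M h -> cc M (fun x => g x * h x).
Proof.
move=> cg [M0 ch sh]; split => // [x|x /sh ->]; last by rewrite mulr0.
exact: cvgM (cg x) (ch x).
Qed.

Lemma cc_add M g h : cc M g -> cc M h -> cc M (fun x => g x + h x).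
Proof.
move=> [M0 cg sg] [_ ch sh]; split => // [x|x Mx]; last by rewrite sg// sh// addr0.
exact: cvgD (cg x) (ch x).
Qed.

Lemma cc_opp M g : cc M g -> cc M (fun x => - g x).
Proof.
move=> [M0 cg sg]; split => // [x|x Mx]; last by rewrite sg// oppr0.
exact: cvgN (cg x).
Qed.

Lemma cc_sum M (X : 'I_m -> 'rV[R]_m -> R) : 0 < M -> (forall i, cc M (X i)) ->
  cc M (fun x => \sum_i X i x).
Proof.
move=> M0 cX; split => // [x|x Mx].
  by apply: cont_sum => i; have [_ + _] := cX i; apply.
by apply: big1 => i _; have [_ _ ->] := cX i.
Qed.

Lemma integral_Rn_sum M (X : 'I_m -> 'rV[R]_m -> R) : (forall i, cc M (X i)) ->
  0 < M -> integral_Rn (fun x => \sum_i X i x) = \sum_i integral_Rn (X i).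
Proof.
move=> cX M0; elim: (index_enum _) => [|i s IHs].
  under eq_fun do rewrite big_nil; rewrite big_nil /integral_Rn /Rintegral.
  by rewrite integral0.
rewrite big_cons -IHs; under eq_fun do rewrite big_cons.
rewrite (integral_Rn_D (cX i) (h := fun x => \sum_(j <- s) X j x))//.
split => // [x|x Mx].
  elim: (s) => [|j s' IHs'].
    rewrite (_ : (fun x => _) = fun=> 0); first exact: cst_continuous.
    by apply/funext => y; rewrite big_nil.
  rewrite (_ : (fun x => _) = fun x => X j x + \sum_(k <- s') X k x).
    by have [_ cXj _] := cX j; exact: cvgD (cXj x) IHs'.
  by apply/funext => y; rewrite big_cons.
by apply: big1 => j _; have [_ _ ->] := cX j.
Qed.

(** The integrand is linear in the test function and its gradient, with coefficients bounded on a
    slightly larger cube; a smooth function C^1-close to [zeta] and supported in that cube therefore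
    changes the integral arbitrarily little. *)
Lemma weak_C1 (X : 'I_m -> 'rV[R]_m -> R) (B : 'rV[R]_m -> R) M zeta
    (dz : 'I_m -> 'rV[R]_m -> R) :
  (forall i, continuous (X i)) -> continuous B ->
  (forall z, test_function z -> (forall x, 0 <= z x) ->
     integral_Rn (fun x => B x * z x) <=
     - integral_Rn (fun x => \sum_i X i x * partial i z x)) ->
  0 < M -> continuous zeta -> (forall i, continuous (dz i)) ->
  (forall i x, is_derive x (delta_mx 0 i) zeta (dz i x)) ->
  (forall x, ~ cube M x -> zeta x = 0 /\ forall i, dz i x = 0) ->
  (forall x, 0 <= zeta x) ->
  integral_Rn (fun x => \sum_i X i x * dz i x + B x * zeta x) <= 0.
Proof.
move=> cX cB weak M0 cz cdz Dz supp z0.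
pose M1 := M + 1; have MM1 : 0 < M < M1 by rewrite M0 ltrDl/=.
have M10 : 0 < M1 by rewrite addr_gt0.
have bnd g : continuous g -> exists b : R, 0 < b /\ forall x, cube M1 x -> `|g x| <= b.
  move=> cg; have [b b0 Hb] := cont_bounded (@cube_compact R m M1) (continuous_subspaceT cg).
  by exists b.
have /choice[bX HbX] : forall i, exists b : R, 0 < b /\ forall x, cube M1 x -> `|X i x| <= b.
  by move=> i; exact: bnd.
have [bB [bB0 HbB]] := bnd B cB.
pose D := \sum_i bX i + bB.
have D0 : 0 < D by rewrite ltr_wpDl// sumr_ge0// => i _; exact/ltW/(HbX i).1.
pose V := cube_vol (m := m) M1; have V0 : 0 <= V := cube_vol_ge0 _.
pose Phi (z : 'rV[R]_m -> R) (d : 'I_m -> 'rV[R]_m -> R) x :=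
  \sum_i X i x * d i x + B x * z x.
have ccPhi (z : 'rV[R]_m -> R) (d : 'I_m -> 'rV[R]_m -> R) :
    cc M1 z -> (forall i, cc M1 (d i)) -> cc M1 (Phi z d).
  move=> cz' cd'; apply: cc_add; last exact: cc_mul.
  by apply: cc_sum => // i; exact: cc_mul.
have suppM1 x : ~ cube M1 x -> ~ cube M x.
  by move=> H1 H; apply: H1 => i; rewrite (le_trans (H i))// lerDl.
have ccz : cc M1 zeta by split => // x /suppM1/supp[].
have ccdz i : cc M1 (dz i) by split => // x /suppM1/supp[].
rewrite -/(Phi zeta dz); apply/ler_addgt0Pl => e e0; rewrite addr0.
(* This makes [D * e1 * V <= e], with [V + 1] positive even if the volume is [0]. *)
pose e1 := e / (D * (V + 1)).
have V10 : 0 < V + 1 by rewrite ltr_wpDl.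
have e10 : 0 < e1 by rewrite divr_gt0// mulr_gt0.
have [z tz [zge0 [zout zclose]]] := test_function_density MM1 cz cdz Dz supp z0 e10.
have [Cz _] := tz.
have ccz' : cc M1 z by split => // [|x /zout[]//]; exact: (Cz 0).
have ccpz i : cc M1 (partial i z).
  by split => // [|x /zout[]//]; exact: ((Cz 1).2 i).2.
have Hz : integral_Rn (Phi z (fun i => partial i z)) <= 0.
  rewrite (@integral_Rn_D _ _ M1); [|by apply: cc_sum => // i; exact: cc_mul|exact: cc_mul].
  by have := weak z tz zge0; lra.
have E : integral_Rn (Phi zeta dz) = integral_Rn (Phi z (fun i => partial i z)) +
    integral_Rn (Phi (fun x => zeta x - z x) (fun i x => dz i x - partial i z x)).
  rewrite -(@integral_Rn_D _ _ M1).
  - congr integral_Rn; apply/funext => x; rewrite /Phi addrACA -big_split/= -mulrDr.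
    congr (_ + B x * _); last ring.
    by apply: eq_bigr => i _; ring.
  - exact: ccPhi.
  - by apply: ccPhi => [|i]; apply: cc_add => //; exact: cc_opp.
have bound x : `|Phi (fun x => zeta x - z x) (fun i x => dz i x - partial i z x) x| <= D * e1.
  have [zc dzc] := zclose x.
  have [Mx|Mx] := pselect (cube M1 x); last first.
    have [z0' dz0'] := zout x Mx; have [s0 ds0] := supp x (suppM1 x Mx).
    rewrite /Phi z0' s0 subrr mulr0 addr0 big1 ?normr0; last first.
      by move=> i _; rewrite dz0' ds0 subrr mulr0.
    by rewrite mulr_ge0 ?(ltW e10) ?(ltW D0).
  rewrite /Phi /D mulrDl mulr_suml (le_trans (ler_normD _ _))//; apply: lerD.
    rewrite (le_trans (ler_norm_sum _ _ _))//; apply: ler_sum => i _.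
    by rewrite normrM ler_pM// ?(HbX i).2// distrC.
  by rewrite normrM ler_pM// ?HbB// distrC.
have ccd : cc M1 (Phi (fun x => zeta x - z x) (fun i x => dz i x - partial i z x)).
  by apply: ccPhi => [|i]; apply: cc_add => //; exact: cc_opp.
have := integral_Rn_norm ccd bound; rewrite -/V => H.
have H2 : D * e1 * V <= e.
  have -> : D * e1 * V = e * (V / (V + 1)) by rewrite /e1; field; rewrite !gt_eqF.
  by rewrite ler_piMr ?(ltW e0)// ler_pdivrMr// mul1r lerDl.
rewrite E -[leRHS]add0r lerD// (le_trans (ler_norm _))// (le_trans H)//.
Qed.

(** [Y] is differentiable only at points of the closed set [S] that carries [zeta]: the products
    with [zeta] and [dz] extend by [0], and the integral of the derivative of [zeta * Y] is [0]. *)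
Lemma integral_Rn_ibp (S : set 'rV[R]_m) M i zeta (dz : 'rV[R]_m -> R)
    (Y dY : 'rV[R]_m -> R) :
  closed S -> S `<=` cube M -> 0 < M -> continuous zeta -> continuous dz ->
  (forall x, is_derive x (delta_mx 0 i) zeta (dz x)) ->
  (forall x, ~ S x -> zeta x = 0 /\ dz x = 0) ->
  (forall x, S x -> is_derive x (delta_mx 0 i) Y (dY x)) ->
  (forall x, S x -> {for x, continuous Y}) ->
  (forall x, S x -> {for x, continuous dY}) ->
  [/\ cc M (fun x => Y x * dz x), cc M (fun x => dY x * zeta x) &
      integral_Rn (fun x => Y x * dz x) + integral_Rn (fun x => dY x * zeta x) = 0].
Proof.
move=> cS SM M0 cz cdz Dz supp DY cY cdY.
have cc1 : cc M (fun x => Y x * dz x).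
  split => // [|x Mx]; last by rewrite (supp x _).2 ?mulr0// => /SM.
  apply: (continuous_glue cS) => x Sx; last by rewrite (supp x Sx).2 mulr0.
  exact: cvgM (cY x Sx) (cdz x).
have cc2 : cc M (fun x => dY x * zeta x).
  split => // [|x Mx]; last by rewrite (supp x _).1 ?mulr0// => /SM.
  apply: (continuous_glue cS) => x Sx; last by rewrite (supp x Sx).1 mulr0.
  exact: cvgM (cdY x Sx) (cz x).
have cc0 : cc M (fun x => zeta x * Y x).
  split => // [|x Mx]; last by rewrite (supp x _).1 ?mul0r// => /SM.
  apply: (continuous_glue cS) => x Sx; last by rewrite (supp x Sx).1 mul0r.
  exact: cvgM (cz x) (cY x Sx).
split => //; rewrite -(integral_Rn_D cc1 cc2).
apply: (integral_Rn_partial (i := i) cc0 (cc_add cc1 cc2)).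
apply: (is_derive_glue cS) => x Sx; last first.
  by rewrite (supp x Sx).1 (supp x Sx).2 mul0r !mulr0 addr0.
have D := is_deriveM (Dz x) (DY x Sx).
by apply: (is_derive_eq D); rewrite /GRing.scale/= addrC mulrC [zeta x * _]mulrC mulrC.
Qed.

End weak_inequality.

(** * The Euclidean norm and monotone vector fields *)

Section euclidean_norm.
Context {R : realType} {m : nat}.
Implicit Types (x y v w n : 'rV[R]_m) (i : 'I_m).

Lemma inner_ge0 v : 0 <= inner v v.
Proof. by apply: sumr_ge0 => i _; rewrite -expr2 sqr_ge0. Qed.

Lemma enorm_sqr v : enorm v ^+ 2 = inner v v.
Proof. by rewrite sqr_sqrtr// inner_ge0. Qed.

Lemma enorm_ge0 v : 0 <= enorm v.
Proof. exact: sqrtr_ge0. Qed.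

Lemma coord_le_enorm v i : `|v 0 i| <= enorm v.
Proof.
rewrite -sqrtr_sqr ler_sqrt ?inner_ge0// /inner (bigD1 i)//= expr2 lerDl.
by apply: sumr_ge0 => j _; rewrite -expr2 sqr_ge0.
Qed.

(** Cauchy-Schwarz, from the non-negative square of [v - inner v n *: n]. *)
Lemma inner_unit_le v n : inner n n = 1 -> inner v n <= enorm v.
Proof.
move=> n1.
have E (t : R) : inner (v - t *: n) (v - t *: n) =
    inner v v + (- 2 * t) * inner v n + t ^+ 2 * inner n n.
  rewrite /inner !mulr_sumr -!big_split/=; apply: eq_bigr => i _.
  by rewrite !mxE; ring.
have := inner_ge0 (v - inner v n *: n).
rewrite E n1 (_ : _ + _ * 1 = inner v v - (inner v n) ^+ 2); last ring.
rewrite subr_ge0 -enorm_sqr => t2.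
apply: le_trans (ler_norm _) _.
by rewrite -ler_sqr ?nnegrE ?enorm_ge0// real_normK ?num_real.
Qed.

Lemma enorm_eq0 v : enorm v = 0 -> v = 0.
Proof.
move=> v0; apply/rowP => i; rewrite mxE; apply/eqP.
by rewrite -normr_le0 -v0 coord_le_enorm.
Qed.

Lemma enorm_continuous : continuous (@enorm R m).
Proof.
move=> x; apply: (@continuous_comp _ _ _ (fun v : 'rV[R]_m => inner v v) Num.sqrt).
  by apply: cont_sum => i; exact: cvgM (coord_cont (x := x)) (coord_cont (x := x)).
exact: sqrt_continuous.
Qed.

(* Monotonicity of the vector field [phi(|v|) v / |v|], the second vector being
   [s *: n] for a unit vector [n]. *)
Lemma field_monotone (phi : R -> R) v n (s : R) :
  (forall a b, 0 <= a -> a <= b -> phi a <= phi b) -> phi 0 = 0 ->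
  0 < s -> inner n n = 1 ->
  0 <= \sum_i ((enorm v)^-1 * phi (enorm v) * v 0 i - phi s * n 0 i) *
              (v 0 i - s * n 0 i).
Proof.
move=> phi_le phi0 s0 n1; set r := enorm v.
have r0 : 0 <= r := enorm_ge0 v.
have phis0 : 0 <= phi s by rewrite -phi0 phi_le// ltW.
have phir0 : 0 <= phi r by rewrite -phi0 phi_le.
have -> : \sum_i (r^-1 * phi r * v 0 i - phi s * n 0 i) * (v 0 i - s * n 0 i) =
    r^-1 * phi r * inner v v - (r^-1 * phi r * s + phi s) * inner v n +
    phi s * s * inner n n.
  rewrite /inner !mulr_sumr -sumrB -big_split/=; apply: eq_bigr => i _; ring.
rewrite n1 mulr1 -enorm_sqr -/r.
have H : (r^-1 * phi r * s + phi s) * inner v n <= (r^-1 * phi r * s + phi s) * r.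
  apply: ler_wpM2l; last exact: inner_unit_le.
  by rewrite addr_ge0 ?mulr_ge0 ?invr_ge0 ?(ltW s0).
have [r00|rn0] := eqVneq r 0.
  have -> : inner v n = 0.
    by rewrite (enorm_eq0 r00) /inner big1// => i _; rewrite mxE mul0r.
  by rewrite mulr0 subr0 !addr_ge0 ?mulr_ge0 ?invr_ge0 ?sqr_ge0 ?(ltW s0).
(* Replacing [inner v n] by [r] can only lower the expression; what remains is a product of two
   differences of the same sign. *)
apply: (@le_trans _ _ ((phi r - phi s) * (r - s))).
  have [rs|sr] := leP r s.
    by rewrite -mulrNN mulr_ge0// opprB subr_ge0// phi_le.
  by rewrite mulr_ge0// subr_ge0 ?phi_le ?(ltW sr)// ltW.
have -> : (phi r - phi s) * (r - s) =
  r^-1 * phi r * r ^+ 2 - (r^-1 * phi r * s + phi s) * r + phi s * s.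
  by field.
by rewrite lerD2r lerD2l lerN2.
Qed.

End euclidean_norm.

(** * Radial functions and radial fields *)

Section radial.
Context {R : realType} {m : nat}.
Implicit Types (x y : 'rV[R]_m) (i : 'I_m).
Variable p : 'rV[R]_m.

Definition radius x : R := enorm (x - p).

Definition direction x : 'rV[R]_m := (radius x)^-1 *: (x - p).

Lemma radius_continuous : continuous radius.
Proof.
move=> x; apply: (@continuous_comp _ _ _ (fun y => y - p) (@enorm R m)).
  exact: cvgB cvg_id (cvg_cst p).
exact: enorm_continuous.
Qed.

Lemma direction_unit x : 0 < radius x -> inner (direction x) (direction x) = 1.
Proof.
move=> r0; have E : inner (direction x) (direction x) = (radius x)^-1 ^+ 2 * inner (x - p) (x - p).
  by rewrite /inner mulr_sumr; apply: eq_bigr => i _; rewrite !mxE; ring.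
by rewrite E -enorm_sqr -exprMn mulVf ?expr1n ?gt_eqF.
Qed.

(** Along a coordinate line the squared radius is a quadratic polynomial in the increment, positive
    at [0]. *)
Lemma is_derive_radius x i : 0 < radius x ->
  is_derive x (delta_mx 0 i) radius (direction x 0 i).
Proof.
move=> r0; pose y := (x - p) 0 i; pose q := inner (x - p) (x - p).
have q0 : 0 < q by rewrite /q -enorm_sqr exprn_gt0.
have E (h : R) : radius (h *: delta_mx 0 i + x) = Num.sqrt (q + 2 * y * h + h ^+ 2).
  congr Num.sqrt; rewrite /q /inner (bigD1 i)//= [in RHS](bigD1 i)//= /y.
  rewrite line_upd !mxE eqxx -!addrA.
  rewrite (eq_bigr (fun j => (x - p) 0 j * (x - p) 0 j)).
    by rewrite ?mxE; ring.
  by move=> j ji; rewrite !mxE (negbTE ji).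
have D1 : is_derive (0 : R) 1 (fun h : R => q + 2 * y * h + h ^+ 2) (2 * y).
  have D1 := is_deriveD (is_deriveD (is_derive_cst q (0 : R) 1)
    (is_deriveM (is_derive_cst (2 * y) (0 : R) 1) (is_derive_id (0 : R) 1)))
    (is_deriveM (is_derive_id (0 : R) 1) (is_derive_id (0 : R) 1)).
  by apply: (is_derive_eq D1); rewrite /GRing.scale/=; ring.
have D2 : is_derive (q + 2 * y * 0 + 0 ^+ 2) 1 Num.sqrt (2 * Num.sqrt q)^-1.
  by rewrite mulr0 expr0n/= !addr0; exact: is_derive1_sqrt.
have D3 := @is_derive1_comp _ Num.sqrt (fun h : R => q + 2 * y * h + h ^+ 2) 0 _ _ D2 D1.
have D4 : is_derive x (delta_mx 0 i) radius ((2 * Num.sqrt q)^-1 * (2 * y)).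
  by apply: (is_derive_line _ D3) => h; rewrite E /= [_%:A]mulr1 addr0.
apply: (is_derive_eq D4); rewrite mxE -/y -/(enorm _) -/(radius x).
by field; rewrite gt_eqF.
Qed.

Lemma is_derive_radial (P : R -> R) (dP : R) x i : 0 < radius x ->
  is_derive (radius x) 1 P dP ->
  is_derive x (delta_mx 0 i) (fun y => P (radius y)) (dP * direction x 0 i).
Proof. by move=> r0 DP; apply: is_derive_comp1 => //; exact: is_derive_radius. Qed.

Lemma is_derive_radial_field (P : R -> R) (dP : R) x i : 0 < radius x ->
  is_derive (radius x) 1 P dP ->
  is_derive x (delta_mx 0 i) (fun y => P (radius y) * direction y 0 i)
    (dP * direction x 0 i ^+ 2 + P (radius x) / radius x * (1 - direction x 0 i ^+ 2)).
Proof.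
move=> r0 DP.
have D1 := is_derive_radial i r0 DP.
have rn0 : radius x != 0 by rewrite gt_eqF.
have D2 := is_derive_comp1 (@is_deriveV _ id _ _ _ rn0 (is_derive_id (radius x) (1 : R)))
  (is_derive_radius i r0).
have D3 := is_deriveB (is_derive_coord x i i) (is_derive_cst (p 0 i) x (delta_mx 0 i)).
have D4 := is_deriveM D1 (is_deriveM D2 D3).
have E : (fun y => P (radius y) * direction y 0 i) =
   (fun y => P (radius y) * ((radius y)^-1 * (y 0 i - p 0 i))).
  by apply/funext => y; rewrite !mxE.
rewrite E; apply: (is_derive_eq D4); rewrite /GRing.scale/= eqxx !mxE.
change (((fun y : 'rV[R]_m => y 0 i) - cst (p 0 i)) x) with (x 0 i - p 0 i).
change (((fun z : 'rV[R]_m => (radius z)^-1) * ((fun y => y 0 i) - cst (p 0 i))) x)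
  with ((radius x)^-1 * (x 0 i - p 0 i)).
by rewrite (_ : true%:R = 1)//; field.
Qed.

(** The divergence of the field [P(r) (x - p) / r]: the unit direction contributes [dP], and each of
    the [m - 1] tangential directions contributes [P / r]. *)
Lemma radial_div x (P dP : R) : (1 <= m)%N -> 0 < radius x ->
  \sum_i (dP * direction x 0 i ^+ 2 + P / radius x * (1 - direction x 0 i ^+ 2)) =
  dP + m.-1%:R / radius x * P.
Proof.
move=> m1 r0; rewrite big_split/= -!mulr_sumr sumrB.
have -> : \sum_i direction x 0 i ^+ 2 = 1 by exact: direction_unit.
rewrite sumr_const card_ord mulr1 -subn1 natrB//; ring.
Qed.

Lemma radius_ge0 x : 0 <= radius x. Proof. exact: enorm_ge0. Qed.

Lemma ball_cube (b : R) : [set x | radius x <= b] `<=` cube (b + \sum_i `|p 0 i|).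
Proof.
move=> x /= xb i; have := coord_le_enorm (x - p) i; rewrite -/(radius x) !mxE => H.
rewrite -[x 0 i](subrK (p 0 i)) (le_trans (ler_normD _ _))// lerD ?(le_trans H)//.
by rewrite (bigD1 i)//= lerDl sumr_ge0.
Qed.

Lemma annulus_closed (a b : R) : closed [set x | a <= radius x <= b].
Proof.
rewrite (_ : mkset _ = radius @^-1` `[a, b]).
  by apply: closed_comp => [x _|]; [exact: radius_continuous|exact: interval_closed].
by apply/seteqP; split => x /=; rewrite in_itv.
Qed.

Lemma annulus_compact (a b : R) : compact [set x | a <= radius x <= b].
Proof.
apply: (subclosed_compact (@annulus_closed a b) (@cube_compact R m _)).
by apply: subset_trans (@ball_cube b) => x /= /andP[].
Qed.

End radial.

(** * Comparison on an annulus *)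

Section positive_part.
Context {R : realType}.

Lemma max0_continuous : continuous (fun t : R => Num.max 0 t).
Proof. exact: (max0_cont (continuous_subspaceT (fun x : R => cvg_id))). Qed.

Lemma is_derive_sqr_pos_part (s : R) :
  is_derive s 1 (fun t : R => Num.max 0 t ^+ 2) (2 * Num.max 0 s).
Proof.
have [s0|s0|->] := ltgtP s 0.
- rewrite mulr0; apply: (@near_eq_is_derive _ _ _ (cst 0)).
  have : \forall t \near s, t < 0 by exact: lt_nbhsl.
  by apply: filterS => t t0; rewrite max_l ?ltW// expr0n.
- apply: (@near_eq_is_derive _ _ _ (fun t : R => t ^+ 2)).
    have : \forall t \near s, 0 < t by exact: lt_nbhsr.
    by apply: filterS => t t0; rewrite max_r ?ltW.
  have D := is_deriveM (is_derive_id s (1 : R)) (is_derive_id s (1 : R)).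
  by apply: (is_derive_eq D); rewrite /GRing.scale/=; ring.
- apply/is_derive1_caratheodory; exists (fun t => Num.max 0 t); split => [z||].
  + rewrite maxxx expr0n subr0 subr0; have [z0|z0] := leP z 0.
      by rewrite expr0n mul0r.
    by rewrite expr2.
  + exact: max0_continuous.
  + by rewrite ?maxxx mulr0.
Qed.

End positive_part.

Section closed_conditions.
Context {R : realType} {m : nat}.
Implicit Types (x : 'rV[R]_m).

(** Relative closedness by a local criterion at points of [D]. It suits [w] and [G], whose
    continuity is known only at points of the annulus, so that closed preimages on the whole space
    are not at hand. *)
Lemma closed_cond (D P : set 'rV[R]_m) : closed D ->
  (forall x, D x -> ~ P x -> \forall y \near x, ~ P y) -> closed (D `&` P).
Proof.
move=> cD nP x clx.
have Dx : D x.
  by rewrite ((closure_id D).1 cD); apply: closure_subset clx; exact: subIsetl.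
split => //; apply: contrapT => /(nP x Dx) H.
by have [y [[_ Py] nPy]] := clx _ H.
Qed.

Lemma near_gt0 (g : 'rV[R]_m -> R) x : {for x, continuous g} -> 0 < g x ->
  \forall y \near x, 0 < g y.
Proof.
move=> cg gx0; have /cvgrPdist_lt/(_ _ gx0) := cg.
by apply: filterS => y; rewrite ltr_norml => /andP[_]; lra.
Qed.

Lemma cont_near_eq (g h : 'rV[R]_m -> R) x :
  (\forall y \near x, g y = h y) -> {for x, continuous h} -> {for x, continuous g}.
Proof.
move=> gh ch; apply/(@cvgrPdist_lt _ _ _ (nbhs x) (nbhs_filter x)) => e e0.
have /cvgrPdist_lt/(_ _ e0) := ch.
have := nbhs_singleton gh => ->.
by apply: filterS2 gh => y ->.
Qed.

End closed_conditions.

Section comparison.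
Context {R : realType} {m : nat}.
Variables (phi f l : R -> R) (u : 'rV[R]_m -> R).
Hypotheses
  (phi_cont : continuous (fun t : R => phi (Num.max 0 t)))
  (phi_le : forall s t : R, 0 <= s -> s <= t -> phi s <= phi t)
  (phi0 : phi 0 = 0)
  (f_cont : continuous (fun t : R => f (Num.max 0 t)))
  (f_lt : forall s t : R, 0 <= s -> s < t -> f s < f t)
  (l_cont : continuous (fun t : R => l (Num.max 0 t)))
  (l_gt0 : forall t : R, 0 < t -> 0 < l t)
  (u_C1 : Ck 1 u)
  (u_ge0 : forall x, 0 <= u x)
  (u_sol : weak_solution phi f l u).
Implicit Types (x y : 'rV[R]_m) (i : 'I_m).

Let n x := enorm (grad u x).
Let X i x := (n x)^-1 * phi (n x) * partial i u x.
Let B x := f (u x) * l (n x).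

Let pu_cont i : continuous (partial i u).
Proof. exact: (u_C1.2 i).2. Qed.

Let u_cont : continuous u.
Proof. exact: Ck_cont u_C1. Qed.

Lemma norm_grad_cont : continuous n.
Proof.
move=> x.
have -> : n = fun y => Num.sqrt (\sum_i partial i u y * partial i u y).
  by apply/funext => y; congr Num.sqrt; apply: eq_bigr => i _; rewrite !mxE.
apply: (@continuous_comp _ _ _ (fun y => \sum_i partial i u y * partial i u y) Num.sqrt).
  by apply: cont_sum => i; exact: cvgM (@pu_cont i x) (@pu_cont i x).
exact: sqrt_continuous.
Qed.

Let n_ge0 x : 0 <= n x. Proof. exact: enorm_ge0. Qed.

Let comp_n_cont (g : R -> R) : continuous (fun t : R => g (Num.max 0 t)) ->
  continuous (fun x => g (n x)).
Proof.
move=> cg x; rewrite (_ : (fun y => g (n y)) = (fun t : R => g (Num.max 0 t)) \o n).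
  by apply: continuous_comp; [exact: norm_grad_cont|exact: cg].
by apply/funext => y /=; rewrite max_r.
Qed.

Lemma B_cont : continuous B.
Proof.
have cf : continuous (fun x => f (u x)).
  move=> x; rewrite (_ : (fun y => f (u y)) = (fun t : R => f (Num.max 0 t)) \o u).
    by apply: continuous_comp; [exact: u_cont|exact: f_cont].
  by apply/funext => y /=; rewrite max_r.
by move=> x; exact: cvgM (cf x) (@comp_n_cont _ l_cont x).
Qed.

(** Where the gradient vanishes, the factor [(n x)^-1] is harmless: [X i] is bounded by [phi (n y)],
    which tends to [phi 0 = 0]. *)
Lemma X_cont i : continuous (X i).
Proof.
move=> x; have cn := comp_n_cont phi_cont.
have [nx0|nx0] := eqVneq (n x) 0; last first.
  exact: cvgM (cvgM (cvgV nx0 (@norm_grad_cont x)) (cn x)) (@pu_cont i x).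
have Xx : X i x = 0 by rewrite /X nx0 phi0 mulr0 mul0r.
have Xy y : `|X i y| <= phi (n y).
  have pn0 : 0 <= phi (n y) by rewrite -phi0 phi_le.
  rewrite /X !normrM mulrAC (ger0_norm pn0) normfV (ger0_norm (n_ge0 y)).
  have [->|ny] := eqVneq (n y) 0; first by rewrite phi0 mulr0.
  have npos : 0 < n y by rewrite lt_def ny n_ge0.
  rewrite ler_piMl// mulrC ler_pdivrMr// mul1r.
  by have := coord_le_enorm (grad u y) i; rewrite mxE.
apply/(@cvgrPdist_lt _ _ _ (nbhs x) (nbhs_filter x)) => e e0.
have /cvgrPdist_lt/(_ _ e0) := cn x; apply: filterS => y.
rewrite nx0 phi0 Xx !sub0r !normrN; apply: le_lt_trans.
by rewrite (le_trans (Xy y))// ler_norm.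
Qed.

Lemma weak_solution_C1 M zeta (dz : 'I_m -> 'rV[R]_m -> R) :
  0 < M -> continuous zeta -> (forall i, continuous (dz i)) ->
  (forall i x, is_derive x (delta_mx 0 i) zeta (dz i x)) ->
  (forall x, ~ cube M x -> zeta x = 0 /\ forall i, dz i x = 0) ->
  (forall x, 0 <= zeta x) ->
  integral_Rn (fun x => \sum_i X i x * dz i x + B x * zeta x) <= 0.
Proof.
move=> M0 cz cdz Dz supp z0.
apply: (weak_C1 X_cont B_cont _ M0) => // z tz zge0.
have := u_sol tz zge0; congr (_ <= - integral_Rn _).
apply/funext => x; rewrite /inner mulr_sumr; apply: eq_bigr => i _.
by rewrite !mxE mulrA.
Qed.

Section annulus.
Variables (p q : 'rV[R]_m) (t0 r1 L : R) (al a b : R -> R).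
Hypotheses (m_ge1 : (1 <= m)%N) (t0_gt0 : 0 < t0) (L_gt0 : 0 < L)
  (al_deriv : forall r : R, t0 <= r <= r1 -> is_derive r 1 al (a r))
  (al_gt0 : forall r : R, t0 <= r <= r1 -> 0 < al r)
  (a_gt0 : forall r : R, t0 <= r <= r1 -> 0 < a r)
  (phia_deriv : forall r : R, t0 <= r <= r1 -> is_derive r 1 (phi \o a) (b r))
  (a_cont : forall r : R, t0 <= r <= r1 -> {for r, continuous a})
  (b_cont : forall r : R, t0 <= r <= r1 -> {for r, continuous b})
  (super : forall r : R, t0 <= r <= r1 ->
     b r + m.-1%:R / r * phi (a r) <= f (al r) * l (a r))
  (boundary : forall x, radius p x = t0 \/ radius p x = r1 ->
     u x - al (radius p x) < L)
  (q_annulus : t0 <= radius p q <= r1)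
  (q_gap : L <= u q - al (radius p q)).

Local Notation rad := (radius p).
Local Notation dir := (direction p).

Let D : set 'rV[R]_m := [set x | t0 <= rad x <= r1].
Let w x := u x - al (rad x).
Let dv i x := a (rad x) * dir x 0 i.
Let divY x := b (rad x) + m.-1%:R / rad x * phi (a (rad x)).
Let G x := B x - divY x.
Let Y i x := phi (a (rad x)) * dir x 0 i.
Let dY i x := b (rad x) * dir x 0 i ^+ 2 +
  phi (a (rad x)) / rad x * (1 - dir x 0 i ^+ 2).

Let rad_gt0 x : D x -> 0 < rad x.
Proof. by move=> /andP[r0 _]; exact: lt_le_trans r0. Qed.

Let comp_rad_cont (g : R -> R) x : {for rad x, continuous g} ->
  {for x, continuous (fun y => g (rad y))}.
Proof.
by move=> cg; exact: (@continuous_comp _ _ _ rad g x (@radius_continuous _ _ p x) cg).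
Qed.

Let dir_cont i x : D x -> {for x, continuous (fun y => dir y 0 i)}.
Proof.
move=> Dx; rewrite (_ : (fun y => dir y 0 i) = fun y => (rad y)^-1 * (y 0 i - p 0 i)).
  have r0 : rad x != 0 by rewrite gt_eqF// rad_gt0.
  exact: cvgM (cvgV r0 (@radius_continuous _ _ p x)) (cvgB (@coord_cont R m i x) (cvg_cst _)).
by apply/funext => y; rewrite !mxE.
Qed.

Let w_cont x : D x -> {for x, continuous w}.
Proof.
by move=> Dx; exact: cvgB (@u_cont x) (comp_rad_cont (is_derive_cont (al_deriv Dx))).
Qed.

Let w_deriv i x : D x -> is_derive x (delta_mx 0 i) w (partial i u x - dv i x).
Proof.
move=> Dx; have r0 := rad_gt0 Dx.
exact: is_deriveB (Ck_is_derive i x u_C1) (is_derive_radial i r0 (al_deriv Dx)).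
Qed.

Let dv_cont i x : D x -> {for x, continuous (dv i)}.
Proof.
move=> Dx; have ca : {for x, continuous (fun y => a (rad y))}.
  by apply: comp_rad_cont; exact: a_cont.
exact: cvgM ca (dir_cont Dx).
Qed.

Let phia_cont x : D x -> {for x, continuous (fun y => phi (a (rad y)))}.
Proof. by move=> Dx; exact: (comp_rad_cont (g := phi \o a) (is_derive_cont (phia_deriv Dx))). Qed.

Let Y_cont i x : D x -> {for x, continuous (Y i)}.
Proof. by move=> Dx; exact: cvgM (phia_cont Dx) (dir_cont Dx). Qed.

Let radV_cont x : D x -> {for x, continuous (fun y => (rad y)^-1)}.
Proof.
move=> Dx; have r0 : rad x != 0 by rewrite gt_eqF// rad_gt0.
exact: cvgV r0 (@radius_continuous _ _ p x).
Qed.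

Let brad_cont x : D x -> {for x, continuous (fun y => b (rad y))}.
Proof. by move=> Dx; apply: comp_rad_cont; exact: b_cont. Qed.

Let dY_cont i x : D x -> {for x, continuous (dY i)}.
Proof.
move=> Dx; have cd := @dir_cont i x Dx.
have cd2 : {for x, continuous (fun y => dir y 0 i ^+ 2)} by exact: (cvgM cd cd).
have c1 : {for x, continuous (fun y => 1 - dir y 0 i ^+ 2)}.
  exact: cvgB (cvg_cst (1 : R)) cd2.
exact: cvgD (cvgM (brad_cont Dx) cd2)
  (cvgM (cvgM (phia_cont Dx) (radV_cont Dx)) c1).
Qed.

Let G_cont x : D x -> {for x, continuous G}.
Proof.
move=> Dx; have c1 : {for x, continuous (fun y => m.-1%:R / rad y)}.
  exact: cvgM (cvg_cst (m.-1%:R : R)) (radV_cont Dx).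
exact: cvgB (@B_cont x) (cvgD (brad_cont Dx) (cvgM c1 (phia_cont Dx))).
Qed.

Let interior x : t0 < rad x < r1 -> \forall y \near x, t0 < rad y < r1.
Proof.
move=> /andP[r1' r2'].
have c1 : {for x, continuous (fun y => rad y - t0)}.
  exact: cvgB (@radius_continuous _ _ p x) (cvg_cst _).
have c2 : {for x, continuous (fun y => r1 - rad y)}.
  exact: cvgB (cvg_cst _) (@radius_continuous _ _ p x).
have h1 : 0 < rad x - t0 by rewrite subr_gt0.
have h2 : 0 < r1 - rad x by rewrite subr_gt0.
by apply: filterS2 (near_gt0 c1 h1) (near_gt0 c2 h2) => y; rewrite !subr_gt0 => -> ->.
Qed.

Let DW x : t0 < rad x < r1 -> D x.
Proof. by move=> /andP[? ?]; apply/andP; split; exact: ltW. Qed.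

Let not_boundary x : D x -> L <= w x -> t0 < rad x < r1.
Proof.
move=> /andP[h1 h2] Lw; rewrite !lt_def h1 h2 !andbT; apply/andP; split; apply/eqP => E.
  by have := boundary (or_introl E); rewrite ltNge Lw.
by have := boundary (or_intror (esym E)); rewrite ltNge Lw.
Qed.

(** Fermat's rule on a coordinate line: [x] is interior by [not_boundary], so a segment through it
    stays in the annulus. *)
Let crit x i : D x -> L <= w x -> (forall y, D y -> w y <= w x) ->
  partial i u x = dv i x.
Proof.
move=> Dx Lw wmax; have /interior/nbhs_ballP[e /= e0 He] := not_boundary Dx Lw.
pose g (h : R) := w (h *: delta_mx 0 i + x).
have gD (h : R) : h \in `](- e), e[ -> D (h *: delta_mx 0 i + x).
  rewrite in_itv/= => /andP[h1 h2]; apply/DW/He; apply: mx_ballE => // j.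
  rewrite line_upd mxE; case: eqP => [->|_]; last by rewrite subrr normr0.
  by rewrite opprD addrCA subrr addr0 normrN ltr_norml h1.
have e_lt : - e < e by rewrite (lt_trans _ e0)// oppr_lt0.
have h0 : (0 : R) \in `](- e), e[ by rewrite in_itv/= oppr_lt0 e0.
have gder (h : R) : h \in `](- e), e[ -> is_derive h 1 g
    (partial i u (h *: delta_mx 0 i + x) - dv i (h *: delta_mx 0 i + x)).
  move=> /gD Dh; apply: (is_derive_line _ (w_deriv i Dh)) => k.
  by rewrite /g scalerDl [_%:A]mulr1 addrA.
have g0 : is_derive (0 : R) 1 g 0.
  apply: (@derive1_at_max _ g (- e) e) => //; first exact: ltW.
    by move=> h /gder[].
  by move=> h /gD Dh; rewrite [leRHS]/g scale0r add0r; exact: wmax.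
have [_ E1] := gder 0 h0; have [_ E2] := g0.
by apply/eqP; rewrite -subr_eq0 -E2 E1 scale0r add0r.
Qed.

Let G_max x : D x -> L <= w x -> (forall y, D y -> w y <= w x) -> 0 < G x.
Proof.
move=> Dx Lw wmax; have a0 := a_gt0 Dx.
have gE : grad u x = a (rad x) *: dir x.
  by apply/rowP => i; rewrite mxE (crit i Dx Lw wmax) [RHS]mxE.
have nE : n x = a (rad x).
  rewrite /n gE /enorm (_ : inner _ _ = a (rad x) ^+ 2 * inner (dir x) (dir x)).
    by rewrite direction_unit ?rad_gt0// mulr1 sqrtr_sqr gtr0_norm.
  by rewrite /inner mulr_sumr; apply: eq_bigr => i _; rewrite !mxE; ring.
rewrite subr_gt0 (le_lt_trans (super Dx))// /B nE ltr_pM2r ?l_gt0//.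
apply: f_lt; first exact/ltW/al_gt0.
by rewrite -subr_gt0; exact: lt_le_trans Lw.
Qed.

Lemma annulus_comparison : False.
Proof.
have cD : compact D by exact: annulus_compact.
have clD : closed D by exact: annulus_closed.
have wD : {within D, continuous w}.
  by apply: continuous_in_subspaceT => x; rewrite inE; exact: w_cont.
have [xs xsD' xsmax'] : exists2 c, c \in D & forall t, t \in D -> w t <= w c.
  by apply: compact_EVT_max => //; exists q.
have xsD : D xs by rewrite inE in xsD'.
have xsmax x : D x -> w x <= w xs by move=> Dx; apply: xsmax'; rewrite inE.
have Lxs : L <= w xs by exact: le_trans q_gap (xsmax _ q_annulus).
(* [w] stays below its maximum on the compact set [D `&` P], hence below some
   smaller level [c]. *)
pose P : set 'rV[R]_m := [set x | ~ (0 < G x /\ t0 < rad x < r1)].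
have wP x : D x -> P x -> w x < w xs.
  move=> Dx Px; rewrite lt_neqAle xsmax// andbT; apply/eqP => E.
  have Lw : L <= w x by rewrite E.
  apply: Px; split; last exact: not_boundary.
  by apply: G_max => // y Dy; rewrite E; exact: xsmax.
have clZ : closed (D `&` P).
  apply: closed_cond => // x Dx /contrapT[Gx rx].
  by apply: filterS2 (near_gt0 (G_cont Dx) Gx) (interior rx) => y Gy ry; apply.
have [c cws Hc] : exists2 c : R, c < w xs & forall x, D x -> P x -> w x < c.
  have [[z [Dz Pz]]|Z0] := pselect (exists z, D z /\ P z); last first.
    exists (w xs - 1); first by rewrite ltrBlDr ltrDl.
    by move=> x Dx Px; exfalso; apply: Z0; exists x.
  have [z' + z'max] : exists2 c, c \in D `&` P & forall t, t \in D `&` P -> w t <= w c.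
    apply: compact_EVT_max; first by exists z.
    - by apply: (subclosed_compact clZ cD) => x [].
    - by apply: continuous_subspaceW wD => x [].
  rewrite inE => -[Dz' Pz']; have := wP _ Dz' Pz' => H.
  exists ((w z' + w xs) / 2); first lra.
  move=> x Dx Px; have : w x <= w z' by apply: z'max; rewrite inE.
  lra.
pose S := D `&` [set x | c <= w x].
have clS : closed S.
  apply: closed_cond => // x Dx /negP; rewrite -ltNge => wc.
  have cw : {for x, continuous (fun y => c - w y)} by exact: cvgB (cvg_cst c) (w_cont Dx).
  have cw0 : 0 < c - w x by rewrite subr_gt0.
  by apply: filterS (near_gt0 cw cw0) => y; rewrite subr_gt0 => H /=; rewrite leNgt H.
(* The choice of [c] puts the superlevel set inside the open annulus, with [G > 0] on it; so [zeta],
   set to [0] off the annulus, is C^1 on the whole space. *)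
have S_int x : S x -> 0 < G x /\ t0 < rad x < r1.
  by move=> [Dx cw]; apply: contrapT => Px; have := Hc x Dx Px; rewrite ltNge cw.
pose zeta x := if t0 <= rad x <= r1 then Num.max 0 (w x - c) ^+ 2 else 0.
pose dz i x := if t0 <= rad x <= r1
  then 2 * Num.max 0 (w x - c) * (partial i u x - dv i x) else 0.
have supp x : ~ S x -> zeta x = 0 /\ forall i, dz i x = 0.
  move=> Sx; rewrite /zeta /dz; case: ifPn => // Dx.
  have wc : w x - c <= 0.
    by rewrite subr_le0 leNgt; apply/negP => cw; apply: Sx; split => //; exact: ltW.
  by rewrite max_l// expr0n; split => // i; rewrite mulr0 mul0r.
have nearD x : S x -> \forall y \near x, t0 <= rad y <= r1.
  by move=> Sx; apply: filterS (interior (S_int x Sx).2) => y /DW.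
have wcD x : D x -> {for x, continuous (fun y => w y - c)}.
  by move=> Dx; exact: cvgB (w_cont Dx) (cvg_cst c).
have cmax x : D x -> {for x, continuous (fun y => Num.max 0 (w y - c))}.
  move=> Dx; apply: (@continuous_comp _ _ _ (fun y => w y - c) (fun t : R => Num.max 0 t)).
    exact: wcD.
  exact: max0_continuous.
have cz : continuous zeta.
  apply: (continuous_glue clS) => x Sx; last exact: (supp x Sx).1.
  apply: (@cont_near_eq _ _ _ (fun y => Num.max 0 (w y - c) * Num.max 0 (w y - c))).
    by apply: filterS (nearD x Sx) => y; rewrite /zeta => ->; rewrite expr2.
  exact: cvgM (cmax _ Sx.1) (cmax _ Sx.1).
have cdz i : continuous (dz i).
  apply: (continuous_glue clS) => x Sx; last exact: (supp x Sx).2.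
  apply: (@cont_near_eq _ _ _ (fun y => 2 * Num.max 0 (w y - c) * (partial i u y - dv i y))).
    by apply: filterS (nearD x Sx) => y; rewrite /dz => ->.
  exact: cvgM (cvgM (cvg_cst _) (cmax _ Sx.1)) (cvgB (@pu_cont i x) (dv_cont Sx.1)).
have Dz i x : is_derive x (delta_mx 0 i) zeta (dz i x).
  move: x; apply: (is_derive_glue clS) => x Sx; last by have [-> ->] := supp x Sx.
  apply: (@near_eq_is_derive _ _ _ (fun y => Num.max 0 (w y - c) ^+ 2)).
    by apply: filterS (nearD x Sx) => y; rewrite /zeta => ->.
  have D1 := is_deriveB (w_deriv i Sx.1) (is_derive_cst c x (delta_mx 0 i)).
  have D2 := @is_derive_comp1 _ _ _ (fun y => w y - c) _ _ _ _
    (is_derive_sqr_pos_part (w x - c)) D1.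
  by apply: (is_derive_eq D2); have Dx := Sx.1; rewrite /dz ifT// subr0.
have z0 x : 0 <= zeta x by rewrite /zeta; case: ifP => // _; exact: sqr_ge0.
pose M := r1 + \sum_i `|p 0 i|.
have r10 : 0 < r1 by rewrite (lt_le_trans (rad_gt0 q_annulus))//; case/andP: q_annulus.
have M0 : 0 < M by rewrite ltr_pwDl// sumr_ge0.
have SM : S `<=` cube M.
  by move=> x [Dx _]; apply: ball_cube => /=; case/andP: Dx.
have I1 : integral_Rn (fun x => \sum_i X i x * dz i x + B x * zeta x) <= 0.
  by apply: (@weak_solution_C1 M) => // x Mx; apply: supp => /SM.
have cc_z : cc M zeta by split => // x Mx; apply: (supp x _).1 => /SM.
have cc_dz i : cc M (dz i) by split => // x Mx; apply: (supp x _).2 => /SM.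
have ibp i := @integral_Rn_ibp R m S M i zeta (dz i) (Y i) (dY i) clS SM M0 cz (cdz i)
  (Dz i) (fun x Sx => conj (supp x Sx).1 ((supp x Sx).2 i))
  (fun x Sx => is_derive_radial_field i (rad_gt0 Sx.1) (phia_deriv Sx.1))
  (fun x Sx => @Y_cont i x Sx.1) (fun x Sx => @dY_cont i x Sx.1).
pose J i x := Y i x * dz i x + dY i x * zeta x.
have ccJ i : cc M (J i) by have [h1 h2 _] := ibp i; exact: cc_add.
have I2 : integral_Rn (fun x => \sum_i J i x) = 0.
  rewrite (integral_Rn_sum ccJ M0) big1// => i _; have [h1 h2 h3] := ibp i.
  by rewrite (integral_Rn_D h1 h2).
(* Each [J i] integrates to [0], so subtracting their sum keeps the sign of the weak inequality. On
   the annulus the integrand becomes a monotone-field term plus [G * zeta], both non-negative. *)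
pose Psi x := (\sum_i X i x * dz i x + B x * zeta x) + - \sum_i J i x.
have cc1 : cc M (fun x => \sum_i X i x * dz i x + B x * zeta x).
  apply: cc_add; last exact: (cc_mul B_cont).
  by apply: cc_sum => // i; exact: (cc_mul (@X_cont i)).
have cc2 : cc M (fun x => - \sum_i J i x) by apply/cc_opp/cc_sum.
have ccPsi : cc M Psi by exact: cc_add.
have I3 : integral_Rn Psi <= 0.
  rewrite (integral_Rn_D cc1 cc2) -[leRHS]addr0 lerD//.
  rewrite (_ : (fun x => - _) = fun x => -1 * \sum_i J i x); last first.
    by apply/funext => x; rewrite mulN1r.
  by rewrite (@integral_Rn_Z _ _ M) ?I2 ?mulr0//; apply: cc_sum.
have PsiE x : D x -> Psi x = 2 * Num.max 0 (w x - c) *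
    (\sum_i (X i x - Y i x) * (partial i u x - dv i x)) + G x * zeta x.
  move=> Dx.
  have divE : divY x = \sum_i dY i x by rewrite radial_div// rad_gt0.
  rewrite /Psi /J big_split/= -mulr_suml -divE opprD addrACA -mulrBl -sumrB mulr_sumr.
  congr (_ + _); apply: eq_bigr => i _; rewrite /dz ifT//; ring.
have mono x : D x -> 0 <= 2 * Num.max 0 (w x - c) *
    (\sum_i (X i x - Y i x) * (partial i u x - dv i x)).
  move=> Dx; rewrite !mulr_ge0// ?le_max ?lexx//.
  have := @field_monotone R m phi (grad u x) (dir x) (a (rad x)) phi_le phi0
    (a_gt0 Dx) (direction_unit (rad_gt0 Dx)).
  by congr (0 <= _); apply: eq_bigr => i _; rewrite mxE.
have Psi0 x : 0 <= Psi x.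
  have [Sx|Sx] := pselect (S x).
    by rewrite (PsiE _ Sx.1) addr_ge0 ?mono ?mulr_ge0 ?z0 ?(ltW (S_int x Sx).1)//; exact: Sx.1.
  have [z0' dz0'] := supp x Sx.
  rewrite /Psi /J z0' big1 => [|i _]; last by rewrite dz0' mulr0.
  by rewrite big1 => [|i _]; rewrite ?dz0' ?mulr0 ?addr0// oppr0.
have Sxs : S xs by split => //=; exact: ltW.
have Psixs : 0 < Psi xs.
  rewrite (PsiE _ xsD) ltr_wpDl ?mono// mulr_gt0 ?(S_int xs Sxs).1//.
  by rewrite /zeta ifT// max_r ?exprn_gt0 ?subr_gt0// subr_ge0 ltW.
by have := integral_Rn_gt0 ccPsi Psi0 Psixs; rewrite ltNge I3.
Qed.

End annulus.

End comparison.

(** * The theorem *)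

Section F_function.
Context {R : realType}.
Local Notation mu := (@lebesgue_measure R).
Variable f : R -> R.
Hypotheses (f_cont : {within `[0, +oo[, continuous f})
  (f_incr : {in `[0, +oo[ &, {homo f : s t / s < t}})
  (f_gt0 : {in `]0, +oo[, forall t, 0 < f t}).

Lemma incr_lt s t : 0 <= s -> s < t -> f s < f t.
Proof.
move=> s0 st; apply: f_incr; rewrite ?in_itv/= ?andbT//.
by rewrite (le_trans s0)// ltW.
Qed.

Lemma incr_le s t : 0 <= s -> s <= t -> f s <= f t.
Proof. by move=> s0; rewrite le_eqVlt => /predU1P[->//|/(incr_lt s0)/ltW]. Qed.

Lemma pos_gt0 t : 0 < t -> 0 < f t.
Proof. by move=> t0; apply: f_gt0; rewrite in_itv/= t0. Qed.

(* [Ffun f] vanishes on negative reals, so it need not be differentiable at 0. *)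
Lemma Ffun_extension : exists2 F1 : R -> R,
  (forall t : R, 0 <= t -> is_derive t 1 F1 (f t)) &
  F1 0 = 0 /\ forall t, 0 <= t -> Ffun f t = F1 t.
Proof.
have [P HP] := continuous_primitive (-1) (max0_cont f_cont).
have PD (t : R) : 0 <= t -> is_derive t 1 P (f t).
  move=> t0; have t1 : -1 < t by rewrite (lt_le_trans _ t0)// oppr_lt0.
  by have := HP t t1; rewrite max_r.
exists (fun t => P t - P 0).
  move=> t t0; have D := is_deriveB (PD t t0) (is_derive_cst (P 0) t (1 : R)).
  by apply: (is_derive_eq D); rewrite subr0.
split; first by rewrite subrr.
move=> t; rewrite le_eqVlt => /predU1P[<-|t0].
  by rewrite /Ffun set_itv1 Rintegral_set1 subrr.
have cP (x : R) : 0 <= x -> {for x, continuous P}.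
  by move=> x0; exact: is_derive_cont (PD x x0).
rewrite /Ffun /Rintegral (@continuous_FTC2 _ f P)//.
- apply: continuous_subspaceW f_cont => x /=; rewrite !in_itv/= => /andP[-> _]//.
- split.
  + by move=> x; rewrite in_itv/= => /andP[x0 _]; have [] := PD x (ltW x0).
  + exact/cvg_at_right_filter/cP.
  + exact/cvg_at_left_filter/cP/ltW.
- move=> x; rewrite in_itv/= => /andP[x0 _]; rewrite derive1E.
  by have [_] := PD x (ltW x0).
Qed.

(** Integrability at infinity is recast as a bounded primitive, the form needed for the travel time.
    The base point [a + 1] keeps the closed interval inside []a, +oo[]. *)
Lemma tail_primitive (Ki : R -> R) :
  (forall y, 0 < y -> 0 < Ki y) -> (forall y : R, 0 < y -> {for y, continuous Ki}) ->
  L1_at_infty (fun t => (Ki (Ffun f t))^-1) ->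
  exists A B (G : R -> R), 0 <= A /\ forall x : R, A < x ->
    is_derive x 1 G (Ki (Ffun f x))^-1 /\ G x <= B.
Proof.
move=> Ki0 Kic [a a0 ia]; pose kap t := (Ki (Ffun f t))^-1.
have [F1 F1D [F10 FE]] := Ffun_extension.
have F_pos t : 0 < t -> 0 < Ffun f t.
  move=> t0; rewrite (FE _ (ltW t0)) -F10.
  apply: (mono_lt t0 (df := f)).
  - by apply: (within_deriv (df := f)) => x /andP[x0 _]; exact: F1D.
  - by move=> x /andP[x0 _]; exact/F1D/ltW.
  - by move=> x /andP[x0 _]; exact: pos_gt0.
have kc (t : R) : 0 < t -> {for t, continuous kap}.
  move=> t0; have FD : is_derive t 1 (Ffun f) (f t).
    apply: (@near_eq_is_derive _ _ _ F1); last exact/F1D/ltW.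
    have : \forall s \near t, 0 < s by exact: lt_nbhsr.
    by apply: filterS => s s0; rewrite FE// ltW.
  have Kn : Ki (Ffun f t) != 0 by rewrite gt_eqF// Ki0// F_pos.
  exact: cvgV Kn (@continuous_comp _ _ _ (Ffun f) Ki t (is_derive_cont FD)
    (Kic _ (F_pos t t0))).
have kge0 x : 0 < x -> 0 <= kap x by move=> x0; rewrite invr_ge0 ltW// Ki0// F_pos.
pose I := (\int[mu]_(t in `]a, +oo[) (kap t)%:E)%E.
have Ifin : I \is a fin_num by exact: integrable_fin_num.
have sub (x : R) : `[a + 1, x]%classic `<=` `]a, +oo[%classic.
  move=> t /=; rewrite !in_itv/= => /andP[t1 _].
  by rewrite andbT (lt_le_trans _ t1)// ltrDl.
have ix (x : R) : mu.-integrable `[a + 1, x] (EFin \o kap).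
  by apply: integrableS ia => //; exact: sub.
exists (a + 1), (fine I), (fun x => \int[mu]_(t in `[a + 1, x]) kap t)%R.
split; first by rewrite addr_ge0 ?(ltW a0).
move=> x ax; have x0 : 0 < x by rewrite (lt_trans _ ax)// addr_gt0.
split.
  have xu : x < x + 1 by rewrite ltrDl.
  have [d] := continuous_FTC1_closed xu (ix _) ax (kc x x0).
  by rewrite derive1E => dE; apply: DeriveDef.
rewrite /Rintegral; apply: fine_le => //; first exact: integrable_fin_num (ix x).
apply: ge0_subset_integral => //; first exact: measurable_int ia.
move=> t /=; rewrite in_itv/= andbT => at_; rewrite lee_fin kge0//.
exact: lt_trans at_.
Qed.

End F_function.

(** A supremum bounds its set only if the set is bounded; continuity of [l] on the compact [[0, t]]
    provides this. *)
Lemma C_monotone_le (R : realType) (l : R -> R) (C : R) :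
  {within `[0, +oo[, continuous l} -> C_monotone_nondecreasing C l ->
  forall s t, 0 <= s -> s <= t -> l s <= C * l t.
Proof.
move=> lc lm s t s0 st; have t0 : 0 <= t by exact: le_trans st.
apply: le_trans (lm t t0); apply: ub_le_sup; last first.
  by exists s => //=; rewrite in_itv/= s0.
have lct : {within `[0, t], continuous l}.
  by apply: continuous_subspaceW lc => x /=; rewrite !in_itv/= => /andP[->].
have [c _ Hc] := EVT_max t0 lct.
by exists (l c) => _ [x /= xt <-]; exact: Hc.
Qed.

Theorem theorem1p2 (R : realType) (m : nat) (phi f l : R -> R) (C : R)
    (u : 'rV[R]_m -> R)
  (m_ge1 : (1 <= m)%N)
  (phi_cont : {within `[0, +oo[, continuous phi})
  (phi_derivable : {in `]0, +oo[, forall t, derivable phi t 1})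
  (phi'_cont : {in `]0, +oo[, continuous (derive1 phi)})
  (phi0 : phi 0 = 0)
  (phi'_gt0 : {in `]0, +oo[, forall t, 0 < derive1 phi t})
  (f_cont : {within `[0, +oo[, continuous f})
  (f_incr : {in `[0, +oo[ &, {homo f : s t / s < t}})
  (f_gt0 : {in `]0, +oo[, forall t, 0 < f t})
  (l_cont : {within `[0, +oo[, continuous l})
  (l_gt0 : {in `]0, +oo[, forall t, 0 < l t})
  (C_ge1 : 1 <= C)
  (l_mono : C_monotone_nondecreasing C l)
  (K_0 : L1_at_0 (Kdensity phi l))
  (K_infty : ~ L1_at_infty (Kdensity phi l))
  (phi_l : (fun t => phi t / l t) =o_ (0^'+) (fun=> 1 : R))
  (KO : L1_at_infty (fun t => (inv_pos (Kfun phi l) (Ffun f t))^-1))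
  (u_C1 : Ck 1 u)
  (u_ge0 : forall x, 0 <= u x)
  (u_sol : weak_solution phi f l u) :
  (exists c, forall x, u x = c) /\ (0 < l 0 -> forall x, u x = 0).
Proof.
have pos (t : R) : 0 < t -> t \in `]0, +oo[ by rewrite in_itv/= andbT.
have phiD (t : R) : 0 < t -> is_derive t 1 phi (derive1 phi t).
  by move=> t0; rewrite derive1E; apply/derivableP/phi_derivable/pos.
have phi'0 (t : R) : 0 < t -> 0 < derive1 phi t by move=> /pos; exact: phi'_gt0.
have l0 (t : R) : 0 < t -> 0 < l t by move=> /pos; exact: l_gt0.
have phi_le (s t : R) : 0 <= s -> s <= t -> phi s <= phi t.
  move=> s0 st; apply: (mono_le st (df := derive1 phi)).
  - apply: continuous_subspaceW phi_cont => x /=; rewrite !in_itv/= andbT.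
    by move=> /andP[sx _]; exact: le_trans sx.
  - by move=> x /andP[sx _]; apply: phiD; exact: le_lt_trans sx.
  - by move=> x /andP[sx _]; apply/ltW/phi'0; exact: le_lt_trans sx.
have [F1 F1D [F10 FE]] := Ffun_extension f_cont.
pose K := Kfun phi l; pose Ki := inv_pos K; pose k := Kdensity phi l.
have KD := is_derive_Kfun phi'_cont phi'_gt0 l_cont l_gt0 K_0.
have Klt := Kfun_lt phi'_cont phi'_gt0 l_cont l_gt0 K_0.
have KiP := inv_Kfun phi'_cont phi'_gt0 l_cont l_gt0 K_0 K_infty.
have K0 : K 0 = 0 := Kfun0 phi l.
have kE (t : R) : 0 < t -> k t = t * derive1 phi t / l t by [].
have KiD := is_derive_Ki phi'0 l0 kE KD K0 Klt KiP.
have Ki0 := Ki_gt0 K0 KiP.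
have KO' : exists A B (G : R -> R), 0 <= A /\ forall x : R, A < x ->
    is_derive x 1 G (Ki (F1 x))^-1 /\ G x <= B.
  have [A [B [G [A0 HG]]]] := tail_primitive f_cont f_gt0 Ki0
    (fun y y0 => is_derive_cont (KiD y y0)) KO.
  exists A, B, G; split => // x Ax; rewrite -FE; first exact: HG.
  by rewrite (le_trans A0)// ltW.
have phi_l' (d : R) : 0 < d -> exists2 r : R, 0 < r &
    forall t : R, 0 < t <= r -> phi t <= d * l t.
  move=> d0; have /eqoP/(_ d d0)[e /= e0 He] := phi_l.
  exists (e / 2); first by rewrite divr_gt0.
  move=> t /andP[t0 te]; rewrite -ler_pdivrMr ?l0// (le_trans (ler_norm _))//.
  have := He t; rewrite normr1 mulr1; apply => //=.
  by rewrite sub0r normrN gtr0_norm//; lra.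
have [[c uc]|nc] := pselect (exists c, forall x, u x = c).
  split; first by exists c.
  move=> l00 x; rewrite uc; apply/eqP; rewrite eq_le -{2}(uc 0) u_ge0 andbT leNgt.
  apply/negP => c0.
  (* For a positive constant [c] the left side of the weak inequality is [0], while the right side
     is [f c * l 0] times the integral of the cutoff, which is positive. *)
  pose z := @cutoff R m 1.
  have zsupp y : ~ cube 1 y -> z y = 0.
    by move=> /existsNP[i /negP]; rewrite -ltNge => /ltW/cutoff_eq0.
  have Cz : Cinfty z by move=> n; exact: Ck_cutoff.
  have ccz : cc 1 z by split => //; exact: (Cz 0).
  have tz : test_function z by exact: test_function_supp zsupp.
  have pu0 y : grad u y = 0.
    have -> : u = fun=> c by apply/funext.
    by apply/rowP => i; rewrite !mxE /partial derive_cst.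
  have := u_sol z tz (@cutoff_ge0 R m 1).
  have -> : (fun y => (enorm (grad u y))^-1 * phi (enorm (grad u y)) *
      inner (grad u y) (grad z y)) = fun y => 0 * z y.
    apply/funext => y; rewrite mul0r /inner big1 ?mulr0// => i _.
    by rewrite pu0 mxE mul0r.
  have e0 : enorm (0 : 'rV[R]_m) = 0.
    by rewrite /enorm /inner big1 ?sqrtr0// => i _; rewrite mxE mul0r.
  have -> : (fun y => f (u y) * l (enorm (grad u y)) * z y) =
      fun y => f c * l 0 * z y.
    by apply/funext => y; rewrite pu0 e0 uc.
  rewrite !(integral_Rn_Z _ ccz) mul0r oppr0 leNgt mulr_gt0 ?mulr_gt0 ?f_gt0 ?pos//.
  apply: (integral_Rn_gt0 (x0 := 0) ccz (@cutoff_ge0 R m 1)).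
  by apply: cutoff_gt0 => i; rewrite mxE normr0.
exfalso; have [p [q upq]] : exists p q, u p < u q.
  apply: contrapT => H; apply: nc; exists (u 0) => x.
  by have [h|h|//] := ltgtP (u x) (u 0); exfalso; apply: H; [exists x, 0|exists 0, x].
(* [d] is half the gap [u q - u p]. The profile starts at [d / 4] and is still at most [d / 2] at
   the radius of [q], while [u] stays below [u0 = u q - d] near [p]. *)
pose u0 := (u p + u q) / 2; pose d := u q - u0.
have d0 : 0 < d by rewrite /d /u0; lra.
have u00 : 0 <= u0 by have := u_ge0 p; have := u_ge0 q; rewrite /u0; lra.
have cu : continuous u := Ck_cont u_C1.
have /cvgrPdist_lt/(_ _ d0)/nbhs_ballP[e /= e0 He] := cu p.
have u_small x : radius p x < e -> u x < u0.
  move=> xe; have : `|u p - u x| < d.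
    apply: He; apply: mx_ballE => // i.
    apply: le_lt_trans xe; rewrite distrC.
    by have := coord_le_enorm (x - p) i; rewrite !mxE.
  by rewrite /d /u0 ltr_norml => /andP[h _]; lra.
pose t0 := e / 2; pose t1 := radius p q.
have t00 : 0 < t0 by rewrite divr_gt0.
have t0e : t0 < e by rewrite /t0; lra.
have t01 : t0 <= t1.
  rewrite leNgt; apply/negP => h; have := u_small q (lt_trans h t0e).
  by move: d0; rewrite /d; lra.
have ed : 0 < d / 4 < d / 2 by apply/andP; split; lra.
have f_cont0 (t : R) : 0 < t -> {for t, continuous f} := within0y_cont f_cont (x := t).
have l_cont0 (t : R) : 0 < t -> {for t, continuous l} := within0y_cont l_cont (x := t).
have l_le (s t : R) : 0 < s -> s <= t -> l s <= C * l t.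
  by move=> s0; apply: C_monotone_le => //; exact: ltW.
have [T HT] := barrier phiD phi'0 f_cont0 (incr_le f_incr) (pos_gt0 f_gt0) F10 F1D
  l_cont0 l0 C_ge1 l_le kE KD K0 Klt KiP phi_l' KO' (ler0n R m.-1) t00 t01 ed.
have [B B0 HB] := cont_bounded (@annulus_compact _ _ p 0 T) (continuous_subspaceT cu).
have uB x : radius p x <= T -> u x <= B.
  move=> xT; apply: le_trans (ler_norm _) (HB x _).
  by rewrite /= xT radius_ge0.
have dB : d / 2 < B + d by lra.
have [r1 [al [a [b [[/andP[tr rT] al0 al1 alN] Hr]]]]] := HT _ dB.
have phic := max0_cont phi_cont; have fc := max0_cont f_cont; have lc := max0_cont l_cont.
(* The level [u q - d / 2 = u0 + d / 2] is positive and is reached by [w] at [q]. On the inner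
   sphere [w < u0 - d / 4]; on the outer one [u <= B] and [al = B + d], so [w <= - d]. *)
apply: (@annulus_comparison R m phi f l u phic phi_le phi0 fc (incr_lt f_incr) lc l0
  u_C1 u_ge0 u_sol p q t0 r1 (u q - d / 2) al a b m_ge1 t00) => //.
- by move: u00 d0; rewrite /d; lra.
- by move=> r /Hr[[]].
- by move=> r /Hr[[_ _ h] _]; apply: lt_le_trans h; lra.
- by move=> r /Hr[[]].
- by move=> r /Hr[_ []].
- by move=> r /Hr[_ []].
- by move=> r /Hr[_ []].
- by move=> r /Hr[_ []].
- move=> x [] rx; rewrite rx.
    have : u x < u0 by apply: u_small; rewrite rx.
    by move: d0; rewrite al0 /d; lra.
  have : u x <= B by apply: uB; rewrite rx.
  by rewrite alN; move: u00 d0; rewrite /d; lra.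
- by rewrite t01.
- by rewrite lerD2l lerN2.
Qed.
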